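(* (Asymmetric-AFE subconvexity, i.e. via an approximate functional equation with asymmetric truncations.) Let $\mu_\zeta$ denote the best available pointwise bound $\zeta(\tfrac12+it,\alpha)\ll_\varepsilon|t|^{\mu_\zeta+\varepsilon}$ uniform over $\alpha$ in compact subsets of $(0,1)$ (currently $\mu_\zeta=13/84$ by Bourgain). Then $$\mu_L(\tfrac12)\le\begin{cases}\dfrac{1-d}{2(2-d)}&\text{if }d\ge d^\star:=\dfrac{1-4\mu_\zeta}{1-2\mu_\zeta},\\[8pt]\mu_\zeta&\text{if }d<d^\star.\end{cases}$$ With $\mu_\zeta=13/84$ one has $d^\star=16/29\approx0.552$, so the ternary Cantor ($d\approx0.631$) falls into the first regime: $$\mu_L(\tfrac12)\le\frac{1-d}{2(2-d)}\approx0.1348.$$ For the $5$-of-$7$ Cantor measure ($d=\log5/\log7\approx0.827$) the same formula gives $\mu_L(\tfrac12)\lesssim0.0738$.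
   Context: $\nu$ is the middle-thirds (ternary) Cantor measure, a probability measure, affinely rescaled to $[\theta_0,\theta_1]=[0.5,2.0]\subset(0,2\pi)$; $d$ is its Hausdorff dimension, $d=\log2/\log3\approx0.6309$. Its Fourier coefficients are $\hat\nu(n)=\int e^{in\theta}\,d\nu(\theta)$. The Cantor Dirichlet series is $L(s)=\int_{\operatorname{supp}\nu}F(\theta,s)\,d\nu(\theta)=\sum_{n\ge1}\hat\nu(n)n^{-s}$, where $F(\theta,s)=\sum_{n\ge1}e^{in\theta}n^{-s}$ is the periodic zeta function (analytically continued); $L$ is entire of order $1$. The bound is written in terms of the dimension $d$; for the $5$-of-$7$ Cantor measure (the analogous Cantor measure obtained by keeping $5$ of $7$ equal subintervals at each stage, of dimension $\log5/\log7$), $L$ and $d$ refer to that measure in place of the ternary one. $\zeta(s,\alpha)$ is the Hurwitz zeta function, the continuation of $\sum_{m\ge0}(m+\alpha)^{-s}$. The Lindelöf order function is $\mu_L(\sigma)=\inf\{\beta\ge0:L(\sigma+it)=O(|t|^\beta)\text{ as }|t|\to\infty\}$. *)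

(* Defs.v *)
From HB Require Import structures.
From mathcomp Require Import all_boot all_order all_algebra.
From mathcomp Require Import all_classical all_reals all_analysis.
From mathcomp.real_closed Require Import complex.

Set Implicit Arguments.
Unset Strict Implicit.
Unset Printing Implicit Defensive.

Import Order.TTheory GRing.Theory Num.Theory.
Import numFieldNormedType.Exports.

Local Open Scope classical_set_scope.
Local Open Scope ring_scope.

Section complex_analysis.
Variable R : realType.
Local Notation C := (R[i]).
Local Notation cnorm := (@Normc.normc R).

Definition cexp (z : C) : C :=
  Complex (expR (complex.Re z) * cos (complex.Im z))
          (expR (complex.Re z) * sin (complex.Im z)).

(* x ^ z with the principal branch; only used for x > 0. *)
Definition cpow (x : R) (z : C) : C := cexp (z * Complex (ln x) 0).

(* The regular algebra [C^o] carries the normed topology of [C]. *)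
Definition csum (u : nat -> C) (l : C) : Prop :=
  series (u : nat -> C^o) @ \oo --> (l : C^o).

Definition analytic_at (g : C -> C) (z : C) : Prop :=
  exists (a : nat -> C) (r : R), 0 < r /\
    forall w : C, cnorm (w - z) < r ->
      csum (fun n => a n * (w - z) ^+ n) (g w).

(* [F theta s]: for 0 < theta < 2 pi the continuation is entire in s. *)
Definition is_periodic_zeta (F : R -> C -> C) : Prop :=
  forall theta : R, 0 < theta < 2 * pi ->
    (forall s, analytic_at (F theta) s) /\
    (forall s, 1 < complex.Re s ->
      csum (fun n => cexp (Complex 0 (n.+1%:R * theta)) * cpow n.+1%:R (- s))
           (F theta s)).

(* [zeta s alpha] is meromorphic in s with its only pole at s = 1, where its
   value is left arbitrary. *)
Definition is_hurwitz_zeta (zeta : C -> R -> C) : Prop :=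
  forall alpha : R, 0 < alpha ->
    (forall s, s != 1 -> analytic_at (zeta^~ alpha) s) /\
    (forall s, 1 < complex.Re s ->
      csum (fun m => cpow (m%:R + alpha) (- s)) (zeta s alpha)).

(* zeta(1/2 + it, alpha) <<_eps |t|^(mu + eps), uniformly for alpha in compact
   subsets of (0, 1). *)
Definition hurwitz_exponent (zeta : C -> R -> C) (mu : R) : Prop :=
  forall K : set R, compact K -> K `<=` `]0, 1[ ->
  forall eps : R, 0 < eps ->
  exists B T : R, forall alpha t : R, K alpha -> T <= `|t| ->
    cnorm (zeta (Complex (1 / 2) t) alpha) <= B * `|t| `^ (mu + eps).

(* Taken in [\bar R]: equal to +oo when L has no polynomial bound. *)
Definition lindelof (L : C -> C) (sigma : R) : \bar R :=
  ereal_inf [set beta%:E | beta in [set beta : R | 0 <= beta /\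
    exists B T : R, forall t : R, T <= `|t| ->
      cnorm (L (Complex sigma t)) <= B * `|t| `^ beta]].

End complex_analysis.

Section hausdorff_dimension.
Variable R : realType.
Local Open Scope ereal_scope.

(* The point 0 is adjoined so that the empty set has diameter 0. *)
Definition set_diam (A : set R) : \bar R :=
  ereal_sup (0 |` [set (`|p.1 - p.2|)%:E | p in A `*` A]).

(* The convention 0 `^ 0 = 1 only affects s = 0, which does not change
   [hausdorff_dim]. *)
Definition hausdorff_content (s delta : R) (A : set R) : \bar R :=
  ereal_inf [set \sum_(0 <= i <oo) (set_diam (U i) `^ s)
            | U in [set U : nat -> set R |
                A `<=` \bigcup_i U i /\ forall i, set_diam (U i) <= delta%:E]].

Definition hausdorff_measure (s : R) (A : set R) : \bar R :=
  ereal_sup [set hausdorff_content s delta A | delta in [set delta : R | (0 < delta)%R]].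

Definition hausdorff_dim (A : set R) : \bar R :=
  ereal_inf [set s%:E | s in [set s : R | (0 <= s)%R /\ hausdorff_measure s A = 0]].

End hausdorff_dimension.

Section cantor.
Variable R : realType.
Local Notation C := (R[i]).
Local Notation prob := (probability (measurableTypeR R) R).

Definition theta0 : R := 1 / 2.
Definition theta1 : R := 2.

(* Left endpoint of the stage-n interval with base-b address w, whose length is
   (theta1 - theta0) / b ^ n. *)
Definition cell_left (b n : nat) (w : 'I_b ^ n) : R :=
  theta0 + (theta1 - theta0) * \sum_(j < n) (w j)%:R / b%:R ^+ j.+1.

Definition cell (b n : nat) (w : 'I_b ^ n) : set R :=
  `[cell_left w, cell_left w + (theta1 - theta0) / b%:R ^+ n].

(* Keeping at each stage the subintervals with index in D, the mass is shared
   equally between the #|D| ^ n stage-n intervals; for #|D| > 1 this determines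
   the probability measure. *)
Definition is_cantor_measure (b : nat) (D : {set 'I_b}) (nu : prob) : Prop :=
  forall (n : nat) (w : 'I_b ^ n), (forall j, w j \in D) ->
    nu (cell w) = ((#|D|%:R ^+ n)^-1)%:E.

Definition is_ternary_cantor (nu : prob) : Prop :=
  is_cantor_measure ([set ord0; ord_max]%SET : {set 'I_3}) nu.

Definition is_5_of_7_cantor (nu : prob) : Prop :=
  exists2 D : {set 'I_7}, #|D| = 5%N & is_cantor_measure D nu.

Definition msupport (nu : prob) : set R :=
  [set x | forall U : set R, open U -> U x -> (0 < nu U)%E].

Definition cantor_dim (nu : prob) : R := fine (hausdorff_dim (msupport nu)).

Definition cantor_L (F : R -> C -> C) (nu : prob) (s : C) : C :=
  Complex (\int[nu]_(theta in msupport nu) complex.Re (F theta s))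
          (\int[nu]_(theta in msupport nu) complex.Im (F theta s)).

Definition dstar (mu : R) : R := (1 - 4 * mu) / (1 - 2 * mu).

End cantor.

(* Main.v *)
Require Import Defs.
From mathcomp Require Import all_boot all_order all_algebra.
From mathcomp Require Import all_classical all_reals all_analysis.
From mathcomp.real_closed Require Import complex.
From mathcomp Require Import ring lra.
From mathcomp Require Import zify.

Set Implicit Arguments.
Unset Strict Implicit.
Unset Printing Implicit Defensive.

Import Order.TTheory GRing.Theory Num.Theory.
Import numFieldNormedType.Exports.

Local Open Scope classical_set_scope.
Local Open Scope ring_scope.

(** Throughout [s = 1 / 2 + i t]. Let [m] be the number of digits kept in base
    [b], so that [d = ln m / ln b]. The two lines of the bound come from two
    different arguments.

    The bound [(1 - d) / (2 (2 - d))]. The integral defining [L] is the limit of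
    the averages of [F(theta, s)] over the left endpoints [theta] of the kept
    intervals of stage [k] ([cantor_L_le]), so it suffices to bound these averages
    uniformly in [k]. Replace [F] by its partial sum of length [N]. By van der
    Corput's method the error is [O(sqrt(|t| / N) + 1)], uniformly for [theta] away
    from [2 pi Z], once [N ^ 2 >= |t|] ([F_approx]). The average of the partial sum
    is [sum_(n < N) c_n n ^ (- s)], where the [c_n] are the Fourier coefficients of
    the averaging measure. An interval of length [b ^ (- j)] has mass at most
    [3 m ^ (- j)], and this gives [sum_(n < N) |c_n| ^ 2 = O(N ^ (1 - d))] for
    [N = b ^ J] ([strichartz]); Cauchy-Schwarz then bounds the main sum by
    [N ^ ((1 - d) / 2)] up to a logarithm ([main_sum]). Both errors have the size
    [|t| ^ ((1 - d) / (2 (2 - d)))] when [N] is about [|t| ^ (1 / (2 - d))]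
    ([cantor_L_bound]).

    The bound [mu_zeta]. Here [|L|] is at most the supremum of [|F(theta, s)|], and
    [F] is compared with the Hurwitz zeta function on the conjugate line
    ([F_le_zeta]). Both [F(2 pi alpha, s)] and [zeta(1 - s, alpha)] satisfy, as
    functions of [alpha], the same Kubert distribution relations, whose solutions
    are determined by their singularities at [alpha = 0] and [alpha = 1]
    ([kubert_basis], after Milnor). Hence
    [F(2 pi alpha, s) = c zeta(1 - s, alpha) + c' zeta(1 - s, 1 - alpha)], and [c]
    and [c'] are bounded in [t] because van der Corput's method also controls the
    growth of [F] at both ends ([F_singular_bound]). As [lindelof] only involves
    nonnegative exponents, [mu_zeta < 0] has to be excluded: otherwise [F(1, s)]
    would tend to [0], but its mean over a long range of [t] is close to its first
    coefficient, of modulus [1] ([F1_not_decaying]).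

    For [0 < Re s <= 1] the function [F] and the differences of Hurwitz zeta
    functions are still limits of their partial sums, by the identity theorem along
    horizontal lines ([ran_identity]). On the side of the measure, the masses of the kept intervals
    are given but those of their endpoints are not; these have mass [0]
    ([shared_eq0], [pr_point]), which identifies the support with the limit set
    ([msupportP]) and gives its dimension by the mass distribution principle
    ([frostman], [cantor_hausdorff_dim]). *)

(** * Complex numbers: modulus, unit circle, limits *)

Section ComplexBasics.
Variable R : realType.
Local Notation C := (R[i]).
Local Notation nrm := (@Normc.normc R).

Lemma nrm_ge0 (z : C) : 0 <= nrm z.
Proof. by case: z => a b /=; apply: sqrtr_ge0. Qed.

Lemma nrm0 : nrm (0 : C) = 0. Proof. exact: Normc.normc0. Qed.

Lemma nrm1 : nrm (1 : C) = 1. Proof. exact: Normc.normc1. Qed.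

Lemma nrmM (x y : C) : nrm (x * y) = nrm x * nrm y.
Proof. exact: Normc.normcM. Qed.

Lemma nrmV (x : C) : nrm x^-1 = (nrm x)^-1.
Proof. exact: Normc.normcV. Qed.

Lemma nrmD (x y : C) : nrm (x + y) <= nrm x + nrm y.
Proof. exact: le_normcD. Qed.

Lemma nrmN (x : C) : nrm (- x) = nrm x.
Proof. exact: normcN. Qed.

Lemma nrmB (x y : C) : nrm (x - y) <= nrm x + nrm y.
Proof. by rewrite -(nrmN y) nrmD. Qed.

Lemma nrmBC (x y : C) : nrm (x - y) = nrm (y - x).
Proof. by rewrite -nrmN opprB. Qed.

Lemma nrm_triangle (z x y : C) : nrm (x - y) <= nrm (x - z) + nrm (z - y).
Proof. by have := nrmD (x - z) (z - y); rewrite addrA subrK. Qed.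

Lemma nrmX (x : C) n : nrm (x ^+ n) = nrm x ^+ n.
Proof. by elim: n => [|n IH]; rewrite ?expr0 ?nrm1// !exprS nrmM IH. Qed.

Lemma nrm_eq0 (x : C) : (nrm x == 0) = (x == 0).
Proof.
apply/eqP/eqP => [|->]; [exact: Normc.eq0_normc | exact: nrm0].
Qed.

Lemma nrm_real (a : R) : nrm a%:C%C = `|a|.
Proof. by rewrite /= expr0n /= addr0 sqrtr_sqr. Qed.

Lemma nrm_sum I (r : seq I) (P : pred I) (F : I -> C) :
  nrm (\sum_(i <- r | P i) F i) <= \sum_(i <- r | P i) nrm (F i).
Proof.
elim/big_rec2: _ => [|i y x _ H]; first by rewrite nrm0.
by apply: le_trans (nrmD _ _) _; rewrite lerD2l.
Qed.

Lemma nrm_sqr (z : C) : nrm z ^+ 2 = complex.Re z ^+ 2 + complex.Im z ^+ 2.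
Proof. by case: z => a b /=; rewrite sqr_sqrtr // addr_ge0 ?sqr_ge0. Qed.

Lemma nrm_Re (z : C) : `|complex.Re z| <= nrm z.
Proof.
rewrite -[leRHS]ger0_norm ?nrm_ge0 // -ler_sqr ?nnegrE // !real_normK ?num_real //.
by rewrite nrm_sqr lerDl sqr_ge0.
Qed.

Lemma nrm_Im (z : C) : `|complex.Im z| <= nrm z.
Proof.
rewrite -[leRHS]ger0_norm ?nrm_ge0 // -ler_sqr ?nnegrE // !real_normK ?num_real //.
by rewrite nrm_sqr lerDr sqr_ge0.
Qed.

Lemma nrm_ReIm (z : C) : nrm z <= `|complex.Re z| + `|complex.Im z|.
Proof.
rewrite -ler_sqr ?nnegrE ?nrm_ge0 ?addr_ge0 // nrm_sqr sqrrD.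
rewrite !real_normK ?num_real // -addrA [_ *+ 2 + _]addrC addrA lerDl.
by rewrite mulrn_wge0 // mulr_ge0.
Qed.

Lemma ReB (x y : C) : complex.Re (x - y) = complex.Re x - complex.Re y.
Proof. by case: x => ? ?; case: y. Qed.
Lemma ImB (x y : C) : complex.Im (x - y) = complex.Im x - complex.Im y.
Proof. by case: x => ? ?; case: y. Qed.
Lemma ReD (x y : C) : complex.Re (x + y) = complex.Re x + complex.Re y.
Proof. by case: x => ? ?; case: y. Qed.
Lemma ImD (x y : C) : complex.Im (x + y) = complex.Im x + complex.Im y.
Proof. by case: x => ? ?; case: y. Qed.
Lemma Re_sum I (r : seq I) (P : pred I) (F : I -> C) :
  complex.Re (\sum_(i <- r | P i) F i) = \sum_(i <- r | P i) complex.Re (F i).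
Proof. by apply: (big_morph _ ReD). Qed.
Lemma Im_sum I (r : seq I) (P : pred I) (F : I -> C) :
  complex.Im (\sum_(i <- r | P i) F i) = \sum_(i <- r | P i) complex.Im (F i).
Proof. by apply: (big_morph _ ImD). Qed.

Definition cis (x : R) : C := Complex (cos x) (sin x).

Lemma cisD x y : cis (x + y) = cis x * cis y.
Proof. by rewrite /cis cosD sinD; simpc; congr Complex; ring. Qed.

Lemma cis0 : cis 0 = 1. Proof. by rewrite /cis cos0 sin0. Qed.

Lemma nrm_cis x : nrm (cis x) = 1.
Proof. by rewrite /= cos2Dsin2 sqrtr1. Qed.

Lemma cis_neq0 x : cis x != 0.
Proof. by rewrite -nrm_eq0 nrm_cis oner_eq0. Qed.

Lemma cisN x : cis (- x) = (cis x)^-1.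
Proof. by apply: (mulfI (cis_neq0 x)); rewrite -cisD subrr cis0 mulfV ?cis_neq0. Qed.

Lemma cis2pi : cis (2 * pi) = 1.
Proof. by rewrite /cis mulr_natl cos2pi sin2pi. Qed.

Lemma cis_period_nat x (n : nat) : cis (x + n%:R * (2 * pi)) = cis x.
Proof.
elim: n => [|n IH]; first by rewrite mul0r addr0.
by rewrite -natr1 mulrDl mul1r addrA cisD IH cis2pi mulr1.
Qed.

Lemma cis_period_int x (k : int) : cis (x + k%:~R * (2 * pi)) = cis x.
Proof.
case: k => n; first exact: cis_period_nat.
by rewrite -(cis_period_nat (_ + _) n.+1) NegzE mulrNz mulNr -pmulrn subrK.
Qed.

Lemma cis_natM (n : nat) x : cis (n%:R * x) = cis x ^+ n.
Proof.
elim: n => [|n IH]; first by rewrite mul0r cis0.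
by rewrite -natr1 mulrDl mul1r cisD IH exprSr.
Qed.

Lemma cexpE (z : C) : cexp z = (expR (complex.Re z))%:C%C * cis (complex.Im z).
Proof. by rewrite /cexp /cis; simpc. Qed.

Lemma cexp_imag (x : R) : cexp (Complex 0 x) = cis x.
Proof. by rewrite cexpE /= expR0 mul1r. Qed.

(** The elementary inequalities on the circle are all that is used of
    trigonometry: chords are comparable with arcs. *)
Lemma sin_le_id (x : R) : 0 <= x -> sin x <= x.
Proof.
rewrite le_eqVlt => /predU1P[<-|x0]; first by rewrite sin0.
have [c _] := @MVT R (@sin R) (@cos R) 0 x x0 (fun y _ => is_derive_sin y)
   (@continuous_subspaceT _ _ _ _ (@continuous_sin R)).
by rewrite sin0 !subr0 => ->; rewrite ger_pMl // cos_le1.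
Qed.

Lemma norm_sin_le (x : R) : `|sin x| <= `|x|.
Proof.
wlog x0 : x / 0 <= x => [H|].
  by have [/H//|/ltW x0] := leP 0 x; rewrite -normrN -(normrN x) -sinN H ?oppr_ge0.
have [xp|xp] := leP x 1; last first.
  by rewrite (le_trans (sin_max _))// ger0_norm ?(le_trans (ltW xp)).
rewrite !ger0_norm ?sin_le_id // sin_ge0_pi // x0 (le_trans xp) //.
by rewrite (le_trans _ (pi_ge2 R)) // ler1n.
Qed.

Lemma cos_ge_quadratic (x : R) : 1 - x ^+ 2 / 2 <= cos x.
Proof.
have -> : x = (x / 2) *+ 2 by rewrite -mulr_natr; field.
rewrite cos_mulr2n cos2sin2.
have : sin (x / 2) ^+ 2 <= (x / 2) ^+ 2.
  by rewrite -[leLHS]real_normK ?num_real // -[leRHS]real_normK ?num_real // ler_sqr ?nnegrE// norm_sin_le.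
by set a := sin _ => h; rewrite -mulr_natr; nra.
Qed.

Lemma sin_ge_linear (x : R) : 0 <= x <= pi / 2 -> x / 4 <= sin x.
Proof.
have H (y : R) : 0 <= y <= 1 -> y / 2 <= sin y.
  move=> /andP[]; rewrite le_eqVlt => /predU1P[<-|y0 y1]; first by rewrite sin0 mul0r.
  have [c] := @MVT R (@sin R) (@cos R) 0 y y0 (fun y _ => is_derive_sin y)
   (@continuous_subspaceT _ _ _ _ (@continuous_sin R)).
  rewrite sin0 !subr0 in_itv /= => /andP[c0 cy] ->.
  have := cos_ge_quadratic c; nra.
move=> /andP[x0 x2]; have [x1|x1] := leP x 1.
  by have := H x; rewrite x0 x1 => /(_ isT); lra.
have h1 : 1 / 2 <= sin (1 : R) by apply: H; rewrite lexx ler01.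
have : sin 1 < sin x.
  rewrite ltr_sin ?x1 // in_itv /=; have := pi_gt0 R; have := pihalf_ge1 R => ? ?; apply/andP; split; lra.
have := pihalf_lt2 R; lra.
Qed.

Lemma chord_formula (x : R) : nrm (1 - cis x) = 2 * `|sin (x / 2)|.
Proof.
have -> : 2 * `|sin (x / 2)| = `|2 * sin (x / 2)| by rewrite normrM (ger0_norm (_ : 0 <= 2)).
apply/eqP; rewrite -(@eqrXn2 _ 2) ?nrm_ge0 //; apply/eqP.
rewrite nrm_sqr real_normK ?num_real // ReB ImB /=.
have xE : x = (x / 2) *+ 2 by rewrite -mulr_natr; field.
have -> : cos x = 1 - 2 * sin (x / 2) ^+ 2.
  by rewrite {1}xE cos_mulr2n cos2sin2 -mulr_natr; ring.
have -> : sin x = 2 * (cos (x / 2) * sin (x / 2)).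
  by rewrite {1}xE sin_mulr2n -mulr_natr; ring.
have := cos2Dsin2 (x / 2); set c := cos _; set s := sin _ => h.
transitivity (4 * s ^+ 2 * (c ^+ 2 + s ^+ 2)); first by ring.
by rewrite h; ring.
Qed.

Lemma chord_le (x : R) : nrm (1 - cis x) <= `|x|.
Proof.
rewrite chord_formula; apply: le_trans (ler_wpM2l _ (norm_sin_le _)) _ => //.
by rewrite normrM [`|2^-1|]ger0_norm ?invr_ge0 //; lra.
Qed.

Lemma chord_dist (x y : R) : nrm (cis x - cis y) <= `|x - y|.
Proof.
have -> : cis x - cis y = cis x * (1 - cis (y - x)).
  by rewrite mulrBr mulr1 -cisD [x + _]addrC subrK.
by rewrite nrmM nrm_cis mul1r distrC chord_le.
Qed.

Lemma chord_ge (e x : R) : 0 <= e -> e <= x <= 2 * pi - e -> e / 4 <= nrm (1 - cis x).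
Proof.
move=> e0 /andP[ex xe]; rewrite chord_formula.
have H (y : R) : e / 2 <= y <= pi / 2 -> e / 8 <= `|sin y|.
  move=> /andP[y1 y2]; have := @sin_ge_linear y; rewrite y2 andbT.
  move=> /(_ ltac:(lra)) h; apply: le_trans (ler_norm _); lra.
have [h|h] := leP (x / 2) (pi / 2).
  by have := H (x / 2); rewrite h => /(_ ltac:(lra)); lra.
have : e / 8 <= `|sin (pi - x / 2)| by apply: H; apply/andP; split; lra.
rewrite addrC sinDpi sinN normrN normrN; lra.
Qed.

Lemma chord_ge_small (x : R) : `|x| <= 2 -> `|x| / 4 <= nrm (1 - cis x).
Proof.
move=> h; have -> : nrm (1 - cis x) = nrm (1 - cis `|x|).
  rewrite !chord_formula; case: (ger0P x) => // _.
  by rewrite mulNr sinN normrN.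
apply: chord_ge => //; rewrite lexx /=; have := pi_ge2 R; lra.
Qed.

End ComplexBasics.
Arguments cis {R}.
Arguments Normc.normc : simpl never.

Section ComplexLimits.
Variable R : realType.
Local Notation C := (R[i]).
Local Notation nrm := (@Normc.normc R).

(** Epsilon form of the convergence of partial sums, which avoids carrying the
    normed structure of [C^o]. *)
Definition ccvg (u : nat -> C) (l : C) : Prop :=
  forall e : R, 0 < e -> exists N, forall n, (N <= n)%N -> nrm (u n - l) <= e.

Lemma csumP (u : nat -> C) l :
  csum u l <-> ccvg (fun n => \sum_(k < n) u k) l.
Proof.
rewrite /csum; split.
  move=> /cvgrPdist_le H e e0.
  have e0C : 0 < e%:C%C :> C by rewrite ltcR.
  have [N _ HN] := H _ e0C; exists N => n /HN.
  rewrite /series /= big_mkord => h.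
  by rewrite nrmBC -lecR.
move=> H; apply/cvgrPdist_le => e; case: e => a b; rewrite ltcE /= => /andP[/eqP b0 a0].
have [N HN] := H a a0; exists N => // n /= /HN.
rewrite nrmBC => h; rewrite /series /= big_mkord.
by rewrite -[_ <= _]/((nrm _)%:C%C <= _) lecE /= b0 eqxx.
Qed.

Lemma ccvg_unique u l l' : ccvg u l -> ccvg u l' -> l = l'.
Proof.
move=> h h'; apply/eqP; rewrite -subr_eq0 -nrm_eq0; apply/negPn/negP => n0.
have n1 : 0 < nrm (l - l') by rewrite lt_neqAle eq_sym n0 nrm_ge0.
have [N HN] := h (nrm (l - l') / 4) ltac:(lra).
have [N' HN'] := h' (nrm (l - l') / 4) ltac:(lra).
have := nrm_triangle (u (maxn N N')) l l'.
rewrite (nrmBC l (u _)).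
have := HN _ (leq_maxl N N'); have := HN' _ (leq_maxr N N'); lra.
Qed.

Lemma ccvg_eventually u v l N :
  (forall n, (N <= n)%N -> u n = v n) -> ccvg u l -> ccvg v l.
Proof.
move=> h hu e /hu[N' HN]; exists (maxn N N') => n; rewrite geq_max => /andP[n1 n2].
by rewrite -h // HN.
Qed.

Lemma ccvg_ext u v l : u =1 v -> ccvg u l -> ccvg v l.
Proof. by move=> h; apply: (@ccvg_eventually _ _ _ 0) => n _; apply: h. Qed.

Lemma ccvg_cst l : ccvg (fun=> l) l.
Proof. by move=> e e0; exists 0%N => n _; rewrite subrr nrm0 ltW. Qed.

Lemma ccvgD u v l l' : ccvg u l -> ccvg v l' -> ccvg (fun n => u n + v n) (l + l').
Proof.
move=> h h' e e0.
have [N HN] := h (e / 2) ltac:(lra); have [N' HN'] := h' (e / 2) ltac:(lra).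
exists (maxn N N') => n; rewrite geq_max => /andP[/HN n1 /HN' n2].
have := nrmD (u n - l) (v n - l').
rewrite (_ : u n - l + _ = u n + v n - (l + l')); [lra | ring].
Qed.

Lemma ccvgZ a u l : ccvg u l -> ccvg (fun n => a * u n) (a * l).
Proof.
move=> h e e0; have a1 : 0 < nrm a + 1 by have := nrm_ge0 a; lra.
have [N HN] := h (e / (nrm a + 1)) (divr_gt0 e0 a1); exists N => n /HN hn.
rewrite -mulrBr nrmM.
apply: le_trans (ler_wpM2l (nrm_ge0 a) hn) _.
rewrite mulrA ler_pdivrMr //; have := nrm_ge0 a; nra.
Qed.

Lemma ccvgN u l : ccvg u l -> ccvg (fun n => - u n) (- l).
Proof.
by move=> h e /h[N HN]; exists N => n /HN; rewrite -opprD nrmN.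
Qed.

Lemma ccvgB u v l l' : ccvg u l -> ccvg v l' -> ccvg (fun n => u n - v n) (l - l').
Proof. by move=> h /ccvgN; apply: ccvgD. Qed.

Lemma ccvg_sum I (s : seq I) (u : I -> nat -> C) (l : I -> C) :
  (forall i, ccvg (u i) (l i)) ->
  ccvg (fun n => \sum_(i <- s) u i n) (\sum_(i <- s) l i).
Proof.
move=> h; elim: s => [|i s IH].
  by rewrite big_nil; apply: (ccvg_ext _ (@ccvg_cst 0)) => n; rewrite big_nil.
rewrite big_cons; apply: (ccvg_ext _ (ccvgD (h i) IH)) => n /=.
by rewrite big_cons.
Qed.

Lemma ccvg_subseq (f : nat -> nat) u l :
  (forall n, (n <= f n)%N) -> ccvg u l -> ccvg (u \o f) l.
Proof.
move=> h hu e /hu[N HN]; exists N => n Nn; exact: HN (leq_trans Nn (h n)).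
Qed.

Lemma ccvg_nrm_le u l (M : R) N :
  ccvg u l -> (forall n, (N <= n)%N -> nrm (u n) <= M) -> nrm l <= M.
Proof.
move=> h hM; apply/ler_addgt0Pr => e e0.
have [N' HN] := h e e0.
have := HN _ (leq_maxr N N'); have := hM _ (leq_maxl N N').
have := nrmB (u (maxn N N')) (u (maxn N N') - l).
rewrite opprB addrC subrK; lra.
Qed.

Lemma ccvg_squeeze u l (v : nat -> R) :
  (forall e, 0 < e -> exists N, forall n, (N <= n)%N -> v n <= e) ->
  (forall n, nrm (u n - l) <= v n) -> ccvg u l.
Proof.
move=> hv h e /hv[N HN]; exists N => n /HN; exact: le_trans (h n).
Qed.

Lemma ccvg_bounded u l : ccvg u l -> exists M, forall n, nrm (u n) <= M.
Proof.
move=> /(_ 1 ltr01)[N HN].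
exists (nrm l + 1 + \sum_(k < N) nrm (u k)) => n.
have s0 : 0 <= \sum_(k < N) nrm (u k) by apply: sumr_ge0 => *; apply: nrm_ge0.
have [/HN h|h] := leqP N n.
  have := nrmD (u n - l) l; rewrite subrK; lra.
rewrite (bigD1 (Ordinal h)) //= addrCA lerDl.
by rewrite addr_ge0 ?sumr_ge0 ?addr_ge0 ?nrm_ge0 // => *; apply: nrm_ge0.
Qed.

Lemma nonneg_tail (a : nat -> R) (M : R) :
  (forall n, 0 <= a n) -> (forall n, \sum_(k < n) a k <= M) ->
  forall e, 0 < e -> exists N, forall n,
    \sum_(N <= k < n) a k <= e.
Proof.
move=> a0 aM e e0.
have hs : has_sup [set \sum_(k < n) a k | n in [set: nat]].
  split; first by exists (\sum_(k < 0) a k); exists 0%N.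
  by exists M => _ [n _ <-].
have [_ [N _ <-] hN] := sup_adherent e0 hs.
exists N => n; have [nN|Nn] := leqP n N; first by rewrite big_geq // ltW.
have := sup_upper_bound hs.
move=> /(_ (\sum_(k < n) a k)) /(_ ltac:(by exists n)).
rewrite -(big_mkord xpredT a) in hN; rewrite -(big_mkord xpredT a).
rewrite (big_cat_nat (leq0n N) (ltnW Nn)) /=.
move: hN; set x := sup _; set y := \sum_(_ <= _ < _) _; set z := \sum_(_ <= _ < _) _ => h1 h2; lra.
Qed.

Lemma abs_ccvg (u : nat -> C) (M : R) :
  (forall n, \sum_(k < n) nrm (u k) <= M) ->
  exists2 l, ccvg (fun n => \sum_(k < n) u k) l & nrm l <= M.
Proof.
move=> hM.
have H (f : C -> R) : (forall z, `|f z| <= nrm z) ->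
   exists l : R, forall e, 0 < e -> exists N, forall n, (N <= n)%N ->
      `|\sum_(k < n) f (u k) - l| <= e.
  move=> hf; have hc : cvgn (series (fun k => f (u k))).
    apply: normed_cvg; apply: nondecreasing_is_cvgn.
      by apply/nondecreasing_seqP => n; rewrite /= -subr_ge0 !seriesEnat /= big_nat_recr//= addrAC subrr add0r.
    exists M => _ [n _ <-] /=; rewrite seriesEnat /= big_mkord; apply: le_trans (hM n).
    by apply: ler_sum => i _; apply: hf.
  exists (limn (series (fun k => f (u k)))) => e e0.
  have /cvgrPdist_le/(_ _ e0)[N _ HN] := hc.
  exists N => n /HN; rewrite distrC /series /= big_mkord.
  by [].
have [a ha] := H _ (@nrm_Re R); have [b hb] := H _ (@nrm_Im R).
have hl : ccvg (fun n => \sum_(k < n) u k) (Complex a b).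
  move=> e e0; have [N HN] := ha (e / 2) ltac:(lra); have [N' HN'] := hb (e / 2) ltac:(lra).
  exists (maxn N N') => n; rewrite geq_max => /andP[/HN h1 /HN' h2].
  apply: le_trans (nrm_ReIm _) _; rewrite ReB ImB Re_sum Im_sum /=; lra.
exists (Complex a b) => //; apply: (ccvg_nrm_le (N := 0) hl) => n _.
exact: le_trans (nrm_sum _ _ _) (hM n).
Qed.

End ComplexLimits.

(** * Analytic functions along horizontal lines *)

Section RealAnalytic.
Variable R : realType.
Local Notation C := (R[i]).
Local Notation nrm := (@Normc.normc R).

(** Continuation is only ever performed along a horizontal line, so a function
    of the real part is enough; the absolute bound is part of the definition so
    that series can be rearranged. *)
Definition ran (h : R -> C) (x : R) : Prop :=
  exists a : nat -> C, exists r M : R, [/\ 0 < r,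
    forall n, \sum_(k < n) nrm (a k) * r ^+ k <= M &
    forall y, `|y| <= r ->
      ccvg (fun n => \sum_(k < n) a k * y%:C%C ^+ k) (h (x + y))].

Lemma nrm_monomial (a : C) (y r : R) k : `|y| <= r ->
  nrm (a * y%:C%C ^+ k) <= nrm a * r ^+ k.
Proof.
move=> yr; rewrite nrmM nrmX nrm_real ler_wpM2l ?nrm_ge0 //.
by rewrite lerXn2r ?nnegrE // (le_trans _ yr).
Qed.

Lemma ran_local (h h' : R -> C) x d : 0 < d ->
  (forall y, `|y| <= d -> h (x + y) = h' (x + y)) -> ran h x -> ran h' x.
Proof.
move=> d0 hh [a [r [M [r0 aM hc]]]].
exists a, (Num.min r d), M; split.
- by rewrite lt_min r0.
- move=> n; apply: le_trans (aM n); apply: ler_sum => k _.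
  rewrite ler_wpM2l ?nrm_ge0 // lerXn2r ?nnegrE ?ge_min ?lexx //; last exact: ltW.
  by rewrite le_min !ltW.
by move=> y; rewrite le_min => /andP[y1 y2]; rewrite -hh //; apply: hc.
Qed.

Lemma geometric_half n : \sum_(k < n) (2^-1 : R) ^+ k <= 2.
Proof.
suff -> : \sum_(k < n) (2^-1 : R) ^+ k = 2 - 2 * 2^-1 ^+ n.
  by rewrite lerBlDr lerDl mulr_ge0 // exprn_ge0 // invr_ge0.
elim: n => [|n IH]; first by rewrite big_ord0 expr0; ring.
by rewrite big_ord_recr /= IH exprS; field.
Qed.

Lemma analytic_ran (g : C -> C) (x t : R) :
  analytic_at g (Complex x t) -> ran (fun s => g (Complex s t)) x.
Proof.
move=> [a [r [r0 H]]].
have zE (y : R) : Complex (x + y) t - Complex x t = y%:C%C.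
  by apply/eqP; rewrite eq_complex /=; apply/andP; split; apply/eqP; ring.
have H' (y : R) : `|y| < r ->
    ccvg (fun n => \sum_(k < n) a k * y%:C%C ^+ k) (g (Complex (x + y) t)).
  by move=> yr; have := H (Complex (x + y) t); rewrite zE nrm_real => /(_ yr)/csumP.
have r2 : 0 < r / 2 by lra.
have [B hB] : exists B, forall k, nrm (a k) * (r / 2) ^+ k <= B.
  have [//|B hB] := @ccvg_bounded _ _ _ (H' (r / 2) _).
    by rewrite ger0_norm ?ltW //; lra.
  exists (B + B) => k; have h1 := hB k; have := hB k.+1.
  rewrite big_ord_recr /=; move: h1.
  set s := \sum_(i < k) _; set u := a k * _ => h1 h2.
  have <- : nrm u = nrm (a k) * (r / 2) ^+ k.
    by rewrite nrmM nrmX nrm_real ger0_norm // ltW.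
  have := nrmB (s + u) s; rewrite addrAC subrr add0r; lra.
exists a, (r / 4), (B * 2); split; first by lra.
  move=> n; apply: le_trans (_ : \sum_(k < n) B * 2^-1 ^+ k <= _).
    apply: ler_sum => k _.
    have -> : r / 4 = r / 2 * 2^-1 by field.
    by rewrite exprMn mulrA ler_wpM2r // exprn_ge0 // invr_ge0.
  rewrite -mulr_sumr ler_wpM2l ?geometric_half //.
  by have := hB 0%N; rewrite expr0 mulr1; apply: le_trans; apply: nrm_ge0.
by move=> y yr; apply: H'; lra.
Qed.

Lemma sum_nrm_lim K (u : nat -> nat -> C) (l : nat -> C) (w : nat -> R) (B : R) N0 :
  (forall k, 0 <= w k) -> (forall k, ccvg (u k) (l k)) ->
  (forall n, (N0 <= n)%N -> \sum_(k < K) nrm (u k n) * w k <= B) ->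
  \sum_(k < K) nrm (l k) * w k <= B.
Proof.
move=> w0 hl hB; apply/ler_addgt0Pr => e e0.
have [N HN] : exists N, forall n, (N <= n)%N ->
    \sum_(k < K) nrm (u k n - l k) * w k <= e.
  elim: K {hB} e e0 => [|K IH] e e0.
    by exists 0%N => n _; rewrite big_ord0 ltW.
  have [N HN] := IH (e / 2) ltac:(lra).
  have e2 : 0 < e / 2 by lra.
  have w1 : 0 < w K + 1 by have := w0 K; lra.
  have [N' HN'] := hl K (e / 2 / (w K + 1)) (divr_gt0 e2 w1).
  exists (maxn N N') => n; rewrite geq_max => /andP[/HN h1 /HN' h2].
  rewrite big_ord_recr /=.
  have : nrm (u K n - l K) * w K <= e / 2.
    apply: le_trans (ler_wpM2r (w0 K) h2) _.
    by rewrite mulrAC ler_pdivrMr // ler_wpM2l ?lerDl // ltW.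
  by move: h1; set s := \sum_(_ < _) _; lra.
have h1 := HN _ (leq_maxr N0 N); have h2 := hB _ (leq_maxl N0 N).
rewrite addrC; apply: le_trans (lerD h1 h2); rewrite -big_split /=.
apply: ler_sum => k _; rewrite -mulrDl ler_wpM2r //.
have := nrmB (u k (maxn N0 N)) (u k (maxn N0 N) - l k).
by rewrite opprB addrC subrK addrC.
Qed.

(** Weierstrass double series theorem: coefficients are summed first in [n]. *)
Lemma ran_series (h : R -> C) x r (c : nat -> nat -> C) (f : nat -> R -> C)
    (M : nat -> R) (B : R) : 0 < r ->
  (forall n K, \sum_(k < K) nrm (c n k) * r ^+ k <= M n) ->
  (forall N, \sum_(n < N) M n <= B) ->
  (forall n y, `|y| <= r -> ccvg (fun K => \sum_(k < K) c n k * y%:C%C ^+ k) (f n y)) ->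
  (forall y, `|y| <= r -> ccvg (fun N => \sum_(n < N) f n y) (h (x + y))) ->
  ran h x.
Proof.
move=> r0 hM hB hf hh.
have M0 n : 0 <= M n by have := hM n 0%N; rewrite big_ord0.
have rX k : 0 < r ^+ k by apply: exprn_gt0.
have cM n k : nrm (c n k) * r ^+ k <= M n.
  apply: le_trans (hM n k.+1); rewrite big_ord_recr /= lerDr.
  by apply: sumr_ge0 => *; rewrite mulr_ge0 ?nrm_ge0 // ltW.
have hA k : exists l, ccvg (fun N => \sum_(n < N) c n k) l.
  have [N|l hl _] := @abs_ccvg R (fun n => c n k) (B / r ^+ k); last by exists l.
  rewrite ler_pdivlMr // mulr_suml; apply: le_trans (hB N).
  by apply: ler_sum => n _; apply: cM.
have [A {}hA] := choice hA.
have swap K N N' : \sum_(k < K) nrm (\sum_(N <= n < N') c n k) * r ^+ k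
     <= \sum_(N <= n < N') M n.
  apply: le_trans (_ : \sum_(k < K) \sum_(N <= n < N') nrm (c n k) * r ^+ k <= _).
    by apply: ler_sum => k _; rewrite -mulr_suml ler_wpM2r ?nrm_sum // ltW.
  by rewrite exchange_big; apply: ler_sum => n _; apply: hM.
exists A, r, B; split => //.
  move=> K; apply: (@sum_nrm_lim K (fun k N => \sum_(n < N) c n k) A (fun k => r ^+ k) B 0 _ hA) => [k|n _].
    exact: ltW.
  apply: le_trans (hB n); have := swap K 0%N n; rewrite big_mkord.
  by under eq_bigr do rewrite big_mkord.
move=> y yr e e0.
have e3 : 0 < e / 3 by lra.
have [N1 HN1] := nonneg_tail M0 hB e3.
have [N2 HN2] := hh y yr (e / 3) e3.
pose N := maxn N1 N2.
have [K0 HK0] : exists K0, forall K, (K0 <= K)%N ->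
    nrm (\sum_(n < N) \sum_(k < K) c n k * y%:C%C ^+ k - \sum_(n < N) f n y) <= e / 3.
  have := @ccvg_sum R _ (index_enum 'I_N) (fun (n : 'I_N) K => \sum_(k < K) c n k * y%:C%C ^+ k)
    (fun n : 'I_N => f n y) (fun n => hf n y yr).
  by move=> /(_ (e / 3) e3).
exists K0 => K /HK0 h2.
have h3 := HN2 N (leq_maxr _ _).
have h1 : nrm (\sum_(k < K) (A k - \sum_(n < N) c n k) * y%:C%C ^+ k) <= e / 3.
  apply: le_trans (nrm_sum _ _ _) _.
  apply: le_trans (_ : \sum_(k < K) nrm (A k - \sum_(n < N) c n k) * r ^+ k <= _).
    by apply: ler_sum => k _; apply: nrm_monomial.
  apply: (@sum_nrm_lim K (fun k N' => \sum_(n < N') c n k - \sum_(n < N) c n k) (fun k => A k - \sum_(n < N) c n k) (fun k => r ^+ k) (e / 3) N).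
  - by move=> k; apply: ltW.
  - by move=> k; apply: ccvgB (hA k) (ccvg_cst _).
  move=> N' NN'; apply: le_trans (HN1 N'); apply: le_trans (_ : \sum_(N <= n < N') M n <= _).
    apply: le_trans (swap K N N'); apply: ler_sum => k _.
    rewrite ler_wpM2r ?(ltW (rX _)) //.
    rewrite -!(big_mkord xpredT (fun n => c n k)) (big_cat_nat (leq0n N) NN') /=.
    by rewrite addrAC subrr add0r.
  by rewrite [leRHS](big_cat_nat (leq_maxl N1 N2) NN') /= lerDr sumr_ge0.
move: h1 h2 h3.
rewrite exchange_big /=.
have -> : \sum_(k < K) (A k - \sum_(n < N) c n k) * y%:C%C ^+ k =
   \sum_(k < K) A k * y%:C%C ^+ k - \sum_(k < K) \sum_(n < N) c n k * y%:C%C ^+ k.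
  by rewrite -sumrB; apply: eq_bigr => k _; rewrite mulrBl mulr_suml.
set a := \sum_(k < K) A k * _; set b := \sum_(k < K) _; set d := \sum_(n < N) _.
move=> h1 h2 h3.
have := nrm_triangle b a (h (x + y)); have := nrm_triangle d b (h (x + y)); lra.
Qed.

End RealAnalytic.

Section RanClosure.
Variable R : realType.
Local Notation C := (R[i]).
Local Notation nrm := (@Normc.normc R).

Lemma ran_shrink (h : R -> C) x d : 0 < d -> ran h x ->
  exists a : nat -> C, exists r M : R, [/\ 0 < r, r <= d,
    forall n, \sum_(k < n) nrm (a k) * r ^+ k <= M &
    forall y, `|y| <= r ->
      ccvg (fun n => \sum_(k < n) a k * y%:C%C ^+ k) (h (x + y))].
Proof.
move=> d0 [a [r [M [r0 aM hc]]]].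
exists a, (Num.min r d), M; split.
- by rewrite lt_min r0.
- by rewrite ge_min lexx orbT.
- move=> n; apply: le_trans (aM n); apply: ler_sum => k _.
  rewrite ler_wpM2l ?nrm_ge0 // lerXn2r ?nnegrE ?ge_min ?lexx //; last exact: ltW.
  by rewrite le_min !ltW.
by move=> y; rewrite le_min => /andP[y1 y2]; apply: hc.
Qed.

Lemma ranD (f g : R -> C) x : ran f x -> ran g x -> ran (fun s => f s + g s) x.
Proof.
move=> [a [r [M [r0 aM ha]]]] /(ran_shrink r0)[b [r' [M' [r'0 r'r bM hb]]]].
exists (fun k => a k + b k), r', (M + M'); split => //.
  move=> n; apply: le_trans (lerD (aM n) (bM n)).
  rewrite -big_split /=; apply: ler_sum => k _.
  apply: le_trans (ler_wpM2r _ (nrmD _ _)) _; first by rewrite exprn_ge0 // ltW.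
  rewrite mulrDl lerD2r ler_wpM2l ?nrm_ge0 // lerXn2r ?nnegrE //; exact: ltW.
move=> y yr; apply: ccvg_ext (ccvgD (ha y (le_trans yr r'r)) (hb y yr)) => n /=.
by rewrite -big_split /=; apply: eq_bigr => k _; rewrite mulrDl.
Qed.

Lemma ran_mul (f g : R -> C) x : ran f x -> ran g x -> ran (fun s => f s * g s) x.
Proof.
move=> [a [r [M [r0 aM ha]]]] /(ran_shrink r0)[b [r' [M' [r'0 r'r bM hb]]]].
have aM' n : \sum_(k < n) nrm (a k) * r' ^+ k <= M.
  apply: le_trans (aM n); apply: ler_sum => k _.
  rewrite ler_wpM2l ?nrm_ge0 // lerXn2r ?nnegrE //; exact: ltW.
have M0 : 0 <= M by have := aM 0%N; rewrite big_ord0.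
pose c n k := if (k < n)%N then 0 else b n * a (k - n)%N.
have cE n (y : C) K : \sum_(k < n + K) c n k * y ^+ k = (b n * y ^+ n) * \sum_(k < K) a k * y ^+ k.
  rewrite big_split_ord /= big1 ?add0r; last first.
    by move=> k _; rewrite /c ltn_ord mul0r.
  rewrite mulr_sumr; apply: eq_bigr => k _.
  by rewrite /c ltnNge leq_addr /= addKn exprD; ring.
have nE n K : \sum_(k < n + K) nrm (c n k) * r' ^+ k = (nrm (b n) * r' ^+ n) * \sum_(k < K) nrm (a k) * r' ^+ k.
  rewrite big_split_ord /= big1 ?add0r; last first.
    by move=> k _; rewrite /c ltn_ord nrm0 mul0r.
  rewrite mulr_sumr; apply: eq_bigr => k _.
  by rewrite /c ltnNge leq_addr /= addKn exprD nrmM; ring.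
apply: (@ran_series R _ x r' c (fun n y => b n * y%:C%C ^+ n * f (x + y))
   (fun n => nrm (b n) * r' ^+ n * M) (M' * M) r'0).
- move=> n K; apply: le_trans (_ : \sum_(k < n + K) nrm (c n k) * r' ^+ k <= _).
    rewrite addnC big_split_ord /= lerDl sumr_ge0 // => k _.
    by rewrite mulr_ge0 ?nrm_ge0 // exprn_ge0 // ltW.
  by rewrite nE ler_wpM2l ?aM' // mulr_ge0 ?nrm_ge0 // exprn_ge0 // ltW.
- by move=> N; rewrite -mulr_suml ler_wpM2r.
- move=> n y yr; have h := ccvgZ (b n * y%:C%C ^+ n) (ha y (le_trans yr r'r)).
  move=> e /h[N HN]; exists (n + N)%N => K hK.
  by rewrite -(subnKC (leq_trans (leq_addr N n) hK)) cE HN // leq_subRL // (leq_trans _ hK) // leq_addr.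
move=> y yr; rewrite [f _ * _]mulrC.
apply: ccvg_ext (_ : ccvg (fun N => f (x + y) * \sum_(n < N) b n * y%:C%C ^+ n) _).
  by move=> N; rewrite mulr_sumr; apply: eq_bigr => n _; rewrite mulrC.
by rewrite [g _ * _]mulrC; apply/ccvgZ/hb.
Qed.

Lemma ran_cst (a : C) x : ran (fun=> a) x.
Proof.
exists (fun k => if k is 0%N then a else 0), 1, (nrm a); split => //.
  case => [|n]; first by rewrite big_ord0 nrm_ge0.
  by rewrite big_ord_recl /= mulr1 big1 ?addr0 // => i _; rewrite nrm0 mul0r.
move=> y _; apply: (@ccvg_eventually _ (fun=> a) _ _ 1); last exact: ccvg_cst.
case => // n _; rewrite big_ord_recl /= expr0 mulr1 big1 ?addr0 // => i _.
by rewrite mul0r.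
Qed.

Lemma ranZ (a : C) f x : ran f x -> ran (fun s => a * f s) x.
Proof. by apply: ran_mul; apply: ran_cst. Qed.

Lemma ranB (f g : R -> C) x : ran f x -> ran g x -> ran (fun s => f s - g s) x.
Proof.
move=> hf /(ranZ (-1)) hg; apply: (@ran_local _ (fun s => f s + -1 * g s) _ _ 1) => //.
  by move=> y _; rewrite mulN1r.
exact: ranD.
Qed.

Lemma ran_sum I (s : seq I) (f : I -> R -> C) x :
  (forall i, ran (f i) x) -> ran (fun s' => \sum_(i <- s) f i s') x.
Proof.
move=> h; elim: s => [|i s IH].
  apply: (@ran_local _ (fun=> 0) _ _ 1) (ran_cst _ _) => // y _.
  by rewrite big_nil.
apply: (@ran_local _ (fun z => f i z + \sum_(i <- s) f i z) _ _ 1) (ranD (h i) IH) => // y _.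
by rewrite big_cons.
Qed.

(** Vanishing on one side of the centre suffices: if [a n] is the first nonzero
    coefficient, dividing by [y ^ n] and letting [y] tend to [0] gives [a n = 0]. *)
Lemma power_series_coef0 (a : nat -> C) (r M : R) : 0 < r ->
  (forall n, \sum_(k < n) nrm (a k) * r ^+ k <= M) ->
  (forall y, 0 < y <= r -> ccvg (fun n => \sum_(k < n) a k * y%:C%C ^+ k) 0) ->
  forall n, a n = 0.
Proof.
move=> r0 aM h n; have [m] := ubnP n; elim: m n => // m IH n; rewrite ltnS => nm.
have a0 k : (k < n)%N -> a k = 0 by move=> kn; apply: IH; apply: leq_trans nm.
have M0 : 0 <= M by have := aM 0%N; rewrite big_ord0.
have key y : 0 < y <= r -> nrm (a n) * r ^+ n.+1 <= M * y.
  move=> /andP[y0 yr].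
  have yrr : y / r <= 1 by rewrite ler_pdivrMr // mul1r.
  have yr0 : 0 <= y / r by rewrite divr_ge0 // ltW.
  have hl : ccvg (fun K => \sum_(k < K) a k * y%:C%C ^+ k - a n * y%:C%C ^+ n) (0 - a n * y%:C%C ^+ n).
    by apply: ccvgB (ccvg_cst _); apply: h; rewrite y0.
  have := @ccvg_nrm_le _ _ _ (M * (y / r) ^+ n.+1) n.+1 hl.
  rewrite sub0r nrmN nrmM nrmX nrm_real (ger0_norm (ltW y0)) => H.
  have {}H : nrm (a n) * y ^+ n <= M * (y / r) ^+ n.+1.
    apply: H => K /subnKC <-; move: (K - n.+1)%N => {}K.
    rewrite big_split_ord /= big_ord_recr /=.
    rewrite big1 ?add0r; last by move=> i _; rewrite a0 ?mul0r.
    rewrite addrAC subrr add0r; apply: le_trans (nrm_sum _ _ _) _.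
    apply: le_trans (ler_wpM2r (exprn_ge0 _ yr0) (aM (n.+1 + K)%N)); rewrite big_split_ord /= mulrDl.
    rewrite -[leLHS]add0r lerD //.
      rewrite mulr_ge0 ?exprn_ge0 //; apply: sumr_ge0 => i _.
      by rewrite mulr_ge0 ?exprn_ge0 ?nrm_ge0 // ltW.
    rewrite mulr_suml.
    apply: ler_sum => k _; rewrite nrmM nrmX nrm_real (ger0_norm (ltW y0)).
    rewrite -mulrA ler_wpM2l ?nrm_ge0 //.
    have -> : y ^+ (n.+1 + k) = r ^+ (n.+1 + k) * (y / r) ^+ (n.+1 + k).
      by rewrite -exprMn mulrCA divff ?gt_eqF ?mulr1.
    apply: ler_wpM2l; first by rewrite exprn_ge0 ?ltW.
    by rewrite exprD ler_piMr ?exprn_ge0 // exprn_ile1.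
  have yn : 0 < y ^+ n by rewrite exprn_gt0.
  move: H; rewrite expr_div_n mulrA ler_pdivlMr ?exprn_gt0 // [y ^+ n.+1]exprSr.
  by rewrite mulrAC [M * _]mulrA [leRHS]mulrAC ler_pM2r.
apply/eqP; rewrite -nrm_eq0; apply/negPn/negP => an.
have an0 : 0 < nrm (a n) * r ^+ n.+1.
  by rewrite mulr_gt0 ?exprn_gt0 // lt_neqAle eq_sym an nrm_ge0.
pose y := Num.min r (nrm (a n) * r ^+ n.+1 / (M + 1) / 2).
have M1 : 0 < M + 1 by lra.
have y0 : 0 < y by rewrite lt_min r0 !divr_gt0.
have := key y; rewrite y0 ge_min lexx => /(_ isT).
have : y <= nrm (a n) * r ^+ n.+1 / (M + 1) / 2 by rewrite ge_min lexx orbT.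
rewrite ler_pdivlMr // ler_pdivlMr //; move: an0; set q := _ * r ^+ _; nra.
Qed.

(** Identity theorem: the infimum of the abscissae up to which [h] vanishes can
    be pushed to the left as long as it is positive. *)
Lemma ran_identity (h : R -> C) : (forall x, 0 < x -> ran h x) ->
  (forall x, 1 < x -> h x = 0) -> forall x, 0 < x -> h x = 0.
Proof.
move=> hr h1 x0 x00.
pose S := [set x : R | 0 < x /\ forall y, x < y -> h y = 0].
have S1 : S 1 by split.
have hS : has_inf S by split; [exists 1 | exists 0 => x [/ltW]].
have m0 : 0 <= inf S by apply: lb_le_inf => [|x [/ltW //]]; exists 1.
have hm y : inf S < y -> h y = 0.
  move=> /(inf_lt hS.1)[z [_ hz] zy]; exact: hz.
move: m0; rewrite le_eqVlt => /predU1P[m0|m0]; first by apply: hm; rewrite -m0.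
have [a [r [M [r0 aM hc]]]] := hr _ m0.
have a0 : forall n, a n = 0.
  apply: (power_series_coef0 r0 aM) => y /andP[y0 yr]; have := hc y; rewrite (ger0_norm (ltW y0)) => /(_ yr).
  by rewrite hm // ltrDl.
have hz y : `|y| <= r -> h (inf S + y) = 0.
  move=> /hc H; apply: ccvg_unique H _; apply: ccvg_ext (@ccvg_cst _ 0) => n.
  by rewrite big1 // => i _; rewrite a0 mul0r.
(* [h] vanishes on the whole disc around [inf S], hence already from [z] on. *)
pose z := Num.max (inf S - r) (inf S / 2).
have z0 : 0 < z by rewrite lt_max; apply/orP; right; lra.
have zm : z < inf S by rewrite gt_max; apply/andP; split; lra.
have : inf S <= z.
  apply: ge_inf; first by exists 0 => x [/ltW].
  split => // y zy; have [ym|ym] := ltP (inf S) y; first exact: hm.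
  have -> : y = inf S + (y - inf S) by ring.
  apply: hz; rewrite ler_norml; have : inf S - r <= z by rewrite le_max lexx.
  move=> h2; apply/andP; split; lra.
by rewrite leNgt zm.
Qed.

End RanClosure.

(** * Dirichlet series of differences *)

Section DirichletDifferences.
Variable R : realType.
Local Notation C := (R[i]).
Local Notation nrm := (@Normc.normc R).

(** [dpow t s x] is x ^ (- (s + i t)), with the real part as running variable. *)
Definition dpow (t s x : R) : C := cpow x (- Complex s t).

Lemma dpowE t s x : 0 < x -> dpow t s x = (x `^ (- s))%:C%C * cis (- (t * ln x)).
Proof.
move=> x0; rewrite /dpow /cpow cexpE /powR gt_eqF //=.
by rewrite !mulr0 subr0 add0r !mulNr.
Qed.

Lemma nrm_dpow t s x : 0 < x -> nrm (dpow t s x) = x `^ (- s).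
Proof. by move=> x0; rewrite dpowE // nrmM nrm_cis mulr1 nrm_real ger0_norm ?powR_ge0. Qed.

Lemma dpowM t s x y : 0 < x -> 0 < y -> dpow t s (x * y) = dpow t s x * dpow t s y.
Proof.
move=> x0 y0; rewrite !dpowE ?mulr_gt0 // powRM ?ltW // lnM ?posrE //.
by rewrite rmorphM mulrDr opprD cisD /=; ring.
Qed.

Lemma ln_ratio_le (x y : R) : 0 < x -> x <= y -> ln y - ln x <= (y - x) / x.
Proof.
move=> x0 xy; have y0 : 0 < y by apply: lt_le_trans xy.
rewrite -ln_div ?posrE //; have -> : y / x = 1 + (y - x) / x.
  by rewrite mulrBl divff ?gt_eqF // addrC subrK.
apply: le_ln1Dx; apply: lt_le_trans (_ : 0 <= _); first by rewrite ltrN10.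
by rewrite divr_ge0 ?subr_ge0 // ltW.
Qed.

Lemma ln_ratio_ge (x y : R) : 0 < x -> x <= y -> (y - x) / y <= ln y - ln x.
Proof.
move=> x0 xy; have y0 : 0 < y by apply: lt_le_trans xy.
rewrite -[leLHS]opprK -[leRHS]opprK lerN2 opprB -ln_div ?posrE //.
have -> : x / y = 1 + - ((y - x) / y) by rewrite mulrBl divff ?gt_eqF //; ring.
apply: le_ln1Dx; rewrite ltrN2 ltr_pdivrMr // mul1r; lra.
Qed.

Lemma one_minus_expR_cis (a b : R) : 0 <= a ->
  nrm (1 - (expR (- a))%:C%C * cis b) <= a + `|b|.
Proof.
move=> a0.
have -> : 1 - (expR (- a))%:C%C * cis b =
   (1 - expR (- a))%:C%C + (expR (- a))%:C%C * (1 - cis b).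
  by rewrite rmorphB /=; ring.
apply: le_trans (nrmD _ _) _; rewrite lerD //.
  rewrite nrm_real ger0_norm; last by rewrite subr_ge0 expR_le1 oppr_le0.
  by have := expR_ge1Dx (- a); lra.
rewrite nrmM nrm_real ger0_norm ?expR_ge0 //.
have := chord_le b; have := nrm_ge0 (1 - cis b).
have : expR (- a) <= 1 by rewrite expR_le1 oppr_le0.
have := expR_ge0 (- a); set u := expR _; set v := nrm _; nra.
Qed.

Lemma dpow_sub t s x y : 0 <= s -> 0 < x -> x <= y ->
  nrm (dpow t s x - dpow t s y) <= (s + `|t|) * (y - x) * x `^ (- s - 1).
Proof.
move=> s0 x0 xy; have y0 : 0 < y by apply: lt_le_trans xy.
have l0 : 0 <= ln y - ln x by rewrite subr_ge0 ler_ln ?posrE.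
have -> : dpow t s x - dpow t s y = dpow t s x *
     (1 - (expR (- (s * (ln y - ln x))))%:C%C * cis (- (t * (ln y - ln x)))).
  have yE : y = x * (y / x) by rewrite mulrCA divff ?gt_eqF ?mulr1.
  have -> : dpow t s y = dpow t s x * dpow t s (y / x) by rewrite -dpowM ?divr_gt0 // -yE.
  rewrite [dpow t s (y / x)]dpowE ?divr_gt0 // /powR gt_eqF ?divr_gt0 //.
  by rewrite ln_div ?posrE // [RHS]mulrBr mulr1 mulNr.
rewrite nrmM nrm_dpow // powRB; last by rewrite (gt_eqF x0) implybT.
rewrite powRr1 ?(ltW x0) // [leRHS]mulrCA ler_wpM2l ?powR_ge0 //.
apply: le_trans (one_minus_expR_cis _ _) _; first by rewrite mulr_ge0.
rewrite normrN normrM (ger0_norm l0) -mulrDl -mulrA ler_wpM2l ?addr_ge0 //.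
exact: ln_ratio_le.
Qed.

Lemma expR_partial_sum (z : R) K : 0 <= z ->
  \sum_(k < K) z ^+ k / k`!%:R <= expR z.
Proof.
move=> z0; have h := is_cvg_series_exp_coeff z.
have nd : nondecreasing_seq (series (exp_coeff z)).
  apply/nondecreasing_seqP => n; rewrite -subr_ge0 !seriesEnat /= big_nat_recr //=.
  by rewrite addrAC subrr add0r divr_ge0 ?exprn_ge0.
have := nondecreasing_cvgn_le nd h K; rewrite seriesEnat /= big_mkord.
by rewrite /expR.
Qed.

Lemma expR_ccvg (z : R) : ccvg (fun n => \sum_(k < n) (z ^+ k / k`!%:R)%:C%C) (expR z)%:C%C.
Proof.
move=> e e0; have /cvgrPdist_le/(_ _ e0)[N _ HN] := is_cvg_series_exp_coeff z.
exists N => n /HN; rewrite seriesEnat /= big_mkord distrC => h.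
by rewrite -rmorph_sum -rmorphB nrm_real.
Qed.

Lemma expR_partial_sum_sub (a b : R) K : 0 <= a -> a <= b ->
  \sum_(k < K) (b ^+ k / k`!%:R - a ^+ k / k`!%:R) <= expR b - expR a.
Proof.
move=> a0 ab; pose T k : R := b ^+ k / k`!%:R - a ^+ k / k`!%:R.
have T0 k : 0 <= T k.
  by rewrite /T -mulrBl mulr_ge0 ?invr_ge0 // subr_ge0 lerXn2r ?nnegrE ?(le_trans a0).
rewrite -/(T _); apply/ler_addgt0Pr => e e0.
have [N HN] := ccvgB (expR_ccvg b) (expR_ccvg a) e0.
have := HN _ (leq_maxr K N).
rewrite -sumrB -rmorphB; under eq_bigr do rewrite -rmorphB.
rewrite -rmorph_sum -rmorphB nrm_real => hN.
apply: le_trans (_ : \sum_(k < maxn K N) T k <= _).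
  by rewrite -(subnKC (leq_maxl K N)) big_split_ord /= lerDl; apply: sumr_ge0.
by rewrite -lerBlDl; apply: le_trans hN; apply: ler_norm.
Qed.

Lemma dpow_expand t s x y : 0 < x ->
  ccvg (fun n => \sum_(k < n) (dpow t s x * ((- ln x) ^+ k / k`!%:R)%:C%C) * y%:C%C ^+ k)
    (dpow t (s + y) x).
Proof.
move=> x0; have := ccvgZ (dpow t s x) (@expR_ccvg (- ln x * y)).
have -> : dpow t s x * (expR (- ln x * y))%:C%C = dpow t (s + y) x.
  rewrite !dpowE // opprD powRD; last by rewrite (gt_eqF x0) implybT.
  rewrite [x `^ (- y)]/powR gt_eqF // rmorphM /= mulrAC; congr (_ * _%:C%C * _).
  by congr expR; ring.
apply: ccvg_ext => n; rewrite mulr_sumr; apply: eq_bigr => k _.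
rewrite -mulrA; congr (_ * _); rewrite -rmorphXn -rmorphM /=.
by congr (_%:C%C); rewrite exprMn; ring.
Qed.

Lemma ran_dpow t x s : 0 < x -> ran (fun s => dpow t s x) s.
Proof.
move=> x0.
exists (fun k => dpow t s x * ((- ln x) ^+ k / k`!%:R)%:C%C), 1,
  (nrm (dpow t s x) * expR `|ln x|); split => //; last first.
  by move=> y _; apply: dpow_expand.
move=> n; apply: le_trans (ler_wpM2l (nrm_ge0 _) (expR_partial_sum n (normr_ge0 (ln x)))).
rewrite mulr_sumr; apply: ler_sum => k _.
rewrite expr1n mulr1 nrmM nrm_real ler_wpM2l ?nrm_ge0 //.
by rewrite normrM normrX normrN ger0_norm // invr_ge0.
Qed.

Lemma powR_expR (x a : R) : 0 < x -> x `^ a = expR (a * ln x).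
Proof. by move=> x0; rewrite /powR gt_eqF. Qed.

Lemma riemann_sum_bound (e : R) N : 0 < e ->
  \sum_(n < N) (n.+1%:R : R) `^ (- 1 - e) <= 1 + e^-1.
Proof.
move=> e0.
have H n : (n.+2%:R : R) `^ (- 1 - e) <= e^-1 * (n.+1%:R `^ (- e) - n.+2%:R `^ (- e)).
  have n1 : 0 < n.+1%:R :> R by []. have n2 : 0 < n.+2%:R :> R by [].
  rewrite ler_pdivlMl // (_ : -1 - e = - e - 1); last by ring.
  rewrite powRB; last by rewrite (gt_eqF n2) implybT.
  rewrite powRr1 //.
  have -> : n.+1%:R `^ (- e) = n.+2%:R `^ (- e) * expR (e * (ln n.+2%:R - ln n.+1%:R)) :> R.
    by rewrite !powR_expR // -expRD; congr expR; ring.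
  have h := ln_ratio_ge n1 (_ : n.+1%:R <= n.+2%:R); rewrite ler_nat leqnSn in h.
  have {h} := h isT; rewrite -natrB // subSnn => h.
  have h2 := expR_ge1Dx (e * (ln n.+2%:R - ln n.+1%:R) : R).
  rewrite -[X in _ <= _ - X]mulr1 -mulrBr mulrCA ler_wpM2l ?powR_ge0 //.
  apply: le_trans (_ : e * (ln n.+2%:R - ln n.+1%:R) <= _); last by lra.
  by rewrite ler_wpM2l ?(ltW e0) // -[leLHS]mul1r.
case: N => [|N]; first by rewrite big_ord0 addr_ge0 // invr_ge0 ltW.
rewrite big_ord_recl /= powR1 lerD2l.
apply: le_trans (_ : e^-1 * (1 - N.+1%:R `^ (- e)) <= _); last first.
  by rewrite ger_pMr ?invr_gt0 // gerBl powR_ge0.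
elim: N => [|N IH]; first by rewrite big_ord0 powR1 subrr mulr0.
rewrite big_ord_recr /=; apply: le_trans (lerD IH (H N)) _.
by rewrite -mulrDr ler_wpM2l ?invr_ge0 ?(ltW e0) //; lra.
Qed.

(** Summability of the differences only uses one gain of [1 / x], so both the
    Abel transform of the periodic zeta function and differences of Hurwitz zeta
    functions are covered. *)
Definition diff_series (w : nat -> C) (X Y : nat -> R) (t s : R) (N : nat) : C :=
  \sum_(n < N) w n * (dpow t s (X n) - dpow t s (Y n)).

Definition diff_nodes (w : nat -> C) (X Y : nat -> R) (W : R) : Prop :=
  forall n, [/\ nrm (w n) <= W, n.+1%:R <= X n, X n <= Y n & Y n <= X n + 1].

Lemma diff_series_term w X Y W t s n : diff_nodes w X Y W -> 0 <= s ->
  nrm (w n * (dpow t s (X n) - dpow t s (Y n))) <=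
    W * (s + `|t|) * n.+1%:R `^ (- 1 - s).
Proof.
move=> /(_ n)[wW nX XY YX] s0.
have n1 : 0 < n.+1%:R :> R by [].
have X0 : 0 < X n by apply: lt_le_trans nX.
have W0 : 0 <= W := le_trans (nrm_ge0 _) wW.
rewrite nrmM -mulrA ler_pM ?nrm_ge0 //.
apply: le_trans (dpow_sub t s0 X0 XY) _.
rewrite -mulrA ler_wpM2l ?addr_ge0 //.
apply: le_trans (_ : 1 * X n `^ (- s - 1) <= _).
  by rewrite ler_wpM2r ?powR_ge0 //; lra.
rewrite mul1r (_ : - s - 1 = - (1 + s)); last by ring.
rewrite (_ : -1 - s = - (1 + s)); last by ring.
rewrite !powRN lef_pV2 ?posrE ?powR_gt0 //.
by apply: ge0_ler_powR; rewrite ?nnegrE ?addr_ge0 // ltW.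
Qed.

Lemma diff_series_ccvg w X Y W t s : diff_nodes w X Y W -> 0 < s ->
  exists l, ccvg (diff_series w X Y t s) l.
Proof.
move=> H s0.
have W0 : 0 <= W by have [h _ _ _] := H 0%N; apply: le_trans (nrm_ge0 _) h.
have [N|l hl _] := @abs_ccvg R (fun n => w n * (dpow t s (X n) - dpow t s (Y n)))
   (W * (s + `|t|) * (1 + s^-1)); last by exists l.
apply: le_trans (ler_wpM2l _ (riemann_sum_bound N s0)); last first.
  by rewrite mulr_ge0 ?addr_ge0 // ltW.
by rewrite mulr_sumr; apply: ler_sum => n _; apply: diff_series_term (ltW s0).
Qed.

(** Each term is expanded in powers of the real part and [ran_series] applies with
    summable majorants: the exponential series of [X] and [Y] are compared
    coefficientwise, so that the cancellation between them is not lost. *)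
Lemma ran_diff_series w X Y W t (h : R -> C) s0 : diff_nodes w X Y W -> 0 < s0 ->
  (forall s, 0 < s -> ccvg (diff_series w X Y t s) (h s)) -> ran h s0.
Proof.
move=> H s00 hh.
have W0 : 0 <= W by have [h' _ _ _] := H 0%N; apply: le_trans (nrm_ge0 _) h'.
have nX n : n.+1%:R <= X n by have [] := H n.
have XY n : X n <= Y n by have [] := H n.
have n1 n : 0 < n.+1%:R :> R by [].
have X0 n : 0 < X n by apply: lt_le_trans (nX n).
have Y0 n : 0 < Y n by apply: lt_le_trans (XY n).
have lX n : 0 <= ln (X n) by rewrite ln_ge0 // (le_trans _ (nX n)) // ler1n.
have lXY n : ln (X n) <= ln (Y n) by rewrite ler_ln ?posrE.
have lY n : 0 <= ln (Y n) by apply: le_trans (lXY n).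
(* The radius stays below half the abscissa, so that majorants remain summable. *)
pose r := Num.min (s0 / 2) 1.
have r0 : 0 < r by rewrite lt_min ltr01 andbT; lra.
have r1 : r <= 1 by rewrite ge_min lexx orbT.
have rs : r <= s0 / 2 by rewrite ge_min lexx.
pose c n k := w n * (dpow t s0 (X n) * ((- ln (X n)) ^+ k / k`!%:R)%:C%C
                    - dpow t s0 (Y n) * ((- ln (Y n)) ^+ k / k`!%:R)%:C%C).
pose A := W * (2 * (s0 + `|t|) + 1).
have A0 : 0 <= A by rewrite mulr_ge0 // addr_ge0 // mulr_ge0 // addr_ge0 // ltW.
apply: (@ran_series R h s0 r c (fun n y => w n * (dpow t (s0 + y) (X n) - dpow t (s0 + y) (Y n)))
   (fun n => A * n.+1%:R `^ (- 1 - s0 / 2)) (A * (1 + (s0 / 2)^-1)) r0).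
- move=> n K.
  have ck k : nrm (c n k) * r ^+ k <= W * (
      nrm (dpow t s0 (X n) - dpow t s0 (Y n)) * ((ln (Y n) * r) ^+ k / k`!%:R) +
      nrm (dpow t s0 (X n)) * ((ln (Y n) * r) ^+ k / k`!%:R - (ln (X n) * r) ^+ k / k`!%:R)).
    have f0 : 0 <= (k`!%:R : R)^-1 by rewrite invr_ge0.
    (* Separates the change of the coefficient from that of the power of the log. *)
    have -> : c n k = w n * ((-1) ^+ k * ((dpow t s0 (X n) - dpow t s0 (Y n)) * (ln (Y n) ^+ k / k`!%:R)%:C%C
        - dpow t s0 (X n) * ((ln (Y n) ^+ k - ln (X n) ^+ k) / k`!%:R)%:C%C)).
      rewrite /c; congr (_ * _); rewrite ![(- ln _) ^+ _]exprNn.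
      rewrite !rmorphM /= !rmorphB /= !rmorphXn /= !rmorphN /= !rmorph1.
      by set u := (-1) ^+ k; ring.
    rewrite nrmM -mulrA; apply: ler_pM; rewrite ?mulr_ge0 ?nrm_ge0 ?exprn_ge0 ?(ltW r0) //; first by have [] := H n.
    rewrite nrmM nrmX nrmN nrm1 expr1n mul1r.
    apply: le_trans (ler_wpM2r _ (nrmB _ _)) _; first by rewrite exprn_ge0 // ltW.
    rewrite !nrmM !nrm_real ger0_norm ?mulr_ge0 ?exprn_ge0 //.
    rewrite ger0_norm ?mulr_ge0 // ?subr_ge0 ?lerXn2r ?nnegrE //.
    by rewrite !exprMn le_eqVlt; apply/orP; left; apply/eqP; ring.
  apply: le_trans (ler_sum _ (fun (k : 'I_K) _ => ck k)) _.
  rewrite -mulr_sumr big_split /= -!mulr_sumr /A -mulrA.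
  rewrite ler_wpM2l //.
  have Yr1 : expR (ln (Y n) * r) <= 2 * expR (ln (X n) * r).
    rewrite -[ln (Y n)](subrK (ln (X n))) mulrDl expRD ler_wpM2r ?expR_ge0 //.
    apply: le_trans (_ : expR (ln (Y n) - ln (X n)) <= _).
      by rewrite ler_expR ler_piMr // subr_ge0.
    rewrite -ln_div ?posrE // lnK ?posrE ?divr_gt0 // ler_pdivrMr //.
    have [_ _ _ h1] := H n; have : 1 <= X n by rewrite (le_trans _ (nX n)) // ler1n.
    by rewrite mulr_natl mulr2n; lra.
  have XE a : X n `^ a = expR (ln (X n) * a) by rewrite powR_expR // mulrC.
  have Yr2 : expR (ln (Y n) * r) - expR (ln (X n) * r) <= expR (ln (X n) * (r - 1)).
    have -> : ln (Y n) * r = (ln (Y n) - ln (X n)) * r + ln (X n) * r by ring.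
    rewrite mulrBr mulr1 expRB expRD [in leRHS]lnK ?posrE //.
    have : expR ((ln (Y n) - ln (X n)) * r) <= 1 + (X n)^-1.
      apply: le_trans (_ : expR (ln (Y n) - ln (X n)) <= _).
        by rewrite ler_expR ler_piMr // subr_ge0.
      rewrite -ln_div ?posrE // lnK ?posrE ?divr_gt0 //.
      rewrite ler_pdivrMr // mulrDl mul1r mulVf ?gt_eqF //.
      by have [] := H n.
    have := expR_gt0 (ln (X n) * r); set u := expR (_ * _); set v := expR (_ * _).
    by move=> u0 uv; rewrite [leRHS]mulrC -[X in _ - X]mul1r -mulrBl ler_pM2r // lerBlDl.
  have S1 := expR_partial_sum K (mulr_ge0 (lY n) (ltW r0)).
  have S2 : \sum_(k < K) ((ln (Y n) * r) ^+ k / k`!%:R - (ln (X n) * r) ^+ k / k`!%:R)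
        <= expR (ln (Y n) * r) - expR (ln (X n) * r).
    apply: expR_partial_sum_sub; first by rewrite mulr_ge0 // ltW.
    by rewrite ler_wpM2r // ltW.
  have D1 := dpow_sub t (ltW s00) (X0 n) (XY n).
  have D2 : nrm (dpow t s0 (X n) - dpow t s0 (Y n)) <= (s0 + `|t|) * X n `^ (- s0 - 1).
    apply: le_trans D1 _; rewrite ler_wpM2r ?powR_ge0 // ler_piMr ?addr_ge0 ?(ltW s00) //.
    by have [_ _ _] := H n; lra.
  have E1 : X n `^ (- s0 - 1) * expR (ln (X n) * r) <= n.+1%:R `^ (- 1 - s0 / 2).
    rewrite XE -expRD -mulrDr -XE.
    apply: le_trans (_ : X n `^ (- 1 - s0 / 2) <= _).
      by rewrite ler_powR ?(le_trans _ (nX n)) ?ler1n //; lra.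
    rewrite (_ : -1 - s0 / 2 = - (1 + s0 / 2)); last by ring.
    rewrite !powRN lef_pV2 ?posrE ?powR_gt0 //.
    by apply: ge0_ler_powR; rewrite ?nnegrE ?(ltW (X0 _)) // addr_ge0 // divr_ge0 // ltW.
  have D3 : nrm (dpow t s0 (X n)) * expR (ln (X n) * (r - 1)) = X n `^ (- s0 - 1) * expR (ln (X n) * r).
    by rewrite nrm_dpow // !XE -!expRD; congr expR; ring.
  rewrite [X in _ <= X](_ : _ = (s0 + `|t|) * (2 * n.+1%:R `^ (-1 - s0 / 2)) + n.+1%:R `^ (-1 - s0 / 2)); last by ring.
  rewrite lerD //.
    apply: le_trans (_ : (s0 + `|t|) * X n `^ (- s0 - 1) * (2 * expR (ln (X n) * r)) <= _).
      rewrite ler_pM ?nrm_ge0 //; last exact: le_trans S1 Yr1.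
      by apply: sumr_ge0 => k _; rewrite divr_ge0 // exprn_ge0 // mulr_ge0 // ltW.
    by rewrite -mulrA ler_wpM2l ?addr_ge0 ?(ltW s00) // mulrCA ler_wpM2l.
  apply: le_trans (ler_wpM2l (nrm_ge0 _) (le_trans S2 Yr2)) _.
  by rewrite D3.
- move=> N; rewrite -mulr_sumr ler_wpM2l // riemann_sum_bound //; lra.
- move=> n y yr; have := ccvgZ (w n) (ccvgB (dpow_expand t s0 y (X0 n)) (dpow_expand t s0 y (Y0 n))).
  apply: ccvg_ext => K; rewrite -sumrB mulr_sumr; apply: eq_bigr => k _.
  by rewrite /c; ring.
move=> y; rewrite ler_norml => /andP[y1 y2]; apply: hh; lra.
Qed.

End DirichletDifferences.

(** * The periodic and Hurwitz zeta functions in the half plane Re s > 0 *)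

Section ZetaFunctions.
Variable R : realType.
Local Notation C := (R[i]).
Local Notation nrm := (@Normc.normc R).

Lemma powR_tends0 (a e : R) : 0 < a -> 0 < e ->
  exists N, forall n, (N <= n)%N -> (n.+1%:R : R) `^ (- a) <= e.
Proof.
move=> a0 e0; have [N hN] : exists N : nat, e `^ (- a^-1) <= N%:R.
  exists (Num.truncn (e `^ (- a^-1))).+1.
  by rewrite ltW // truncnS_gt.
exists N => n Nn; have n0 : 0 < n.+1%:R :> R by [].
have h : e `^ (- a^-1) <= n.+1%:R by rewrite (le_trans hN) // ler_nat ltnW.
have -> : e = (e `^ (- a^-1)) `^ (- a).
  by rewrite -powRrM mulrNN mulVf ?gt_eqF // powRr1 // ltW.
have u0 : 0 < e `^ (- a^-1) by rewrite powR_gt0.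
move: h u0; set u := e `^ _ => h u0; rewrite !powRN lef_pV2 ?posrE ?powR_gt0 //.
by apply: ge0_ler_powR; rewrite ?nnegrE // ltW.
Qed.

Lemma dpow_tends0 t s : 0 < s -> ccvg (fun n => dpow t s n.+1%:R) (0 : C).
Proof.
move=> s0 e e0; have [N HN] := powR_tends0 s0 e0.
by exists N => n /HN; rewrite subr0 nrm_dpow.
Qed.

(** Summation by parts, with the convention that the term before the first one
    is [0]. *)
Definition backward (d : nat -> C) (n : nat) : C :=
  d n - (if n is m.+1 then d m else 0).

Lemma sum_backward (z : C) d N :
  \sum_(n < N) z ^+ n.+1 * backward d n =
  (1 - z) * \sum_(n < N) z ^+ n.+1 * d n + (if N is M.+1 then z ^+ N.+1 * d M else 0).
Proof.
elim: N => [|N IH]; first by rewrite !big_ord0 mulr0 addr0.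
rewrite !big_ord_recr /= IH mulrDr; case: N {IH} => [|N].
  by rewrite /backward big_ord0 !exprS; ring.
by rewrite /backward [z ^+ N.+3]exprS [z ^+ N.+2]exprS; ring.
Qed.

Lemma ccvg_backward (z : C) d L : nrm z = 1 -> ccvg d 0 ->
  ccvg (fun N => \sum_(n < N) z ^+ n.+1 * d n) L ->
  ccvg (fun N => \sum_(n < N) z ^+ n.+1 * backward d n) ((1 - z) * L).
Proof.
move=> z1 d0 hL; rewrite -[_ * L]addr0.
apply: ccvg_ext (ccvgD (ccvgZ (1 - z) hL) (_ : ccvg (fun N => if N is M.+1 then z ^+ N.+1 * d M else 0) 0)).
  by move=> N; rewrite sum_backward.
move=> e /d0[N HN]; exists N.+1 => -[//|n] /HN.
by rewrite !subr0 nrmM nrmX z1 expr1n mul1r.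
Qed.

Lemma geometric_cis_bound (x : R) N : cis x != 1 ->
  nrm (\sum_(n < N) cis (n.+1%:R * x)) <= 2 / nrm (1 - cis x).
Proof.
move=> x1; have n0 : 0 < nrm (1 - cis x).
  by rewrite lt_neqAle nrm_ge0 andbT eq_sym nrm_eq0 subr_eq0 eq_sym.
rewrite ler_pdivlMr // mulrC -nrmM.
have -> : (1 - cis x) * \sum_(n < N) cis (n.+1%:R * x) = cis x - cis (N.+1%:R * x).
  elim: N => [|N IH]; first by rewrite big_ord0 mulr0 mul1r subrr.
  rewrite big_ord_recr /= mulrDr IH !cis_natM [cis x ^+ N.+2]exprS; ring.
by apply: le_trans (nrmB _ _) _; rewrite !nrm_cis.
Qed.

Lemma cis_neq1 (x : R) : 0 < x < 2 * pi -> cis x != 1.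
Proof.
move=> /andP[x0 x2]; apply/negP => /eqP x1.
have := @chord_ge R (Num.min x (2 * pi - x)) x; rewrite x1 subrr nrm0.
have h : 0 < Num.min x (2 * pi - x) by rewrite lt_min x0; lra.
rewrite (ltW h) ge_min lexx /= => /(_ isT).
have : Num.min x (2 * pi - x) <= 2 * pi - x by rewrite ge_min lexx orbT.
by move=> h2 /(_ ltac:(lra)); lra.
Qed.

Definition pz_sum (theta t s : R) (N : nat) : C :=
  \sum_(n < N) cis (n.+1%:R * theta) * dpow t s n.+1%:R.

Section PeriodicZeta.
Variable F : R -> C -> C.
Hypothesis hF : is_periodic_zeta F.

(** Multiplication by [1 - e ^ (i theta)] turns the series into one of successive
    differences, which converges absolutely for [Re s > 0] and continues [F]. *)
Lemma F_series theta t s : 0 < theta < 2 * pi -> 0 < s ->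
  ccvg (pz_sum theta t s) (F theta (Complex s t)).
Proof.
move=> th; have [han hser] := hF th.
pose S n := \sum_(k < n.+1) cis (k.+1%:R * theta).
have nodes : diff_nodes S (fun n => n.+1%:R) (fun n => n.+2%:R) (2 / nrm (1 - cis theta)).
  move=> n; split; rewrite ?lexx ?ler_nat //; last by rewrite natr1.
  by apply: geometric_cis_bound; apply: cis_neq1.
have abel N s' : pz_sum theta t s' N = diff_series S (fun n => n.+1%:R) (fun n => n.+2%:R) t s' N
      + (\sum_(k < N) cis (k.+1%:R * theta)) * dpow t s' N.+1%:R.
  elim: N => [|N IH]; first by rewrite /pz_sum /diff_series !big_ord0 mul0r addr0.
  rewrite /pz_sum big_ord_recr /= -/(pz_sum _ _ _ _) IH /diff_series [in RHS]big_ord_recr /=.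
  by rewrite /S big_ord_recr /=; ring.
have rest s' : 0 < s' -> ccvg (fun N => (\sum_(k < N) cis (k.+1%:R * theta)) * dpow t s' N.+1%:R) 0.
  move=> s'0; pose W := 2 / nrm (1 - cis theta).
  have W0 : 0 <= W by rewrite divr_ge0 ?nrm_ge0.
  apply: (@ccvg_squeeze _ _ _ (fun n => W * n.+1%:R `^ (- s'))).
    move=> e e0; have W1 : 0 < W + 1 by lra.
    have [N HN] := powR_tends0 s'0 (divr_gt0 e0 W1).
    exists N => n /HN; rewrite ler_pdivlMr //; have := powR_ge0 (n.+1%:R : R) (- s').
    by set u := _ `^ _; nra.
  move=> n; rewrite subr0 nrmM nrm_dpow // ler_wpM2r ?powR_ge0 //.
  by apply: geometric_cis_bound; apply: cis_neq1.
have hex s' : exists l, 0 < s' -> ccvg (diff_series S (fun n => n.+1%:R) (fun n => n.+2%:R) t s') l.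
  have [s'0|] := ltP 0 s'; last by exists 0.
  by have [l hl] := diff_series_ccvg t nodes s'0; exists l.
have [h hh] := choice hex.
have hpz s' : 0 < s' -> ccvg (pz_sum theta t s') (h s').
  move=> s'0; rewrite -[h s']addr0; apply: ccvg_ext (ccvgD (hh _ s'0) (rest _ s'0)).
  by move=> N; rewrite abel.
move=> s0; suff <- : h s = F theta (Complex s t) by apply: hpz.
apply/eqP; rewrite -subr_eq0; apply/eqP.
apply: (@ran_identity _ (fun s => h s - F theta (Complex s t))) s0.
  move=> x x0; apply: ranB; first exact: (ran_diff_series nodes x0 hh).
  exact: analytic_ran.
move=> x x1; apply/eqP; rewrite subr_eq0; apply/eqP.
apply: ccvg_unique (hpz x (lt_trans ltr01 x1)) _.
have /csumP := hser (Complex x t) x1.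
by apply: ccvg_ext => N; apply: eq_bigr => n _; rewrite cexp_imag.
Qed.

End PeriodicZeta.

Section HurwitzZeta.
Variable zeta : C -> R -> C.
Hypothesis hz : is_hurwitz_zeta zeta.

Lemma zeta_series alpha t s : 0 < alpha -> 1 < s ->
  ccvg (fun N => \sum_(m < N) dpow t s (m%:R + alpha)) (zeta (Complex s t) alpha).
Proof. by move=> a0 s1; have [_ h] := hz a0; have /csumP := h (Complex s t) s1. Qed.

Lemma ran_zeta alpha t s : 0 < alpha -> t != 0 -> ran (fun s => zeta (Complex s t) alpha) s.
Proof.
move=> a0 t0; apply: (@analytic_ran R (zeta^~ alpha)); have [h _] := hz a0; apply: h.
by apply: contra t0 => /eqP[_ ->].
Qed.

(** The differences of two Hurwitz zeta functions continue to [Re s > 0] as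
    convergent series, so relations between them extend from [Re s > 1]; the
    hypothesis [t != 0] keeps the horizontal line away from the pole. *)
Lemma zeta_shift alpha t s : 0 < alpha -> t != 0 -> 0 < s ->
  zeta (Complex s t) alpha = dpow t s alpha + zeta (Complex s t) (1 + alpha).
Proof.
move=> a0 t0 s0; have a1 : 0 < 1 + alpha by rewrite addr_gt0.
apply/eqP; rewrite -subr_eq0; apply/eqP.
apply: (@ran_identity _ (fun s => zeta (Complex s t) alpha -
    (dpow t s alpha + zeta (Complex s t) (1 + alpha)))) s0.
  move=> x x0; apply: ranB; first exact: ran_zeta.
  by apply: ranD; [apply: ran_dpow | apply: ran_zeta].
move=> x x1; apply/eqP; rewrite subr_eq0; apply/eqP.
apply: ccvg_unique (ccvgD (ccvg_cst _) (zeta_series t a1 x1)).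
have := zeta_series t a0 x1 => /(ccvg_subseq (f := succn)) h.
apply: ccvg_ext (h _) => [N|n]; last exact: leqnSn.
rewrite /= big_ord_recl /= add0r; congr (_ + _).
by apply: eq_bigr => m _; rewrite /bump /= add1n -natr1 addrA.
Qed.

Lemma zeta_lipschitz alpha beta t s : 1 <= alpha -> alpha <= beta <= alpha + 1 ->
  t != 0 -> 0 < s ->
  nrm (zeta (Complex s t) alpha - zeta (Complex s t) beta) <=
    (s + `|t|) * (1 + s^-1) * (beta - alpha).
Proof.
move=> a1 /andP[ab ba] t0 s0.
have a0 : 0 < alpha by apply: lt_le_trans a1.
have b0 : 0 < beta by apply: lt_le_trans ab.
pose X m : R := m%:R + alpha. pose Y m : R := m%:R + beta.
have nodes : diff_nodes (fun=> 1) X Y 1.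
  by move=> n; rewrite nrm1 /X /Y -natr1; split; lra.
have hex s' : exists l, 0 < s' -> ccvg (diff_series (fun=> 1) X Y t s') l.
  have [s'0|] := ltP 0 s'; last by exists 0.
  by have [l hl] := diff_series_ccvg t nodes s'0; exists l.
have [h hh] := choice hex.
have <- : h s = zeta (Complex s t) alpha - zeta (Complex s t) beta.
  apply/eqP; rewrite -subr_eq0; apply/eqP.
  apply: (@ran_identity _ (fun s => h s - (zeta (Complex s t) alpha - zeta (Complex s t) beta))) s0.
    move=> x x0; apply: ranB; first exact: (ran_diff_series nodes x0 hh).
    by apply: ranB; apply: ran_zeta.
  move=> x x1; apply/eqP; rewrite subr_eq0; apply/eqP.
  apply: ccvg_unique (hh x (lt_trans ltr01 x1)) _.
  apply: ccvg_ext (ccvgB (zeta_series t a0 x1) (zeta_series t b0 x1)) => N.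
  by rewrite /diff_series -sumrB; apply: eq_bigr => m _; rewrite mul1r.
apply: (ccvg_nrm_le (N := 0) (hh s s0)) => N _.
apply: le_trans (nrm_sum _ _ _) _.
have K0 : 0 <= (s + `|t|) * (beta - alpha).
  by rewrite mulr_ge0 ?subr_ge0 // addr_ge0 // ltW.
rewrite mulrAC; apply: le_trans (ler_wpM2l K0 (riemann_sum_bound N s0)).
rewrite mulr_sumr; apply: ler_sum => m _; rewrite mul1r.
have m0 : 0 < X m by rewrite /X; have := ler0n R m; lra.
apply: le_trans (dpow_sub t (ltW s0) m0 _) _; first by rewrite /X /Y; lra.
have -> : Y m - X m = beta - alpha by rewrite /X /Y; ring.
rewrite ler_wpM2l //.
rewrite (_ : - s - 1 = - (1 + s)); last by ring.
rewrite (_ : -1 - s = - (1 + s)); last by ring.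
rewrite !powRN lef_pV2 ?posrE ?powR_gt0 //.
apply: ge0_ler_powR; rewrite ?nnegrE ?(ltW m0) //; first by rewrite addr_ge0 // ltW.
by rewrite /X -natr1 lerD2l.
Qed.

Lemma sum_blocks (V : nmodType) (f : nat -> V) q M :
  \sum_(k < q * M) f k = \sum_(m < M) \sum_(j < q) f (q * m + j)%N.
Proof.
elim: M => [|M IH]; first by rewrite muln0 !big_ord0.
by rewrite mulnS addnC big_split_ord big_ord_recr /= IH.
Qed.

Lemma kubert_zeta q alpha t s : (0 < q)%N -> 0 < alpha -> t != 0 -> 0 < s ->
  \sum_(j < q) dpow t s q%:R * zeta (Complex s t) ((alpha + j%:R) / q%:R) =
  zeta (Complex s t) alpha.
Proof.
move=> q0 a0 t0 s0; have qp : 0 < q%:R :> R by rewrite ltr0n.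
have aj j : 0 < (alpha + j%:R) / q%:R by rewrite divr_gt0 // ltr_wpDr.
apply/eqP; rewrite -subr_eq0; apply/eqP.
apply: (@ran_identity _ (fun s => (\sum_(j < q) dpow t s q%:R * zeta (Complex s t) ((alpha + j%:R) / q%:R)) -
   zeta (Complex s t) alpha)) s0.
  move=> x x0; apply: ranB; last exact: ran_zeta.
  by apply: ran_sum => j; apply: ran_mul; [apply: ran_dpow | apply: ran_zeta].
move=> x x1; apply/eqP; rewrite subr_eq0; apply/eqP.
have := zeta_series t a0 x1 => /(ccvg_subseq (f := muln q)) h.
apply: ccvg_unique (h (fun n => leq_pmull n q0)).
apply: ccvg_ext (ccvg_sum (index_enum 'I_q) (fun j : 'I_q => ccvgZ (dpow t x q%:R) (zeta_series t (aj j) x1))).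
move=> N /=; rewrite (sum_blocks (fun m => dpow t x (m%:R + alpha))) exchange_big /=.
under eq_bigr do rewrite mulr_sumr; apply: eq_bigr => m _; apply: eq_bigr => j _.
rewrite -dpowM //; last by rewrite ltr_wpDl.
congr dpow; rewrite mulrDr mulrCA divff ?gt_eqF // mulr1 natrD natrM; ring.
Qed.

End HurwitzZeta.

End ZetaFunctions.

Section PeriodicZetaRegularity.
Variable R : realType.
Local Notation C := (R[i]).
Local Notation nrm := (@Normc.normc R).
Variable F : R -> C -> C.
Hypothesis hF : is_periodic_zeta F.

Lemma cis_2pi_nat n : cis (n%:R * (2 * pi)) = 1 :> C.
Proof. by rewrite -[_ * _]add0r cis_period_nat cis0. Qed.

Lemma sum_roots_of_unity (q n : nat) : (0 < q)%N ->
  \sum_(j < q) cis (n%:R * (2 * pi * (j%:R / q%:R))) =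
  (if (q %| n)%N then q%:R else 0) :> C.
Proof.
move=> q0; have qp : 0 < q%:R :> R by rewrite ltr0n.
pose z : C := cis (2 * pi * (n%:R / q%:R)).
have zE j : cis (n%:R * (2 * pi * (j%:R / q%:R))) = z ^+ j :> C.
  by rewrite -cis_natM; congr cis; ring.
under eq_bigr do rewrite zE.
case: ifP => [/dvdnP[m ->]|qn] in z {zE} *.
  have -> : z = 1.
    rewrite /z natrM mulfK ?gt_eqF // mulrC; exact: cis_2pi_nat.
  by under eq_bigr do rewrite expr1n; rewrite sumr_const card_ord.
have z1 : z != 1.
  have -> : z = cis (2 * pi * ((n %% q)%:R / q%:R)).
    rewrite /z -[RHS](cis_period_nat _ (n %/ q)); congr cis.
    by rewrite {1}(divn_eq n q) natrD natrM; field; rewrite gt_eqF.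
  apply: cis_neq1; have p0 := pi_gt0 R.
  have m0 : (0 < n %% q)%N by rewrite lt0n; apply/negP => /eqP h; rewrite /dvdn h in qn.
  rewrite mulr_gt0 ?divr_gt0 ?mulr_gt0 ?ltr0n //=.
  by rewrite gtr_pMr ?mulr_gt0 // ltr_pdivrMr // mul1r ltr_nat ltn_mod.
have z10 : z - 1 != 0 by rewrite subr_eq0.
apply: (mulfI z10).
rewrite mulr0 -subrX1; apply/eqP; rewrite subr_eq0 /z -cis_natM.
rewrite (_ : _ * _ = n%:R * (2 * pi)); first by rewrite cis_2pi_nat.
by field; rewrite gt_eqF.
Qed.

Lemma kubert_F q (alpha t s : R) : (0 < q)%N -> 0 < alpha < 1 -> 0 < s ->
  \sum_(j < q) F (2 * pi * ((alpha + j%:R) / q%:R)) (Complex s t) =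
  q%:R * dpow t s q%:R * F (2 * pi * alpha) (Complex s t).
Proof.
move=> q0 /andP[a0 a1] s0; have qp : 0 < q%:R :> R by rewrite ltr0n.
have p0 := pi_gt0 R.
have aj (j : 'I_q) : 0 < 2 * pi * ((alpha + j%:R) / q%:R) < 2 * pi.
  have h1 : 0 < (alpha + j%:R) / q%:R by rewrite divr_gt0 // ltr_wpDr.
  have h2 : (alpha + j%:R) / q%:R < 1.
    rewrite ltr_pdivrMr // mul1r.
    have : (j.+1%:R : R) <= q%:R by rewrite ler_nat.
    by rewrite -natr1; lra.
  by move: h1 h2; set x := _ / _ => h1 h2; apply/andP; split; nra.
have aa : 0 < 2 * pi * alpha < 2 * pi.
  by apply/andP; split; nra.
have h := ccvg_sum (index_enum 'I_q) (fun j : 'I_q => F_series hF t (aj j) s0).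
have := ccvg_subseq (f := muln q) (fun n => leq_pmull n q0) h.
move/ccvg_unique; apply.
apply: ccvg_ext (ccvgZ (q%:R * dpow t s q%:R) (F_series hF t aa s0)) => N /=.
rewrite exchange_big /= (sum_blocks (fun k => \sum_(j < q) cis (k.+1%:R * (2 * pi * ((alpha + j%:R) / q%:R))) * dpow t s k.+1%:R)).
rewrite /pz_sum mulr_sumr; apply: eq_bigr => m _.
have E k : \sum_(j < q) cis (k.+1%:R * (2 * pi * ((alpha + j%:R) / q%:R))) * dpow t s k.+1%:R =
   cis (k.+1%:R * (2 * pi * (alpha / q%:R))) * dpow t s k.+1%:R * (if (q %| k.+1)%N then q%:R else 0).
  rewrite -sum_roots_of_unity // mulr_sumr; apply: eq_bigr => j _.
  have -> : k.+1%:R * (2 * pi * ((alpha + j%:R) / q%:R)) =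
     k.+1%:R * (2 * pi * (alpha / q%:R)) + k.+1%:R * (2 * pi * (j%:R / q%:R)) :> R by ring.
  by rewrite cisD; ring.
under eq_bigr do rewrite E.
have qE : (q.-1 < q)%N by rewrite prednK.
rewrite (bigD1 (Ordinal qE)) //= big1 => [|j jq]; last first.
  rewrite -addnS dvdn_addr ?dvdn_mulr //.
  case: ifP => [/dvdn_leq h1|_]; last by rewrite mulr0.
  case/negP: jq; apply/eqP/val_inj => /=; apply/eqP.
  by rewrite -eqSS prednK // eqn_leq ltn_ord h1.
rewrite addr0 -addnS prednK // -[X in (_ + X)%N]muln1 -mulnDr addn1 dvdn_mulr //.
rewrite natrM dpowM //.
have -> : q%:R * m.+1%:R * (2 * pi * (alpha / q%:R)) = m.+1%:R * (2 * pi * alpha) :> R.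
  by field; rewrite gt_eqF.
by ring.
Qed.

(** Second differences gain a factor [x ^ -2], one of which pays for the
    derivative in [theta]. *)
Lemma dpow_second_difference t s x : 0 <= s -> 1 <= x ->
  nrm (dpow t s x - 2 * dpow t s (x + 1) + dpow t s (x + 2)) <=
   ((s + `|t|) ^+ 2 + (s + `|t|)) * x `^ (- s - 2).
Proof.
move=> s0 x1; have x0 : 0 < x by lra.
set K := s + _; have K0 : 0 <= K by rewrite addr_ge0.
pose a := (x + 1) / x; pose b := (x + 2) / x.
have aE : a = 1 + x^-1 by rewrite /a mulrDl divff ?gt_eqF // mul1r.
have bE : b = 1 + 2 * x^-1 by rewrite /b mulrDl divff ?gt_eqF.
have xi : 0 < x^-1 by rewrite invr_gt0.
have a1 : 1 <= a by lra. have b1 : 1 <= b by lra.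
have a0 : 0 < a by lra. have b0 : 0 < b by lra.
have -> : dpow t s (x + 1) = dpow t s x * dpow t s a.
  by rewrite -dpowM //; congr dpow; rewrite /a mulrCA divff ?gt_eqF ?mulr1.
have -> : dpow t s (x + 2) = dpow t s x * dpow t s b.
  by rewrite -dpowM //; congr dpow; rewrite /b mulrCA divff ?gt_eqF ?mulr1.
have d1 : dpow t s 1 = 1.
  by rewrite dpowE // ln1 mulr0 oppr0 cis0 powR1 mulr1.
have -> : dpow t s x - 2 * (dpow t s x * dpow t s a) + dpow t s x * dpow t s b =
   dpow t s x * ((dpow t s 1 - dpow t s a) ^+ 2 + (dpow t s b - dpow t s (a * a))).
  by rewrite d1 (dpowM t s a0 a0); ring.
rewrite nrmM nrm_dpow //.
have -> : x `^ (- s - 2) = x `^ (- s) * (x^-1) ^+ 2.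
  rewrite powRB; last by rewrite (gt_eqF x0) implybT.
  by rewrite exprVn powR_mulrn // ltW.
rewrite [leRHS]mulrCA ler_wpM2l ?powR_ge0 //.
apply: le_trans (nrmD _ _) _; rewrite nrmX mulrDl lerD //.
  rewrite -exprMn lerXn2r ?nnegrE ?nrm_ge0 ?mulr_ge0 ?(ltW xi) //.
  by have := dpow_sub t s0 ltr01 a1; rewrite powR1 mulr1 -/K aE addrAC subrr add0r.
have ba : b <= a * a by rewrite aE bE; nra.
apply: le_trans (dpow_sub t s0 b0 ba) _; rewrite -/K -mulrA ler_wpM2l //.
have -> : a * a - b = x^-1 ^+ 2 by rewrite aE bE; ring.
rewrite ler_piMr ?exprn_ge0 ?(ltW xi) //.
have -> : - s - 1 = - (s + 1) by ring.
rewrite powRN invf_le1 ?powR_gt0 //.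
by rewrite -[leLHS](powRr0 b) ler_powR // addr_ge0.
Qed.

Definition second_backward (t s : R) : nat -> C := backward (backward (fun n => dpow t s n.+1%:R)).

Lemma second_backward_bound t : exists2 K : R, 0 <= K & forall n,
  nrm (second_backward t (1 / 2) n) <= K * n.+1%:R `^ (- 5 / 2).
Proof.
pose A := ((1 / 2 + `|t|) ^+ 2 + (1 / 2 + `|t|)) : R.
have A0 : 0 <= A by rewrite addr_ge0 ?sqr_ge0 ?addr_ge0.
pose K0 := (nrm (second_backward t (1 / 2) 0) + nrm (second_backward t (1 / 2) 1)) * 2 `^ (5 / 2).
have K00 : 0 <= K0 by rewrite mulr_ge0 ?powR_ge0 ?addr_ge0 ?nrm_ge0.
exists (K0 + A * 3 `^ (5 / 2)) => [|n]; first by rewrite addr_ge0 // mulr_ge0 ?powR_ge0.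
have E a : (a : R) `^ (- 5 / 2) = (a `^ (5 / 2))^-1 by rewrite mulNr powRN.
case: n => [|[|n]].
- have h2 : 1 <= 2 `^ (5 / 2) :> R by rewrite -[leLHS](powRr0 2) ler_powR //; lra.
  rewrite powR1 mulr1 -[leLHS]addr0 lerD ?mulr_ge0 ?powR_ge0 //.
  rewrite -[leLHS]mulr1 ler_pM ?nrm_ge0 //.
  by rewrite lerDl nrm_ge0.
- rewrite E mulrDl -[leLHS]addr0 lerD ?mulr_ge0 ?invr_ge0 ?powR_ge0 //.
  by rewrite /K0 mulfK ?lerDr ?nrm_ge0 // gt_eqF ?powR_gt0.
have n1 : 1 <= n.+1%:R :> R by rewrite ler1n.
have := dpow_second_difference t (_ : 0 <= 1 / 2) n1; rewrite divr_ge0 // => /(_ isT).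
rewrite -/A (_ : n.+1%:R + 1 = n.+2%:R); last by rewrite natr1.
rewrite (_ : n.+1%:R + 2 = n.+3%:R); last by rewrite -[n.+3%:R]natr1 -[n.+2%:R]natr1; ring.
rewrite (_ : _ - _ + _ = second_backward t (1 / 2) n.+2); last first.
  by rewrite /second_backward /backward; ring.
move/le_trans; apply; rewrite [leRHS]mulrDl -[leLHS]add0r lerD ?(mulr_ge0 K00) ?powR_ge0 //.
rewrite -[leRHS]mulrA ler_wpM2l // (_ : - (1 / 2) - 2 = - 5 / 2); last by field.
rewrite !E ler_pdivlMr ?powR_gt0 // ler_pdivrMl ?powR_gt0 // -powRM //.
by apply: ge0_ler_powR; rewrite ?nnegrE ?mulr_ge0 // -natrM ler_nat; lia.
Qed.

(** Multiplying by (1 - e ^ (i theta)) ^ 2 turns the series into one that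
    converges absolutely together with its termwise derivative. *)
Lemma F_lipschitz t (d : R) : 0 < d ->
  exists2 L : R, 0 <= L & forall th th', d <= th <= 2 * pi - d -> d <= th' <= 2 * pi - d ->
    nrm (F th (Complex (1 / 2) t) - F th' (Complex (1 / 2) t)) <= L * `|th - th'|.
Proof.
move=> d0; have s0 : 0 < 1 / 2 :> R by lra.
have [K K0 hK] := second_backward_bound t.
pose G th := (1 - cis th) * ((1 - cis th) * F th (Complex (1 / 2) t)).
have Gc th : 0 < th < 2 * pi -> ccvg (fun N => \sum_(n < N) cis th ^+ n.+1 * second_backward t (1 / 2) n) (G th).
  move=> hth.
  have t0 := @dpow_tends0 R t (1 / 2) s0.
  have t1 : ccvg (backward (fun n => dpow t (1 / 2) n.+1%:R)) 0.
    move=> e e0; have [N HN] := t0 (e / 2) ltac:(lra); exists N.+1 => -[//|n] nN.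
    rewrite subr0; apply: le_trans (nrmB _ _) _.
    have := HN n.+1 (ltnW nN); have := HN n nN; rewrite !subr0; lra.
  apply: ccvg_backward t1 _; rewrite ?nrm_cis //.
  apply: ccvg_backward t0 _; rewrite ?nrm_cis //.
  apply: ccvg_ext (F_series hF t hth s0) => N.
  by apply: eq_bigr => n _; rewrite cis_natM.
pose B := K * (1 + (1 / 2)^-1).
have B0 : 0 <= B by rewrite mulr_ge0 // addr_ge0 // invr_ge0 ltW.
have Gle th : 0 < th < 2 * pi -> nrm (G th) <= B.
  move=> hth; apply: (ccvg_nrm_le (N := 0) (Gc th hth)) => N _.
  apply: le_trans (nrm_sum _ _ _) _; apply: le_trans (ler_wpM2l K0 (riemann_sum_bound N s0)).
  rewrite mulr_sumr; apply: ler_sum => n _; rewrite nrmM nrmX nrm_cis expr1n mul1r.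
  apply: le_trans (hK n) _; rewrite ler_wpM2l //.
  by rewrite ler_powR ?ler1n //; lra.
have GL th th' : 0 < th < 2 * pi -> 0 < th' < 2 * pi -> nrm (G th - G th') <= B * `|th - th'|.
  move=> hth hth'; apply: (ccvg_nrm_le (N := 0) (ccvgB (Gc th hth) (Gc th' hth'))) => N _.
  rewrite -sumrB; apply: le_trans (nrm_sum _ _ _) _; rewrite /B mulrAC.
  apply: le_trans (ler_wpM2l _ (riemann_sum_bound N s0)); last by rewrite mulr_ge0.
  rewrite mulr_sumr; apply: ler_sum => n _; rewrite -mulrBl nrmM -!cis_natM.
  apply: le_trans (ler_pM _ _ (chord_dist _ _) (hK n)) _; rewrite ?nrm_ge0 //.
  have n0 : 0 < n.+1%:R :> R by [].
  rewrite -mulrBr normrM ger0_norm // le_eqVlt; apply/orP; left; apply/eqP.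
  have -> : n.+1%:R `^ (-1 - 1 / 2) = n.+1%:R * n.+1%:R `^ (- 5 / 2) :> R.
    rewrite (_ : - 1 - 1 / 2 = 1 + (- 5 / 2)); last by field.
    rewrite powRD; last by rewrite (gt_eqF n0) implybT.
    by rewrite powRr1 // ltW.
  by ring.
pose u th : C := (1 - cis th)^-1.
have hu th : d <= th <= 2 * pi - d -> [/\ 0 < th < 2 * pi, 1 - cis th != 0 & nrm (u th) <= 4 / d].
  move=> hth; have := chord_ge (ltW d0) hth; move/andP: hth => [h1 h2] hc.
  have hn : 0 < nrm (1 - cis th) by apply: lt_le_trans hc; lra.
  have hth : 0 < th < 2 * pi by apply/andP; split; lra.
  split => //; first by rewrite subr_eq0 eq_sym cis_neq1.
  by rewrite /u nrmV -[4 / d]invf_div lef_pV2 ?posrE // divr_gt0.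
have D0 : 0 <= 4 / d by rewrite divr_ge0 // ltW.
have Q0 : 0 <= B * (4 / d) ^+ 2 := mulr_ge0 B0 (sqr_ge0 _).
exists (B * (4 / d) ^+ 2 + B * (4 / d) ^+ 2 * (4 / d + 4 / d)).
  exact: addr_ge0 Q0 (mulr_ge0 Q0 (addr_ge0 D0 D0)).
move=> th th' /hu[h1 h2 h3] /hu[h1' h2' h3'].
have FE x : 1 - cis x != 0 -> F x (Complex (1 / 2) t) = G x * u x ^+ 2.
  by move=> hx; rewrite /G /u; field.
(* [F = G u ^ 2], where both [G] and [u = (1 - cis) ^ (- 1)] are Lipschitz. *)
have -> : F th (Complex (1 / 2) t) - F th' (Complex (1 / 2) t) =
    (G th - G th') * u th ^+ 2 + G th' * (u th * u th') * (cis th - cis th') * (u th + u th').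
  rewrite !FE //; have : u th - u th' = (cis th - cis th') * (u th * u th').
    by rewrite /u; field; rewrite h2 h2'.
  move=> e; transitivity ((G th - G th') * u th ^+ 2 + G th' * ((u th - u th') * (u th + u th'))); first by ring.
  by rewrite e; ring.
apply: le_trans (nrmD _ _) _; rewrite [leRHS]mulrDl lerD //.
  rewrite nrmM nrmX [leRHS]mulrAC ler_pM ?nrm_ge0 ?exprn_ge0 ?nrm_ge0 ?GL //.
  by rewrite lerXn2r ?nnegrE ?nrm_ge0.
rewrite [leRHS]mulrAC 3!nrmM.
apply: ler_pM; rewrite ?mulr_ge0 ?nrm_ge0 //; last first.
  by apply: le_trans (nrmD _ _) _; rewrite lerD.
apply: ler_pM; rewrite ?mulr_ge0 ?nrm_ge0 ?chord_dist //.
by apply: ler_pM; rewrite ?mulr_ge0 ?nrm_ge0 ?Gle // nrmM expr2 ler_pM ?nrm_ge0.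
Qed.

End PeriodicZetaRegularity.

(** * Functions satisfying the Kubert identities *)

Section KubertFunctions.
Variable R : realType.
Local Notation C := (R[i]).
Local Notation nrm := (@Normc.normc R).
Variable t : R.
Local Notation e := (dpow (- t) (1 / 2)).

(** The Kubert identities of the weight for which both [alpha |-> F(2 pi alpha, s)]
    and [alpha |-> zeta(1 - s, alpha)] are solutions, where [s = 1 / 2 + i t]. *)
Definition kubert (g : R -> C) : Prop :=
  forall q alpha, (0 < q)%N -> 0 < alpha < 1 ->
    \sum_(j < q) e q%:R * g ((alpha + j%:R) / q%:R) = g alpha.

Definition locally_lip (g : R -> C) : Prop :=
  forall d, 0 < d -> exists2 L : R, 0 <= L & forall x y,
    d <= x <= 1 - d -> d <= y <= 1 - d -> nrm (g x - g y) <= L * `|x - y|.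

Definition lip_on (I : R -> Prop) (g : R -> C) : Prop :=
  exists2 L : R, 0 <= L & forall x y, I x -> I y -> nrm (g x - g y) <= L * `|x - y|.

Definition left_half (x : R) : Prop := 0 < x <= 1 / 2.

Lemma lip_onB I f g : lip_on I f -> lip_on I g ->
  lip_on I (fun x => f x - g x).
Proof.
move=> [L L0 hL] [M M0 hM]; exists (L + M) => [|x y hx hy]; first exact: addr_ge0.
rewrite mulrDl; apply: le_trans (lerD (hL x y hx hy) (hM x y hx hy)).
rewrite (_ : _ - _ = (f x - f y) - (g x - g y)); [exact: nrmB | ring].
Qed.

Lemma lip_onZ I (a : C) g : lip_on I g -> lip_on I (fun x => a * g x).
Proof.
move=> [L L0 hL]; exists (nrm a * L) => [|x y hx hy]; first by rewrite mulr_ge0 ?nrm_ge0.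
by rewrite -mulrBr nrmM -mulrA ler_wpM2l ?nrm_ge0 // hL.
Qed.

Lemma lip_on_ext I f g : (forall x, I x -> f x = g x) ->
  lip_on I f -> lip_on I g.
Proof. by move=> h [L L0 hL]; exists L => // x y hx hy; rewrite -!h // hL. Qed.

Lemma lip_on_bounded I g : (forall x, I x -> `|x| <= 1) -> lip_on I g ->
  exists2 B : R, 0 <= B & forall x, I x -> nrm (g x) <= B.
Proof.
move=> hI [L L0 hL]; have [[y hy]|hn] := pselect (exists y, I y); last first.
  by exists 0 => // x hx; case: hn; exists x.
exists (nrm (g y) + L * 2) => [|x hx]; first by rewrite addr_ge0 ?nrm_ge0 ?mulr_ge0.
have := nrmD (g y) (g x - g y); rewrite addrC subrK => /le_trans; apply.
rewrite lerD2l; apply: le_trans (hL x y hx hy) _; rewrite ler_wpM2l //.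
apply: le_trans (ler_normB _ _) _; have := hI x hx; have := hI y hy; lra.
Qed.

Lemma nrm_e x : 0 < x -> nrm (e x) = x `^ (- (1 / 2)).
Proof. exact: nrm_dpow. Qed.

Lemma e_neq0 x : 0 < x -> e x != 0.
Proof. by move=> x0; rewrite -nrm_eq0 nrm_e // gt_eqF ?powR_gt0. Qed.

Lemma e_half_lt1 : nrm (e 2) < 1.
Proof.
rewrite nrm_e // powRN invf_lt1 ?powR_gt0 // -[ltLHS](powRr0 2).
by rewrite /powR gt_eqF // ltr_expR ltr_pM2r ?ln_gt0 //; lra.
Qed.

Lemma e_lipschitz d : 0 < d -> lip_on (fun x => d <= x) e.
Proof.
move=> d0; exists ((1 / 2 + `|t|) * d `^ (- (1 / 2) - 1)).
  by rewrite mulr_ge0 ?powR_ge0 // addr_ge0.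
move=> x y; wlog xy : x y / x <= y => [H dx dy|dx dy].
  have [/H->//|/ltW/H] := leP x y; by rewrite nrmBC distrC => ->.
have x0 : 0 < x by apply: lt_le_trans dx.
have h := @dpow_sub R (- t) (1 / 2) x y ltac:(lra) x0 xy.
apply: le_trans h _; rewrite normrN distrC (ger0_norm (_ : 0 <= y - x)) ?subr_ge0 //.
rewrite mulrAC ler_wpM2r ?subr_ge0 // ler_wpM2l ?addr_ge0 //.
rewrite (_ : - (1 / 2) - 1 = - (3 / 2)); last by field.
rewrite !powRN lef_pV2 ?posrE ?powR_gt0 //.
by apply: ge0_ler_powR; rewrite ?nnegrE ?(ltW x0) ?(ltW d0).
Qed.

Lemma kubert_reflect g : kubert g -> kubert (fun x => g (1 - x)).
Proof.
move=> hg q a q0 /andP[a0 a1]; have qp : 0 < q%:R :> R by rewrite ltr0n.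
rewrite -(hg q (1 - a) q0); last by apply/andP; split; lra.
rewrite (reindex_inj rev_ord_inj) /=; apply: eq_bigr => j _; congr (_ * g _).
rewrite natrB // -natr1; field; by rewrite gt_eqF.
Qed.

Lemma kubertB f g : kubert f -> kubert g -> kubert (fun x => f x - g x).
Proof.
move=> hf hg q a q0 ha; rewrite -(hf q a q0 ha) -(hg q a q0 ha) -sumrB.
by apply: eq_bigr => j _; rewrite mulrBr.
Qed.

Lemma kubertZ (c : C) g : kubert g -> kubert (fun x => c * g x).
Proof.
move=> hg q a q0 ha; rewrite -(hg q a q0 ha) mulr_sumr.
by apply: eq_bigr => j _; rewrite mulrCA.
Qed.

Lemma locally_lip_reflect g : locally_lip g -> locally_lip (fun x => g (1 - x)).
Proof.
move=> hg d d0; have [L L0 hL] := hg d d0; exists L => // x y hx hy.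
rewrite (_ : `|x - y| = `|(1 - x) - (1 - y)|); last by rewrite distrC; congr `|_|; ring.
by apply: hL; lra.
Qed.

(** The identity expresses a difference of two values as [q] differences at
    distance at most [1 / q], each with a weight of size [1 / sqrt q]; letting [q]
    grow shows that the function is constant, and the identity for [q = 2] excludes
    the nonzero constants. *)
Lemma kubert_lipschitz_eq0 H : kubert H -> lip_on (fun x => 0 < x < 1) H ->
  forall x, 0 < x < 1 -> H x = 0.
Proof.
move=> hK [L L0 hL].
have hconst (x y : R) : 0 < x < 1 -> 0 < y < 1 -> H x = H y.
  move=> hx hy; apply/eqP; rewrite -subr_eq0 -nrm_eq0 eq_le nrm_ge0 andbT.
  apply/ler_addgt0Pr => d d0; rewrite add0r.
  have L1 : 0 < L + 1 by lra.
  have [N HN] := @powR_tends0 R (1 / 2) (d / (L + 1)) ltac:(lra) (divr_gt0 d0 L1).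
  have := HN N (leqnn N); set q := N.+1 => hq.
  have qp : 0 < q%:R :> R by [].
  rewrite -(hK q x) // -(hK q y) // -sumrB.
  apply: le_trans (nrm_sum _ _ _) _.
  apply: le_trans (_ : \sum_(j < q) d / (L + 1) * (L / q%:R) <= _); last first.
    rewrite sumr_const card_ord -[leLHS]mulr_natr -[leLHS]mulrA mulfVK ?gt_eqF //.
    by rewrite mulrAC ler_pdivrMr // ler_wpM2l ?lerDl // ltW.
  apply: ler_sum => j _; rewrite -mulrBr nrmM nrm_e //; apply: ler_pM; rewrite ?powR_ge0 ?nrm_ge0 //.
  have inI (z : R) : 0 < z < 1 -> 0 < (z + j%:R) / q%:R < 1.
    move=> /andP[z0 z1]; apply/andP; split; first by rewrite divr_gt0 // ltr_wpDr.
    rewrite (ltr_pdivrMr _ _ qp) mul1r.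
    have : (j.+1%:R : R) <= q%:R by rewrite ler_nat.
    by rewrite -natr1; lra.
  apply: le_trans (hL _ _ (inI x hx) (inI y hy)) _; rewrite ler_wpM2l //.
  rewrite -mulrBl normrM [`|q%:R^-1|]ger0_norm ?invr_ge0 // -[leRHS]mul1r ler_wpM2r ?invr_ge0 //.
  rewrite (_ : x + j%:R - (y + j%:R) = x - y); last by ring.
  by move/andP: hx => [? ?]; move/andP: hy => [? ?]; rewrite ler_norml; apply/andP; split; lra.
move=> x hx.
have half : 0 < (1 / 2 : R) < 1 by apply/andP; split; lra.
have h := hK 2%N (1 / 2) isT half; have {}hK := h.
have E (j : nat) : (j < 2)%N -> H ((1 / 2 + j%:R) / 2%:R) = H (1 / 2).
  move=> j2; apply: hconst => //; have : (j.+1%:R : R) <= 2 by rewrite ler_nat.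
  by rewrite -natr1 => h1; have := ler0n R j => h2; apply/andP; split; lra.
rewrite (hconst x (1 / 2)) //; move: h.
under eq_bigr => j _ do rewrite E //.
rewrite sumr_const card_ord -[_ * _ *+ 2]mulr_natr -[_ * _ * 2]mulrA => h.
 apply/eqP; rewrite -nrm_eq0; apply/negPn/negP => n0.
have n1 : 0 < nrm (H (1 / 2)) by rewrite lt_neqAle eq_sym n0 nrm_ge0.
have : nrm (e 2) = 2^-1.
  have : nrm (e 2 * (H (1 / 2) * 2)) = nrm (H (1 / 2)) by rewrite h.
  rewrite nrmM [nrm (_ * 2)]nrmM.
  have -> : nrm (2 : C) = 2 by rewrite -[2 : C](rmorph_nat (real_complex R)) nrm_real ger0_norm.
  move=> h2; apply: (mulIf (_ : nrm (H (1 / 2)) * 2 != 0)); first by rewrite mulf_neq0.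
  by rewrite h2; field.
rewrite nrm_e // powRN => /invr_inj h2.
have : (2 : R) `^ (1 / 2) < 2.
  by rewrite -[ltRHS](powRr1 (_ : 0 <= 2)) // /powR gt_eqF // ltr_expR ltr_pM2r ?ln_gt0 //; lra.
by rewrite h2 ltxx.
Qed.

End KubertFunctions.

Section KubertSingularity.
Variable R : realType.
Local Notation C := (R[i]).
Local Notation nrm := (@Normc.normc R).
Variable t : R.
Local Notation e := (dpow (- t) (1 / 2)).

Lemma geometric_sum_bound (r : R) N : 0 <= r < 1 ->
  \sum_(k < N) r ^+ k <= (1 - r)^-1.
Proof.
move=> /andP[r0 r1]; have r2 : 0 < 1 - r by lra.
rewrite -[leRHS]mul1r ler_pdivlMr // mulrC.
have -> : (1 - r) * \sum_(k < N) r ^+ k = 1 - r ^+ N.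
  by elim: N => [|N IH]; rewrite ?big_ord0 ?big_ord_recr /= ?mulrDr ?IH ?exprS; ring.
by rewrite gerBl exprn_ge0.
Qed.

Lemma geometric_small (r d : R) : 0 <= r < 1 -> 0 < d -> exists k, r ^+ k <= d.
Proof.
move=> /andP[r0 r1] d0.
have h : r ^+ n @[n --> \oo] --> (0 : R) by apply: cvg_expr; rewrite ger0_norm.
have /cvgrPdist_le/(_ d d0)[N _ HN] := h.
exists N; have := HN N (leqnn N); rewrite sub0r normrN ger0_norm ?exprn_ge0 //.
Qed.

(** Near [0] a Kubert function is a multiple of [e] up to a Lipschitz error:
    the identity for [q = 2] isolates the error as a convergent series, and the
    identities for the other [q] force the rest to be homogeneous. *)
Section Decomposition.
Variable g : R -> C.
Hypothesis gK : kubert t g.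
Hypothesis gL : locally_lip g.

Let rho : R := nrm (e 2).

Let rho0 : 0 <= rho. Proof. exact: nrm_ge0. Qed.
Let rho1 : rho < 1. Proof. exact: e_half_lt1. Qed.

Let arg (x : R) k : R := (x / 2 ^+ k + 1) / 2.

Let arg_in x k : left_half x -> 1 / 4 <= arg x k <= 1 - 1 / 4.
Proof.
move=> /andP[x0 x1]; have k1 : 1 <= (2 : R) ^+ k by rewrite exprn_ege1 // ler1n.
have : 0 <= x / 2 ^+ k by rewrite divr_ge0 ?exprn_ge0 // ltW.
have : x / 2 ^+ k <= 1 / 2.
  rewrite ler_pdivrMr ?exprn_gt0 //; nra.
by rewrite /arg => ? ?; apply/andP; split; lra.
Qed.

Let locally_bounded (d : R) : 0 < d -> exists2 B : R, 0 <= B &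
  forall x, d <= x <= 1 - d -> nrm (g x) <= B.
Proof.
move=> d0; have [L L0 hL] := gL d0.
apply: (@lip_on_bounded R (fun x => d <= x <= 1 - d) g); last by exists L.
by move=> x h; rewrite ler_norml; apply/andP; split; lra.
Qed.

(** The remainder is the sum of the terms of index [j = 1] obtained by iterating
    the identity for [q = 2]; their arguments stay away from the endpoints. *)
Let remainder_exists : exists2 r : R -> C,
  lip_on (@left_half R) r &
  forall x, left_half x -> r x = e 2 * g ((x + 1) / 2) + e 2 * r (x / 2).
Proof.
have q4 : 0 < 1 / 4 :> R by lra.
have [B B0 hB] := locally_bounded q4.
have [L L0 hL] := gL q4.
pose T x k := e 2 ^+ k.+1 * g (arg x k).
have hT x : left_half x -> forall n, \sum_(k < n) nrm (T x k) <= (rho * B) * (1 - rho)^-1.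
  move=> hx n; apply: le_trans (ler_wpM2l (mulr_ge0 rho0 B0) (geometric_sum_bound n _)); last by rewrite rho0.
  rewrite mulr_sumr; apply: ler_sum => k _; rewrite nrmM nrmX -/rho exprS.
  rewrite [leRHS]mulrAC ler_wpM2l ?mulr_ge0 ?exprn_ge0 // hB //; exact: arg_in.
have hex x : exists l, left_half x -> ccvg (fun n => \sum_(k < n) T x k) l.
  have [hx|] := pselect (left_half x); last by exists 0.
  by have [l hl _] := abs_ccvg (hT x hx); exists l.
have [r hr] := choice hex; exists r.
  exists (L * (1 - rho)^-1) => [|x y hx hy]; first by rewrite mulr_ge0 // invr_ge0 subr_ge0 ltW.
  apply: (ccvg_nrm_le (N := 0) (ccvgB (hr x hx) (hr y hy))) => n _.
  rewrite -sumrB; apply: le_trans (nrm_sum _ _ _) _; rewrite mulrAC.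
  apply: le_trans (ler_wpM2l _ (geometric_sum_bound n (_ : 0 <= rho < 1))); rewrite ?rho0 ?mulr_ge0 //.
  rewrite mulr_sumr; apply: ler_sum => k _.
  rewrite /T -mulrBr nrmM nrmX -/rho mulrC; apply: ler_pM; rewrite ?nrm_ge0 ?exprn_ge0 //; last first.
    by rewrite exprS ler_piMl ?exprn_ge0 // ltW.
  apply: le_trans (hL _ _ (arg_in k hx) (arg_in k hy)) _; rewrite ler_wpM2l //.
  have k1 : 1 <= (2 : R) ^+ k by rewrite exprn_ege1 // ler1n.
  have -> : arg x k - arg y k = (x - y) / (2 ^+ k * 2).
    by rewrite /arg; field; rewrite gt_eqF // exprn_gt0.
  rewrite normrM [X in _ * X]ger0_norm ?invr_ge0 ?mulr_ge0 ?exprn_ge0 //.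
  rewrite -[leRHS]mulr1 ler_wpM2l // invf_le1 ?mulr_gt0 ?exprn_gt0 //; nra.
move=> x hx; have hx2 : left_half (x / 2).
  by move/andP: hx => [? ?]; apply/andP; split; lra.
have h1 := ccvg_subseq (f := succn) (fun n => leqnSn n) (hr x hx).
apply: ccvg_unique h1 _; rewrite -/(comp _ _).
apply: ccvg_ext (ccvgD (ccvg_cst (e 2 * g ((x + 1) / 2))) (ccvgZ (e 2) (hr _ hx2))) => n /=.
rewrite big_ord_recl /= /T /arg expr1 expr0 divr1; congr (_ + _).
rewrite mulr_sumr; apply: eq_bigr => k _; rewrite /bump /= add1n [e 2 ^+ k.+2]exprS -[RHS]mulrA.
congr (_ * (_ * g _)); rewrite exprS invfM; ring.
Qed.

Lemma singular_part : exists c : C, exists2 r : R -> C,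
  lip_on (@left_half R) r & forall x, left_half x -> g x = c * e x + r x.
Proof.
have [r rL rE] := remainder_exists.
have halfP (x : R) : left_half x -> left_half (x / 2).
  by move=> /andP[? ?]; apply/andP; split; lra.
have e20 : e 2 != 0 by rewrite e_neq0.
(* The identity for [q = 2] makes [P] homogeneous under halving. *)
pose P (x : R) : C := g x - r x.
have P2 (x : R) : left_half x -> P x = e 2 * P (x / 2).
  move=> hx; have hx1 : 0 < x < 1 by move/andP: hx => [? ?]; apply/andP; split; lra.
  rewrite /P rE // -(gK (q := 2) _ hx1) // !big_ord_recl big_ord0 /= /bump /= !addr0.
  by ring.
have [Br Br0 hBr] : exists2 B : R, 0 <= B & forall x, left_half x -> nrm (r x) <= B.
  apply: lip_on_bounded rL => x /andP[? ?]; rewrite ler_norml; apply/andP; split; lra.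
have divP q (x : R) : (0 < q)%N -> left_half x -> left_half (x / q%:R).
  move=> q0 /andP[x0 x1]; have qp : 1 <= q%:R :> R by rewrite ler1n.
  apply/andP; split; first by rewrite divr_gt0 //; lra.
  by rewrite ler_pdivrMr; nra.
have Pq q (x : R) : (0 < q)%N -> left_half x -> P x = e q%:R * P (x / q%:R).
  move=> q0 hx; have qp : 0 < q%:R :> R by rewrite ltr0n.
  (* The defect [D] of homogeneity is bounded, since the singular terms cancel, and
     is multiplied by [e 2] under halving; as [|e 2| < 1] it vanishes. *)
  pose D (y : R) : C := P y - e q%:R * P (y / q%:R).
  have D2 (y : R) k : left_half y -> D y = e 2 ^+ k * D (y / 2 ^+ k).
    elim: k y => [|k IH] y hy; first by rewrite !expr0 mul1r divr1.
    have -> : D y = e 2 * D (y / 2).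
      rewrite /D (P2 y) // (P2 (y / q%:R)); last exact: divP.
      by rewrite [y / q%:R / 2]mulrAC; ring.
    rewrite (IH _ (halfP _ hy)) mulrA -exprS; congr (_ * D _); rewrite exprS invfM; ring.
  have d0 : 0 < (2 * q%:R)^-1 :> R by rewrite invr_gt0 mulr_gt0.
  have [B B0 hB] := locally_bounded d0.
  pose M := \sum_(j < q) nrm (e q%:R) * B + Br + nrm (e q%:R) * Br.
  have DM (y : R) : left_half y -> nrm (D y) <= M.
    move=> hy; have hy1 : 0 < y < 1 by move/andP: hy => [? ?]; apply/andP; split; lra.
    have -> : D y = \sum_(j < q | val j != 0%N) e q%:R * g ((y + j%:R) / q%:R) - r y + e q%:R * r (y / q%:R).
      rewrite /D /P -(gK q0 hy1) (bigD1 (Ordinal q0)) //= addr0.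
      by set s := \sum_(_ < q | _) _; ring.
    apply: le_trans (nrmD _ _) _; rewrite /M lerD //; last first.
      by rewrite nrmM ler_wpM2l ?nrm_ge0 // hBr //; apply: divP.
    apply: le_trans (nrmB _ _) _; rewrite lerD ?hBr //.
    apply: le_trans (nrm_sum _ _ _) _; rewrite [leRHS](bigID (fun j : 'I_q => val j != 0%N)) /=.
    rewrite -[leLHS]addr0 lerD //; last first.
      by apply: sumr_ge0 => j _; rewrite mulr_ge0 ?nrm_ge0.
    apply: ler_sum => j j0; rewrite nrmM ler_wpM2l ?nrm_ge0 //; apply: hB.
    have j1 : 1 <= j%:R :> R by rewrite ler1n lt0n.
    have j2 : j%:R + 1 <= q%:R :> R by rewrite natr1 ler_nat.
    move/andP: hy => [y0 y1].
    rewrite invfM; apply/andP; split.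
      by rewrite ler_wpM2r ?invr_ge0 ?(ltW qp) //; lra.
    rewrite -[X in X - _](@divff _ (q%:R : R)) ?gt_eqF // -mulrBl.
    by rewrite ler_wpM2r ?invr_ge0 ?(ltW qp) //; lra.
  have M0 : 0 <= M by apply: le_trans (DM x hx); apply: nrm_ge0.
  apply/eqP; rewrite -subr_eq0 -/(D x) -nrm_eq0 eq_le nrm_ge0 andbT.
  apply/ler_addgt0Pr => d d1; rewrite add0r; have M1 : 0 < M + 1 by lra.
  have [k hk] := @geometric_small rho (d / (M + 1)) ltac:(by rewrite rho0) (divr_gt0 d1 M1).
  rewrite (D2 x k hx) nrmM nrmX -/rho.
  have hxk : left_half (x / 2 ^+ k) by rewrite -natrX; apply: divP; rewrite // expn_gt0.
  apply: le_trans (ler_pM _ _ hk (DM _ hxk)) _; rewrite ?exprn_ge0 ?nrm_ge0 //.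
  by rewrite mulrAC ler_pdivrMr // ler_wpM2l ?lerDl // ltW.
have h12 : left_half (1 / 2 : R) by apply/andP; split; lra.
pose c := P (1 / 2) / e (1 / 2); exists c, r => // x hx.
suff Pc : P x = c * e x by rewrite -Pc /P subrK.
(* Homogeneity gives the claim at rational points; continuity does the rest. *)
have rat p q : (0 < p)%N -> (p <= q)%N -> P (p%:R / q%:R * (1 / 2)) = c * e (p%:R / q%:R * (1 / 2)).
  move=> p0 pq; have q0 : (0 < q)%N by apply: leq_trans pq.
  have pp : 0 < p%:R :> R by rewrite ltr0n. have qp : 0 < q%:R :> R by rewrite ltr0n.
  have hb : left_half (p%:R / q%:R * (1 / 2) : R).
    have : p%:R / q%:R <= 1 :> R by rewrite ler_pdivrMr // mul1r ler_nat.
    have : 0 < p%:R / q%:R :> R by rewrite divr_gt0.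
    by move=> ? ?; apply/andP; split; lra.
  rewrite (Pq p _ p0 hb) (_ : _ / p%:R = 1 / 2 / q%:R); last by field; rewrite !gt_eqF.
  have h2 : e (1 / 2) / e (1 / 2) = 1 by rewrite divff // e_neq0 // divr_gt0.
  have -> : e (p%:R / q%:R * (1 / 2)) = e p%:R * e q%:R^-1 * e (1 / 2).
    by rewrite [LHS]dpowM ?divr_gt0 //; congr (_ * _); rewrite dpowM ?invr_gt0.
  have h : e q%:R * e q%:R^-1 = 1.
    by rewrite -dpowM ?invr_gt0 // divff ?gt_eqF // dpowE // ln1 mulr0 oppr0 cis0 powR1 mulr1.
  rewrite /c (Pq q _ q0 h12); set u := P _; set v := e (1 / 2) in h2 *.
  transitivity (e p%:R * u * (e q%:R * e q%:R^-1) * (v / v)); last by ring.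
  by rewrite h h2 !mulr1.
move/andP: (hx) => [x0 x1].
have x20 : 0 < x / 2 by lra.
have [Le Le0 hLe] := @e_lipschitz R t (x / 2) x20.
have [Lg Lg0 hLg] := gL x20.
case: rL => Lr Lr0 hLr.
pose K := Lg + Lr + nrm c * Le.
have K0 : 0 <= K by rewrite !addr_ge0 ?mulr_ge0 ?nrm_ge0.
apply/eqP; rewrite -subr_eq0 -nrm_eq0 eq_le nrm_ge0 andbT.
apply/ler_addgt0Pr => d d0; rewrite add0r.
pose dd := Num.min (x / 2) (d / (K + 1)).
have K1 : 0 < K + 1 by lra.
have dd0 : 0 < dd by rewrite lt_min x20 divr_gt0.
pose q := (Num.truncn dd^-1).+1.
have qp : 0 < q%:R :> R by [].
have hq : q%:R^-1 <= dd.
  by rewrite -[leRHS]invrK lef_pV2 ?posrE ?invr_gt0 // ltW // truncnS_gt.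
pose p := (Num.truncn (2 * x * q%:R))%N.
have x2q : 0 <= 2 * x * q%:R by rewrite mulr_ge0 ?mulr_ge0 // ltW.
have /andP[p1 p2] := truncn_itv x2q; rewrite -/p in p1 p2.
pose y : R := p%:R / q%:R * (1 / 2).
have yx : y <= x.
  rewrite /y -(ler_pM2r (_ : 0 < 2 * q%:R)) ?mulr_gt0 //.
  by rewrite (_ : _ * _ = p%:R) ?(le_trans p1) //; [lra | field; rewrite gt_eqF].
have xy : x - y <= dd.
  apply: le_trans hq; rewrite -(ler_pM2r (_ : 0 < 2 * q%:R)) ?mulr_gt0 //.
  rewrite (_ : (x - y) * _ = 2 * x * q%:R - p%:R); last by rewrite /y; field; rewrite gt_eqF.
  rewrite (_ : q%:R^-1 * _ = 2); last by field; rewrite gt_eqF.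
  by move: p2; rewrite -natr1; lra.
have dx : dd <= x / 2 by rewrite ge_min lexx.
have y0 : x / 2 <= y by lra.
have p0 : (0 < p)%N.
  rewrite lt0n; apply/negP => /eqP p0; move: y0; rewrite /y p0 !mul0r; lra.
have pq : (p <= q)%N.
  rewrite -(ler_nat R); apply: le_trans p1 _; nra.
have hy : left_half y by apply/andP; split; lra.
have nxy : `|x - y| <= d / (K + 1).
  rewrite ger0_norm ?subr_ge0 //; apply: le_trans xy _; by rewrite ge_min lexx orbT.
have -> : P x - c * e x = ((g x - g y) - (r x - r y)) + c * (e y - e x).
  have := rat p q p0 pq; rewrite -/y /P => h.
  transitivity ((g x - r x) - c * e x - ((g y - r y) - c * e y)); first by rewrite h subrr subr0.
  by ring.
apply: le_trans (_ : K * `|x - y| <= _); last first.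
  apply: le_trans (ler_wpM2l K0 nxy) _.
  by rewrite mulrCA ger_pMr // ler_pdivrMr // mul1r lerDl.
apply: le_trans (nrmD _ _) _; rewrite /K mulrDl lerD //.
  apply: le_trans (nrmB _ _) _; rewrite mulrDl lerD ?hLr //.
  by apply: hLg; apply/andP; split; lra.
by rewrite nrmM -mulrA ler_wpM2l ?nrm_ge0 // distrC hLe //; lra.
Qed.

End Decomposition.

End KubertSingularity.

Section KubertBasis.
Variable R : realType.
Local Notation C := (R[i]).
Local Notation nrm := (@Normc.normc R).
Variable t : R.
Local Notation e := (dpow (- t) (1 / 2)).

(** Compare both sides as [x] tends to [0], where [|e x| = x ^ (- 1 / 2)]. *)
Lemma singular_coefficient_bound (g r : R -> C) (c : C) (A B : R) :
  lip_on (@left_half R) r -> (forall x, left_half x -> g x = c * e x + r x) ->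
  0 <= A -> (forall x, left_half x -> nrm (g x) <= B * x `^ (- (1 / 2)) + A) -> nrm c <= B.
Proof.
move=> rL gE A0 gB.
have [Br Br0 hBr] : exists2 B : R, 0 <= B & forall x, left_half x -> nrm (r x) <= B.
  apply: lip_on_bounded rL => x /andP[? ?]; rewrite ler_norml; apply/andP; split; lra.
apply/ler_addgt0Pr => d d0; have M0 : 0 < A + Br + 1 by lra.
pose z := Num.min (1 / 2) ((d / (A + Br + 1)) ^+ 2).
have z0 : 0 < z by rewrite lt_min exprn_gt0 ?divr_gt0 // andbT; lra.
have zh : left_half z by apply/andP; split => //; rewrite ge_min lexx.
have zd : z `^ (1 / 2) <= d / (A + Br + 1).
  have h : z <= (d / (A + Br + 1)) ^+ 2 by rewrite ge_min lexx orbT.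
  have hp : 0 <= d / (A + Br + 1) by rewrite ltW // divr_gt0.
  rewrite div1r powR12_sqrt ?(ltW z0) // -[leRHS]ger0_norm // -sqrtr_sqr.
  by rewrite ler_sqrt // exprn_ge0.
have cE : nrm c = z `^ (1 / 2) * nrm (g z - r z).
  rewrite gE // addrK nrmM nrm_e // powRN mulrCA divff ?mulr1 //.
  by rewrite gt_eqF // powR_gt0.
rewrite cE; have p0 : 0 < z `^ (1 / 2) by rewrite powR_gt0.
apply: le_trans (_ : z `^ (1 / 2) * (B * z `^ (- (1 / 2)) + A + Br) <= _).
  rewrite ler_wpM2l ?powR_ge0 //; apply: le_trans (nrmB _ _) _.
  by rewrite lerD ?gB ?hBr.
rewrite powRN; set u := z `^ _ in zd p0 *.
rewrite -addrA mulrDr mulrCA divff ?gt_eqF // mulr1 lerD2l.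
have : u * (A + Br + 1) <= d by rewrite -ler_pdivlMr.
nra.
Qed.

(** The space of Kubert functions is spanned by [z1] and its reflection: after
    removal of the singularities at both ends the difference is Lipschitz. *)
Lemma kubert_basis (g z1 : R -> C) (Lz A B : R) :
  kubert t g -> locally_lip g ->
  kubert t z1 -> (forall x, 0 < x -> z1 x = e x + z1 (1 + x)) ->
  (forall x y, 1 <= x -> x <= y <= x + 1 -> nrm (z1 x - z1 y) <= Lz * (y - x)) ->
  0 <= A -> (forall x, left_half x -> nrm (g x) <= B * x `^ (- (1 / 2)) + A) ->
  (forall x, left_half x -> nrm (g (1 - x)) <= B * x `^ (- (1 / 2)) + A) ->
  exists c c' : C, [/\ nrm c <= B, nrm c' <= B &
    forall x, 0 < x < 1 -> g x = c * z1 x + c' * z1 (1 - x)].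
Proof.
move=> gK gL zK zS zL A0 gB gB'.
have [c [r rL rE]] := singular_part gK gL.
have [c' [r' rL' rE']] := singular_part (kubert_reflect gK) (locally_lip_reflect gL).
have cB := singular_coefficient_bound rL rE A0 gB.
have cB' := singular_coefficient_bound rL' rE' A0 gB'.
exists c, c'; split => // x hx.
have Lz0 : 0 <= Lz.
  have := zL 1 2 (lexx _); rewrite (_ : 2 - 1 = 1); last by ring.
  rewrite mulr1 => h; apply: le_trans (nrm_ge0 _) (h _); apply/andP; split; lra.
have z1shift_lip : lip_on (@left_half R) (fun x => z1 (1 + x)).
  exists Lz => // y z; wlog yz : y z / y <= z => [H hy hz|/andP[y0 y1] /andP[z0 z2]].
    by have [/H->//|/ltW/H] := leP y z; rewrite nrmBC distrC => ->.
  rewrite distrC ger0_norm ?subr_ge0 //.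
  have -> : z - y = (1 + z) - (1 + y) by ring.
  by apply: zL; [lra | apply/andP; split; lra].
have z1top_lip : lip_on (@left_half R) (fun x => z1 (1 - x)).
  have [Le Le0 hLe] := @e_lipschitz R t (1 / 2) ltac:(lra).
  exists (Le + Lz) => [|y z]; first exact: addr_ge0.
  wlog yz : y z / y <= z => [H hy hz|/andP[y0 y1] /andP[z0 z2]].
    by have [/H->//|/ltW/H] := leP y z; rewrite nrmBC distrC => ->.
  rewrite (zS (1 - y)) ?(zS (1 - z)); [|lra|lra].
  rewrite (_ : _ - _ = (e (1 - y) - e (1 - z)) + (z1 (1 + (1 - y)) - z1 (1 + (1 - z)))); last by ring.
  apply: le_trans (nrmD _ _) _; rewrite mulrDl lerD //.
    have -> : y - z = - ((1 - y) - (1 - z)) by ring.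
    by rewrite normrN hLe //; lra.
  rewrite nrmBC distrC (ger0_norm (_ : 0 <= z - y)) ?subr_ge0 //.
  have -> : z - y = (1 + (1 - y)) - (1 + (1 - z)) by ring.
  by apply: zL; [lra | apply/andP; split; lra].
pose H x := g x - c * z1 x - c' * z1 (1 - x).
have HK : kubert t H.
  by apply: kubertB; [apply: kubertB => // | ]; apply: kubertZ => //; apply: kubert_reflect.
have HL : lip_on (@left_half R) H.
  apply: (@lip_on_ext _ _ (fun x => r x - c * z1 (1 + x) - c' * z1 (1 - x))).
    by move=> y hy; rewrite /H rE // (zS y); [ring | case/andP: hy].
  by apply: lip_onB; [apply: lip_onB => //|]; apply: lip_onZ.
have HL' : lip_on (@left_half R) (fun x => H (1 - x)).
  apply: (@lip_on_ext _ _ (fun x => r' x - c' * z1 (1 + x) - c * z1 (1 - x))).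
    move=> y hy; rewrite /H rE' // (_ : 1 - (1 - y) = y); last by ring.
    by rewrite (zS y); [ring | case/andP: hy].
  by apply: lip_onB; [apply: lip_onB => //|]; apply: lip_onZ.
have HL01 : lip_on (fun x => 0 < x < 1) H.
  case: HL HL' => L L0 hL [L' L'0 hL'].
  have hl (y : R) : 0 < y -> y <= 1 / 2 -> left_half y by move=> *; apply/andP.
  have h1 y z : 1 / 2 <= y < 1 -> 1 / 2 <= z < 1 -> nrm (H y - H z) <= L' * `|y - z|.
    move=> /andP[y1 y2] /andP[z2 z3].
    have := hL' (1 - y) (1 - z); rewrite (_ : 1 - (1 - y) = y); last by ring.
    rewrite (_ : 1 - (1 - z) = z); last by ring.
    rewrite (_ : 1 - y - (1 - z) = - (y - z)); last by ring.
    by rewrite normrN; apply; apply: hl; lra.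
  exists (L + L') => [|y z]; first exact: addr_ge0.
  wlog yz : y z / y <= z => [HH hy hz|/andP[y0 y1] /andP[z0 z2]].
    by have [/HH->//|/ltW/HH] := leP y z; rewrite nrmBC distrC => ->.
  have n0 : 0 <= `|y - z| by [].
  have [z3|z3] := leP z (1 / 2).
    have y3 : y <= 1 / 2 by lra.
    by have := hL y z (hl _ y0 y3) (hl _ z0 z3); nra.
  have z4 : 1 / 2 <= z < 1 by apply/andP; split; lra.
  have [y3|y3] := leP (1 / 2) y.
    have y4 : 1 / 2 <= y < 1 by apply/andP; split; lra.
    by have := h1 y z y4 z4; nra.
  have m0 : left_half (1 / 2 : R) by apply: hl; lra.
  have m1 : 1 / 2 <= (1 / 2 : R) < 1 by apply/andP; split; lra.
  apply: le_trans (nrm_triangle (H (1 / 2)) _ _) _; rewrite mulrDl lerD //.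
    apply: le_trans (hL y (1 / 2) (hl _ y0 (ltW y3)) m0) _.
    by rewrite ler_wpM2l // !ler0_norm; lra.
  apply: le_trans (h1 (1 / 2) z m1 z4) _.
  by rewrite ler_wpM2l // !ler0_norm; lra.
have := kubert_lipschitz_eq0 HK HL01 hx; rewrite /H => /eqP.
by rewrite -addrA -opprD subr_eq0 => /eqP.
Qed.

End KubertBasis.

(** * Exponential sums *)

Section ExponentialSums.
Variable R : realType.
Local Notation C := (R[i]).
Local Notation nrm := (@Normc.normc R).

Lemma inv_one_minus_cis (x : R) : sin (x / 2) != 0 ->
  (1 - cis x)^-1 = Complex (1 / 2) (cos (x / 2) / (2 * sin (x / 2))).
Proof.
move=> s0; have xE : x = (x / 2) *+ 2 by rewrite -mulr_natr; field.
have h := cos2Dsin2 (x / 2); set s := sin _ in s0 h *; set c := cos _ in h *.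
have E : 1 - cis x = Complex (2 * s ^+ 2) (- (2 * (c * s))).
  apply/eqP; rewrite eq_complex; apply/andP; split; apply/eqP => /=.
    by rewrite {1}xE cos_mulr2n cos2sin2 -mulr_natr -/s; ring.
  by rewrite {1}xE sin_mulr2n -mulr_natr -/s -/c; ring.
have prod1 : (1 - cis x) * Complex (1 / 2) (c / (2 * s)) = 1.
  rewrite E; apply/eqP; rewrite eq_complex; apply/andP; split; apply/eqP => /=.
    by transitivity (c ^+ 2 + s ^+ 2); [field; rewrite s0 | exact: h].
  by field; rewrite s0.
have n0 : 1 - cis x != 0.
  by apply/negP => /eqP h0; move: prod1; rewrite h0 mul0r => /eqP; rewrite eq_sym oner_eq0.
by apply: (mulfI n0); rewrite divff.
Qed.

Lemma cot_antitone (x y : R) : 0 < x -> x <= y -> y < pi ->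
  cos y / sin y <= cos x / sin x.
Proof.
move=> x0 xy yp; have sx : 0 < sin x by apply: sin_gt0_pi; apply/andP; split; lra.
have sy : 0 < sin y by apply: sin_gt0_pi; apply/andP; split; lra.
rewrite -subr_ge0.
have -> : cos x / sin x - cos y / sin y = sin (y - x) / (sin x * sin y).
  by rewrite sinB; field; rewrite !gt_eqF.
by rewrite divr_ge0 ?mulr_ge0 ?(ltW sx) ?(ltW sy) // sin_ge0_pi //; apply/andP; split; lra.
Qed.

(** Kusmin-Landau: [1 / (1 - e ^ (i delta))] has constant real part and monotone
    imaginary part, so summation by parts telescopes. *)
Lemma kusmin_landau (phi : nat -> R) (eta : R) k : 0 < eta ->
  (forall n, (n < k)%N -> eta <= phi n.+1 - phi n <= 2 * pi - eta) ->
  (forall n, (n.+1 < k)%N -> phi n.+1 - phi n <= phi n.+2 - phi n.+1) ->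
  nrm (\sum_(n < k) cis (phi n)) <= 16 / eta.
Proof.
move=> eta0; case: k => [|k] hd hm.
  by rewrite big_ord0 nrm0 divr_ge0 // ltW.
pose del n := phi n.+1 - phi n.
pose c n : C := (1 - cis (del n))^-1.
pose u n := cos (del n / 2) / sin (del n / 2).
have del2 n : (n <= k)%N -> 0 < del n / 2 < pi.
  by move=> nk; have /andP[] := hd n nk; rewrite -/(del n) => ? ?; apply/andP; split; lra.
have s0 n : (n <= k)%N -> 0 < sin (del n / 2) by move=> nk; apply: sin_gt0_pi; exact: del2.
have sb n : (n <= k)%N -> eta / 8 <= sin (del n / 2).
  move=> nk; have := chord_ge (ltW eta0) (hd n nk).
  by rewrite chord_formula ger0_norm ?(ltW (s0 n nk)) // -/(del n); lra.
have cE n : (n <= k)%N -> c n = Complex (1 / 2) (u n / 2).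
  move=> nk; rewrite /c inv_one_minus_cis ?gt_eqF ?s0 //; congr Complex.
  by rewrite /u; field; rewrite gt_eqF // s0.
have cb n : (n <= k)%N -> nrm (c n) <= 4 / eta.
  move=> nk; have h := chord_ge (ltW eta0) (hd n nk).
  have hn : 0 < nrm (1 - cis (del n)) by apply: lt_le_trans h; lra.
  rewrite /c nrmV -[4 / eta]invf_div; rewrite lef_pV2 ?posrE //; by rewrite divr_gt0.
have ub n : (n <= k)%N -> `|u n| <= 8 / eta.
  move=> nk; rewrite /u normrM normfV [`|sin _|]ger0_norm ?(ltW (s0 n nk)) //.
  rewrite ler_pdivrMr ?s0 //; apply: le_trans (cos_max _) _.
  have := sb n nk; rewrite mulrAC ler_pdivlMr // mul1r; lra.
have um n : (n < k)%N -> u n.+1 <= u n.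
  move=> nk; have /andP[d0 _] := del2 n (ltnW nk); have /andP[_ d1] := del2 n.+1 nk.
  by apply: cot_antitone => //; have := hm n nk; rewrite -/(del n) -/(del n.+1); lra.
have zE n : (n <= k)%N -> cis (phi n) = c n * (cis (phi n) - cis (phi n.+1)).
  move=> nk; have -> : cis (phi n.+1) = cis (phi n) * cis (del n).
    by rewrite -cisD /del addrC subrK.
  rewrite /c; field; rewrite -nrm_eq0 chord_formula mulf_neq0 //.
  by rewrite normr_eq0 gt_eqF // s0.
have abel m : (m <= k)%N -> \sum_(n < m.+1) cis (phi n) =
    c 0%N * cis (phi 0%N) - c m * cis (phi m.+1) + \sum_(j < m) (c j.+1 - c j) * cis (phi j.+1).
  elim: m => [|m IH] mk.
    by rewrite big_ord_recr !big_ord0 /= add0r addr0 -mulrBr -zE.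
  by rewrite big_ord_recr /= IH ?(ltnW mk) // [in RHS]big_ord_recr /= [cis (phi m.+1) in X in _ + X = _](zE _ mk); ring.
rewrite abel //; apply: le_trans (nrmD _ _) _.
have h1 : nrm (c 0%N * cis (phi 0%N) - c k * cis (phi k.+1)) <= 4 / eta + 4 / eta.
  by apply: le_trans (nrmB _ _) _; rewrite !nrmM !nrm_cis !mulr1 lerD ?cb.
have h2 : nrm (\sum_(j < k) (c j.+1 - c j) * cis (phi j.+1)) <= 8 / eta.
  apply: le_trans (nrm_sum _ _ _) _.
  apply: le_trans (_ : \sum_(j < k) (u j - u j.+1) / 2 <= _).
    apply: ler_sum => j _; rewrite nrmM nrm_cis mulr1 !cE ?(ltnW (ltn_ord j)) //.
    rewrite (_ : _ - _ = Complex 0 ((u j.+1 - u j) / 2)); last first.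
      by apply/eqP; rewrite eq_complex /=; apply/andP; split; apply/eqP; ring.
    rewrite /Normc.normc expr0n /= add0r sqrtr_sqr ler0_norm; first by lra.
    by have := um j (ltn_ord j); lra.
  have -> m : \sum_(j < m) (u j - u j.+1) / 2 = (u 0%N - u m) / 2.
    by elim: m => [|m IH]; rewrite ?big_ord0 ?big_ord_recr /= ?IH; field.
  have := ub 0%N isT; have := ub k (leqnn k); rewrite !ler_norml => /andP[? ?] /andP[? ?]; lra.
have -> : 16 / eta = 4 / eta + 4 / eta + 8 / eta by field; rewrite gt_eqF.
lra.
Qed.

Lemma threshold (del : nat -> R) k tau :
  (forall n, (n.+1 < k)%N -> del n <= del n.+1) ->
  exists2 m, (m <= k)%N & (forall n, (n < m)%N -> del n < tau) /\
    (forall n, (m <= n < k)%N -> tau <= del n).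
Proof.
elim: k => [|k IH] hm; first by exists 0%N => //; split => // n; case: n.
have [m mk [h1 h2]] := IH (fun n nk => hm n (leqW nk)).
have [kt|kt] := ltP (del k) tau; last first.
  exists m; first exact: leqW.
  split => // n /andP[mn]; rewrite ltnS leq_eqVlt => /predU1P[->//|nk].
  by apply: h2; rewrite mn.
have [mk'|mk'] := ltnP m k; last first.
  have mE : m = k by apply/eqP; rewrite eqn_leq mk.
  exists k.+1 => //; split => [n|n]; last by rewrite leqNgt => /andP[/negP].
  by rewrite ltnS leq_eqVlt => /predU1P[->//|nk]; apply: h1; rewrite mE.
case: k {IH} hm mk h2 kt mk' => // k hm mk h2 kt mk'.
have := h2 k; rewrite -ltnS mk' leqnn => /(_ isT).
by have := hm k (leqnn _); lra.
Qed.

Section SecondDerivative.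
Variables (eta lam : R).
Hypotheses (eta0 : 0 < eta) (eta1 : eta <= 1) (lam0 : 0 < lam).

Let period_bound : R := 2 * eta / lam + 1 + 16 / eta.

Let spaced (phi : nat -> R) k := forall n, (n.+1 < k)%N ->
  phi n.+1 - phi n + lam <= phi n.+2 - phi n.+1.

Let one_period (phi : nat -> R) k : spaced phi k ->
  (forall n, (n < k)%N -> - eta <= phi n.+1 - phi n < 2 * pi - eta) ->
  nrm (\sum_(n < k) cis (phi n)) <= period_bound.
Proof.
move=> hs hd; pose del n := phi n.+1 - phi n.
have hm n : (n.+1 < k)%N -> del n <= del n.+1 by move=> nk; have := hs n nk; rewrite /del; move: lam0; lra.
have [m mk [h1 h2]] := threshold eta hm.
rewrite -(subnKC mk) big_split_ord /=; apply: le_trans (nrmD _ _) _.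
rewrite /period_bound; apply: lerD.
  apply: le_trans (_ : m%:R <= _).
    apply: le_trans (nrm_sum _ _ _) _; under eq_bigr do rewrite nrm_cis.
    by rewrite sumr_const card_ord.
  case: m mk h1 h2 => [|m] mk h1 _; first by rewrite addr_ge0 ?divr_ge0 ?mulr_ge0 // ltW.
  have grow n : (n < k)%N -> del 0%N + n%:R * lam <= del n.
    elim: n => [|n IH] nk; first by rewrite mul0r addr0.
    have := IH (ltnW nk); have := hs n nk; rewrite -/(del n) -/(del n.+1) -natr1 mulrDl; lra.
  rewrite -natr1 lerD2r ler_pdivlMr //.
  have := grow m mk; have := h1 m (leqnn _); have /andP[] := hd 0%N (leq_trans (ltn0Sn _) mk).
  rewrite -/(del 0%N); lra.
apply: (@kusmin_landau (fun n => phi (m + n)%N)) => // n nk.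
  have nk' : (m + n < k)%N by lia.
  have /andP[_ h3] := hd (m + n)%N nk'; have := h2 (m + n)%N; rewrite leq_addr nk' addnS => /(_ isT).
  by rewrite /del => h4; rewrite h4 /= ltW.
rewrite !addnS; apply: hm; lia.
Qed.

Let many_periods K (phi : nat -> R) k : spaced phi k ->
  (forall n, (n < k)%N -> - eta <= phi n.+1 - phi n < 2 * pi * K%:R - eta) ->
  nrm (\sum_(n < k) cis (phi n)) <= K%:R * period_bound.
Proof.
have B0 : 0 <= period_bound by rewrite !addr_ge0 // divr_ge0 ?mulr_ge0 // ltW.
elim: K phi k => [|K IH] phi k hs hd.
  case: k hs hd => [|k] hs hd; first by rewrite big_ord0 nrm0 mul0r.
  by have /andP[] := hd 0%N isT; rewrite mulr0; lra.
pose del n := phi n.+1 - phi n.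
have hm n : (n.+1 < k)%N -> del n <= del n.+1 by move=> nk; have := hs n nk; rewrite /del; move: lam0; lra.
have [m mk [h1 h2]] := threshold (2 * pi - eta) hm.
rewrite -(subnKC mk) big_split_ord /=; apply: le_trans (nrmD _ _) _.
rewrite -natr1 mulrDl mul1r addrC; apply: lerD.
  have -> : \sum_(i < k - m) cis (phi (m + i)%N) = \sum_(i < k - m) cis (phi (m + i)%N - i%:R * (2 * pi)).
    by apply: eq_bigr => i _; rewrite -[RHS](cis_period_nat _ i) subrK.
  apply: (IH (fun i => phi (m + i)%N - i%:R * (2 * pi)) (k - m)%N) => n nk; rewrite !addnS.
    have := hs (m + n)%N ltac:(lia); rewrite -[n.+2%:R]natr1 -[n.+1%:R]natr1; lra.
  have nk' : (m + n < k)%N by lia.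
  have /andP[_ h3] := hd (m + n)%N nk'; have := h2 (m + n)%N; rewrite leq_addr nk' => /(_ isT).
  move: h3; rewrite /del -[K.+1%:R]natr1 -[n.+1%:R]natr1 => h3 h4; apply/andP; split; lra.
apply: one_period => n nk; first by apply: hs; lia.
have /andP[h3 _] := hd n ltac:(lia); rewrite h3 /=; exact: h1.
Qed.

(** The increments are cut where they come within [eta] of a multiple of [2 pi]:
    few indices are affected because the increments are [lam]-separated, and
    [kusmin_landau] applies to the others. *)
Lemma second_derivative_test_aux (phi : nat -> R) k (V : R) : 0 <= V ->
  (forall n, (n.+1 < k)%N -> phi n.+1 - phi n + lam <= phi n.+2 - phi n.+1) ->
  (forall n, (n < k)%N -> phi n.+1 - phi n <= phi 1%N - phi 0%N + V) ->
  nrm (\sum_(n < k) cis (phi n)) <= (V + 2) * (2 * eta / lam + 1 + 16 / eta).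
Proof.
move=> V0 hs hV; rewrite -/period_bound.
have B0 : 0 <= period_bound by rewrite !addr_ge0 // divr_ge0 ?mulr_ge0 // ltW.
have pp := pi_gt0 R; have p2 := pi_ge2 R.
case: k hs hV => [|k] hs hV; first by rewrite big_ord0 nrm0 mulr_ge0 // addr_ge0.
pose m := Num.floor ((phi 1%N - phi 0%N + eta) / (2 * pi)).
have pi2 : 0 < 2 * pi :> R by rewrite mulr_gt0.
have /andP[m1 m2] : m%:~R * (2 * pi) <= phi 1%N - phi 0%N + eta < (m + 1)%:~R * (2 * pi).
  by rewrite -ler_pdivlMr // -ltr_pdivrMr // floor_le_tmp floorD1_gt.
have -> : \sum_(n < k.+1) cis (phi n) = \sum_(n < k.+1) cis (phi n - (n%:R * m%:~R) * (2 * pi)).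
  apply: eq_bigr => n _; rewrite -[RHS](cis_period_int _ (n%:Z * m)).
  by rewrite intrM subrK.
pose K := (Num.truncn V).+2.
apply: le_trans (_ : K%:R * period_bound <= _); last first.
  rewrite ler_wpM2r // /K -[_.+2%:R]natr1 -[_.+1%:R]natr1.
  have /andP[h _] := truncn_itv V0; lra.
have hdel n : (n < k.+1)%N -> phi 1%N - phi 0%N <= phi n.+1 - phi n.
  elim: n => [//|n IH] nk; have := IH (ltnW nk); have := hs n nk; move: lam0; lra.
have mE : (m + 1)%:~R * (2 * pi) = m%:~R * (2 * pi) + 2 * pi :> R by rewrite intrD; ring.
rewrite mE in m2.
apply: (@many_periods K (fun n => phi n - n%:R * m%:~R * (2 * pi)) k.+1) => n nk; rewrite -?[n.+2%:R]natr1 -[n.+1%:R]natr1.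
  by have := hs n nk; lra.
have KV : V + 1 < K%:R by rewrite /K -natr1 ltrD2r truncnS_gt.
have hV' : V + 2 * pi < 2 * pi * K%:R by nra.
have := hV n nk; have := hdel n nk; move=> *; apply/andP; split; lra.
Qed.

End SecondDerivative.

(** Van der Corput's second derivative test, [V] being the variation of the
    increments; the choice of [eta] balances the two error terms. *)
Lemma second_derivative_test (phi : nat -> R) k (V lam : R) : 0 <= V -> 0 < lam -> lam <= 1 ->
  (forall n, (n.+1 < k)%N -> phi n.+1 - phi n + lam <= phi n.+2 - phi n.+1) ->
  (forall n, (n < k)%N -> phi n.+1 - phi n <= phi 1%N - phi 0%N + V) ->
  nrm (\sum_(n < k) cis (phi n)) <= 19 * (V + 2) / Num.sqrt lam.
Proof.
move=> V0 l0 l1 hs hV; set r := Num.sqrt lam.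
have r0 : 0 < r by rewrite sqrtr_gt0.
have rr : lam = r ^+ 2 by rewrite sqr_sqrtr // ltW.
have r1 : r <= 1 by rewrite -[1]sqrtr1 ler_sqrt.
apply: le_trans (second_derivative_test_aux r0 r1 l0 V0 hs hV) _.
rewrite [19 * _]mulrC -[leRHS]mulrA ler_wpM2l ?addr_ge0 //.
have -> : 2 * r / lam = 2 / r by rewrite rr; field; rewrite gt_eqF.
have : 1 <= r^-1 by rewrite invf_ge1.
lra.
Qed.

(** Abel's inequality for nonincreasing weights. *)
Lemma abel_inequality (w : nat -> R) (z : nat -> C) k (M : R) :
  (forall n, 0 <= w n) -> (forall n, w n.+1 <= w n) ->
  (forall j, (j <= k)%N -> nrm (\sum_(n < j) z n) <= M) ->
  nrm (\sum_(n < k) (w n)%:C%C * z n) <= w 0%N * M.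
Proof.
move=> w0 wm hM.
have M0 : 0 <= M by have := hM 0%N isT; rewrite big_ord0 nrm0.
pose S j := \sum_(n < j) z n.
have E : \sum_(n < k) (w n)%:C%C * z n = (w k)%:C%C * S k + \sum_(n < k) (w n - w n.+1)%:C%C * S n.+1.
  elim: k {hM} => [|k IH]; first by rewrite /S !big_ord0 mulr0 addr0.
  by rewrite big_ord_recr /= IH [in RHS]big_ord_recr /= /S [in RHS]big_ord_recr /= rmorphB /=; ring.
rewrite E; apply: le_trans (nrmD _ _) _.
have -> : w 0%N * M = w k * M + \sum_(n < k) (w n - w n.+1) * M.
  rewrite -mulr_suml -mulrDl; congr (_ * _).
  by elim: k {hM E} => [|k IH]; rewrite ?big_ord0 ?big_ord_recr /=; [ring | rewrite {}IH; ring].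
apply: lerD.
  by rewrite nrmM nrm_real ger0_norm // ler_wpM2l // hM.
apply: le_trans (nrm_sum _ _ _) _; apply: ler_sum => n _.
rewrite nrmM nrm_real ger0_norm ?subr_ge0 // ler_wpM2l ?subr_ge0 //; apply: hM.
exact: ltn_ord.
Qed.

End ExponentialSums.

Section ZetaSums.
Variable R : realType.
Local Notation C := (R[i]).
Local Notation nrm := (@Normc.normc R).

Definition pz_term (theta t : R) (n : nat) : C :=
  cis (n%:R * theta) * dpow t (1 / 2) n%:R.

Lemma pz_termE theta t n : (0 < n)%N ->
  pz_term theta t n = (n%:R `^ (- (1 / 2)))%:C%C * cis (n%:R * theta - t * ln n%:R).
Proof. by move=> n0; rewrite /pz_term dpowE ?ltr0n // cisD; ring. Qed.

Lemma inv_sqrt_pow (N : nat) : (0 < N)%N -> (N%:R : R) `^ (- (1 / 2)) = (Num.sqrt N%:R)^-1.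
Proof. by move=> N0; rewrite powRN div1r powR12_sqrt. Qed.

Lemma pz_weighted theta t (N k : nat) (M : R) : (0 < N)%N ->
  (forall j, (j <= k)%N ->
     nrm (\sum_(n < j) cis ((N + n)%:R * theta - t * ln (N + n)%:R)) <= M) ->
  nrm (\sum_(n < k) pz_term theta t (N + n)%N) <= M / Num.sqrt N%:R.
Proof.
move=> N0 hM.
have := @abel_inequality R (fun n => (N + n)%:R `^ (- (1 / 2)))
  (fun n => cis ((N + n)%:R * theta - t * ln (N + n)%:R)) k M (fun n => powR_ge0 _ _) _ hM.
rewrite addn0 inv_sqrt_pow // [_ * M]mulrC => h.
under eq_bigr => n _ do rewrite pz_termE ?addn_gt0 ?N0 //.
apply: h => n; rewrite addnS !powRN lef_pV2 ?posrE ?powR_gt0 ?ltr0n ?addn_gt0 ?N0 //.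
by apply: ge0_ler_powR; rewrite ?nnegrE // ler_nat.
Qed.

Lemma log_increment (x : R) : 0 < x ->
  [/\ 0 <= ln (x + 1) - ln x, ln (x + 1) - ln x <= x^-1 &
      (x + 1) ^- 2 <= (ln (x + 1) - ln x) - (ln (x + 2) - ln (x + 1))].
Proof.
move=> x0; split.
- by rewrite subr_ge0 ler_ln ?posrE; lra.
- have := @ln_ratio_le R x (x + 1) x0 ltac:(lra).
  by rewrite (_ : x + 1 - x = 1) ?mul1r //; ring.
have y0 : 0 < x * (x + 2) by rewrite mulr_gt0 //; lra.
have := @ln_ratio_ge R (x * (x + 2)) ((x + 1) ^+ 2) y0 ltac:(nra).
rewrite lnM ?posrE //; [|lra]; rewrite expr2 lnM ?posrE; [|lra|lra].
rewrite -expr2 (_ : (x + 1) ^+ 2 - x * (x + 2) = 1); last by ring.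
rewrite mul1r; lra.
Qed.

(** The second derivative of the phase on a dyadic block is about [t / N ^ 2], so
    the test gives [N / sqrt t + sqrt t] for the unweighted sum. *)
Lemma pz_block theta t (N k : nat) : 0 < t -> (0 < N)%N -> t <= 4 * N%:R ^+ 2 -> (k <= N)%N ->
  nrm (\sum_(n < k) pz_term theta t (N + n)%N) <=
    76 * (Num.sqrt t / Num.sqrt N%:R + Num.sqrt N%:R / Num.sqrt t).
Proof.
move=> t0 N0 tN kN; have Np : 0 < N%:R :> R by rewrite ltr0n.
set a := Num.sqrt t; set b := Num.sqrt N%:R.
have a0 : 0 < a by rewrite sqrtr_gt0. have b0 : 0 < b by rewrite sqrtr_gt0.
have aa : t = a ^+ 2 by rewrite sqr_sqrtr // ltW.
have bb : N%:R = b ^+ 2 by rewrite sqr_sqrtr // ltW.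
pose lam := t / (4 * N%:R ^+ 2).
have lam0 : 0 < lam by rewrite divr_gt0 // mulr_gt0 ?exprn_gt0.
have lam1 : lam <= 1 by rewrite ler_pdivrMr ?mul1r // mulr_gt0 ?exprn_gt0.
have sl : Num.sqrt lam = a / (2 * N%:R).
  rewrite /lam aa (_ : a ^+ 2 / _ = (a / (2 * N%:R)) ^+ 2); last by field; rewrite gt_eqF.
  by rewrite sqrtr_sqr ger0_norm // divr_ge0 ?mulr_ge0 // ltW.
apply: le_trans (_ : 19 * (t / N%:R + 2) / Num.sqrt lam / b <= _); last first.
  rewrite sl bb aa; have -> : 19 * (a ^+ 2 / b ^+ 2 + 2) / (a / (2 * b ^+ 2)) / b =
     38 * (a / b + 2 * (b / a)) by field; rewrite !gt_eqF.
  have : 0 <= a / b by rewrite divr_ge0 // ltW.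
  lra.
apply: pz_weighted => // j jk.
pose x n : R := (N + n)%:R.
have x0 n : 0 < x n by rewrite ltr0n addn_gt0 N0.
have xS n : (N + n.+1)%:R = x n + 1 by rewrite addnS -natr1.
have xSS n : (N + n.+2)%:R = x n + 2 by rewrite addnS -natr1 xS; ring.
apply: (@second_derivative_test R (fun n => (N + n)%:R * theta - t * ln (N + n)%:R)) => //; first by rewrite divr_ge0 // ltW.
  move=> n nj; rewrite -/(x n) xS xSS.
  have [_ _ h] := log_increment (x0 n).
  have h2 : lam <= t * (x n + 1) ^- 2.
    rewrite /lam ler_wpM2l ?(ltW t0) // lef_pV2 ?posrE ?exprn_gt0 ?mulr_gt0 ?exprn_gt0 //; last first.
      by have := x0 n; lra.
    rewrite -[4]/(4%:R) (_ : 4%:R * N%:R ^+ 2 = (2 * N%:R) ^+ 2); last by ring.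
    rewrite lerXn2r ?nnegrE ?mulr_ge0 ?addr_ge0 // ?(ltW (x0 n)) //.
    rewrite -xS -natrM ler_nat; lia.
  have : lam <= t * (ln (x n + 1) - ln (x n) - (ln (x n + 2) - ln (x n + 1))).
    by apply: le_trans h2 _; rewrite ler_wpM2l // ltW.
  lra.
move=> n nj; rewrite -/(x n) -/(x 0%N) xS -[(N + 1)%N]/(N + 0.+1)%N xS.
have [h1 _ _] := log_increment (x0 n); have [_ h2 _] := log_increment (x0 0%N).
rewrite {3 6}/x addn0 in h2 *.
have : t * (ln (x 0%N + 1) - ln (x 0%N)) <= t / N%:R by rewrite ler_wpM2l ?(ltW t0).
have : 0 <= t * (ln (x n + 1) - ln (x n)) by rewrite mulr_ge0 // ltW.
lra.
Qed.

(** Once [N] exceeds [4 t / d], the derivative of the phase stays at distance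
    [3 d / 4] from the multiples of [2 pi] and no further splitting is needed. *)
Lemma pz_end theta t d (N k : nat) : 0 < t -> 0 < d -> d <= theta <= 2 * pi - d ->
  (0 < N)%N -> 4 * t <= N%:R * d ->
  nrm (\sum_(n < k) pz_term theta t (N + n)%N) <= 32 / d / Num.sqrt N%:R.
Proof.
move=> t0 d0 /andP[th1 th2] N0 tN; have Np : 0 < N%:R :> R by rewrite ltr0n.
pose x n : R := (N + n)%:R.
have x0 n : 0 < x n by rewrite ltr0n addn_gt0 N0.
have xS n : (N + n.+1)%:R = x n + 1 by rewrite addnS -natr1.
have xSS n : (N + n.+2)%:R = x n + 2 by rewrite addnS -natr1 xS; ring.
apply: pz_weighted => // j jk.
rewrite (_ : 32 / d = 16 / (d / 2)); last by field; rewrite gt_eqF.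
apply: (@kusmin_landau R (fun n => (N + n)%:R * theta - t * ln (N + n)%:R)); first by lra.
  move=> n nj; rewrite -/(x n) xS.
  have [h1 h2 _] := log_increment (x0 n).
  have h3 : t * (ln (x n + 1) - ln (x n)) <= d / 4.
    apply: le_trans (ler_wpM2l (ltW t0) h2) _; rewrite ler_pdivrMr //.
    have : N%:R <= x n by rewrite ler_nat leq_addr.
    nra.
  have : 0 <= t * (ln (x n + 1) - ln (x n)) by rewrite mulr_ge0 // ltW.
  by move=> h4; apply/andP; split; lra.
move=> n nj; rewrite -/(x n) xS xSS.
have [_ _ h] := log_increment (x0 n).
have : 0 <= t * (ln (x n + 1) - ln (x n) - (ln (x n + 2) - ln (x n + 1))).
  by rewrite mulr_ge0 ?(ltW t0) //; apply: le_trans h; rewrite invr_ge0 exprn_ge0 // addr_ge0 // ltW.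
lra.
Qed.

(** The dyadic blocks contribute a decreasing geometric series in [sqrt (t / N)]
    and an increasing one in [sqrt (N / t)]; the negative last term is the potential
    that lets one induction on the number of terms sum both. With the constant 76
    of [pz_block], the coefficients are [4 * 76] and [3 * 76]. *)
Lemma pz_tail_potential theta t d : 1 <= t -> 0 < d -> d <= theta <= 2 * pi - d ->
  forall k N : nat, (0 < N)%N -> t <= N%:R ^+ 2 -> N%:R * d <= 8 * t ->
  nrm (\sum_(n < k) pz_term theta t (N + n)%N) <=
    304 * (Num.sqrt t / Num.sqrt N%:R) + 716 / Num.sqrt d - 228 * (Num.sqrt N%:R / Num.sqrt t).
Proof.
move=> t1 d0 th k; have t0 : 0 < t by lra.
have [m] := ubnP k; elim: m k => // m IH k; rewrite ltnS => km N N0 tN Nd.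
have Np : 0 < N%:R :> R by rewrite ltr0n.
set a := Num.sqrt t in IH *; set b := Num.sqrt N%:R; set c := Num.sqrt d in IH *.
have a1 : 1 <= a by rewrite -sqrtr1 ler_sqrt // ltW.
have a0 : 0 < a by lra. have b0 : 0 < b by rewrite sqrtr_gt0.
have c0 : 0 < c by rewrite sqrtr_gt0.
have aa : t = a ^+ 2 by rewrite sqr_sqrtr // ltW.
have bb : N%:R = b ^+ 2 by rewrite sqr_sqrtr // ltW.
have cc : d = c ^+ 2 by rewrite sqr_sqrtr // ltW.
have u0 : 0 < a / b by rewrite divr_gt0.
have v0 : 0 < b / a by rewrite divr_gt0.
have ci0 : 0 < c^-1 by rewrite invr_gt0.
have root_le (r : R) : 0 < r -> N%:R * d <= r ^+ 2 * t -> b / a <= r * c^-1.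
  move=> r0 h; rewrite ler_pdivrMr // mulrAC ler_pdivlMr //.
  rewrite -(@ler_pXn2r _ 2) ?nnegrE ?mulr_ge0 ?(ltW a0) ?(ltW b0) ?(ltW c0) ?(ltW r0) //.
  by rewrite !exprMn -aa -bb -cc.
have [h|h] := leP (4 * t) (N%:R * d).
  apply: le_trans (pz_end k t0 d0 th N0 h) _; rewrite -/b.
  have h1 : 32 / d / b <= 16 * c^-1.
    have h2 : 2 * a <= b * c.
      rewrite -(@ler_pXn2r _ 2) ?nnegrE ?mulr_ge0 ?(ltW a0) ?(ltW b0) ?(ltW c0) //.
      by rewrite !exprMn -aa -bb -cc (_ : 2 ^+ 2 = 4) //; ring.
    rewrite cc !ler_pdivrMr ?exprn_gt0 //.
    rewrite (_ : 16 * c^-1 * b * c ^+ 2 = 16 * (b * c)); last by field; rewrite gt_eqF.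
    lra.
  have h3 : b / a <= (283 / 100) * c^-1 by apply: root_le; [lra | nra].
  lra.
have vle : b / a <= 2 * c^-1.
  by apply: root_le; rewrite // (_ : 2 ^+ 2 = 4) ?(ltW h) //; ring.
have tN4 : t <= 4 * N%:R ^+ 2 by have := sqr_ge0 (N%:R : R); lra.
have [kN|kN] := leqP k N.
  by apply: le_trans (pz_block theta t0 N0 tN4 kN) _; rewrite -/a -/b; lra.
rewrite -(subnKC (ltnW kN)) big_split_ord /=; apply: le_trans (nrmD _ _) _.
have B1 := pz_block theta t0 N0 tN4 (leqnn N).
pose s : R := Num.sqrt 2.
have s0 : 0 < s by rewrite sqrtr_gt0.
have ss : s ^+ 2 = 2 by rewrite sqr_sqrtr.
have s1 : 141 / 100 <= s.
  by have [//|h1] := leP (141 / 100) s; nra.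
have si : s^-1 <= 71 / 100.
  by rewrite -[leLHS]mul1r ler_pdivrMr //; lra.
have B2 : nrm (\sum_(n < k - N) pz_term theta t (N + (N + n))%N) <=
   304 * (a / b * s^-1) + 716 / c - 228 * (s * (b / a)).
  have N2 : (N + N)%:R = s ^+ 2 * N%:R :> R by rewrite ss natrD; ring.
  have sN : Num.sqrt (N + N)%:R = s * b.
    by rewrite N2 sqrtrM ?exprn_ge0 ?(ltW s0) // sqrtr_sqr ger0_norm // ltW.
  have k1 : (k - N < m)%N.
    by apply: leq_trans km; rewrite ltn_subrL N0 (leq_trans _ kN).
  have N3 : (0 < N + N)%N by rewrite addn_gt0 N0.
  have := IH (k - N)%N k1 (N + N)%N N3.
  rewrite sN (_ : a / (s * b) = a / b * s^-1); last by field; rewrite !gt_eqF.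
  under eq_bigr do rewrite -addnA; rewrite -[s * b / a]mulrA; apply.
    by rewrite N2 ss; have := sqr_ge0 (N%:R : R); nra.
  by rewrite N2 ss; lra.
move: B1 B2; rewrite -/a -/b; set X := nrm _; set Y := nrm _.
move: u0 v0; set u := a / b; set v := b / a => u0 v0 B1 B2.
have h1 : u * s^-1 <= u * (71 / 100) by rewrite ler_wpM2l // ltW.
have h2 : (141 / 100) * v <= s * v by rewrite ler_wpM2r // ltW.
lra.
Qed.

End ZetaSums.

Section PeriodicZetaBounds.
Variable R : realType.
Local Notation C := (R[i]).
Local Notation nrm := (@Normc.normc R).
Variable F : R -> C -> C.
Hypothesis hF : is_periodic_zeta F.

Lemma nrm_conj (z : C) : nrm (conjc z) = nrm z.
Proof. by case: z => a b; rewrite /Normc.normc /= sqrrN. Qed.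

Lemma conj_pz_term (theta t : R) n : (0 < n)%N ->
  conjc (pz_term theta t n) = pz_term (2 * pi - theta) (- t) n.
Proof.
move=> n0; rewrite !pz_termE //.
have -> : n%:R * (2 * pi - theta) - - t * ln n%:R =
  - (n%:R * theta - t * ln n%:R) + n%:R * (2 * pi) :> R by ring.
rewrite cis_period_nat rmorphM; congr (_ * _).
  by rewrite /= oppr0.
by rewrite /cis cosN sinN.
Qed.

Lemma nrm_pz_conj (theta t : R) (N k : nat) : (0 < N)%N ->
  nrm (\sum_(n < k) pz_term theta t (N + n)) =
  nrm (\sum_(n < k) pz_term (2 * pi - theta) (- t) (N + n)).
Proof.
move=> N0; rewrite -nrm_conj (rmorph_sum (@conjc R)); congr nrm; apply: eq_bigr => n _.
by apply: conj_pz_term; rewrite addn_gt0 N0.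
Qed.

(** A name for the constants of van der Corput's bound, whose value does not matter
    but whose independence of [theta], [t], [d] and [N] does. *)
Definition tail_constant (K : R) : Prop := 0 <= K /\
  forall (theta t d : R) (N k : nat), 1 <= `|t| -> 0 < d ->
  d <= theta <= 2 * pi - d -> (0 < N)%N -> `|t| <= N%:R ^+ 2 ->
  nrm (\sum_(n < k) pz_term theta t (N + n)) <=
    K * (Num.sqrt `|t| / Num.sqrt N%:R + (Num.sqrt d)^-1).

Lemma tail_constant_exists : exists K, tail_constant K.
Proof.
exists 716; split; first exact: ler0n.
move=> theta t d N k t1 d0 th N0 tN.
wlog t0 : theta t t1 th tN / 0 <= t => [H|].
  have [/H|t0] := leP 0 t; first exact.
  rewrite nrm_pz_conj // -normrN; apply: H; rewrite ?normrN //; last by lra.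
  by move/andP: th => [? ?]; apply/andP; split; lra.
rewrite (ger0_norm t0) in t1 tN *; have t0' : 0 < t by lra.
have Np : 0 < N%:R :> R by rewrite ltr0n.
have sN : 0 < Num.sqrt N%:R :> R by rewrite sqrtr_gt0.
have sd : 0 < Num.sqrt d by rewrite sqrtr_gt0.
have u0 : 0 <= Num.sqrt t / Num.sqrt N%:R by rewrite divr_ge0 ?sqrtr_ge0.
have v0 : 0 <= (Num.sqrt d)^-1 by rewrite invr_ge0 ltW.
have w0 : 0 <= Num.sqrt N%:R / Num.sqrt t by rewrite divr_ge0 ?sqrtr_ge0.
have [h|h] := leP (N%:R * d) (8 * t).
  have := pz_tail_potential t1 d0 th k N0 tN h.
  move: u0 v0 w0; set u := Num.sqrt t / _; set v := (Num.sqrt d)^-1; set w := _ / Num.sqrt t.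
  by set X := nrm _ => u0 v0 w0 hX; lra.
have h4 : 4 * t <= N%:R * d by lra.
have := pz_end k t0' d0 th N0 h4.
have h1 : 1 <= Num.sqrt N%:R * Num.sqrt d.
  rewrite -sqrtrM ?(ltW Np) // -[leLHS]sqrtr1 ler_sqrt; first by lra.
  by rewrite mulr_ge0 // ltW.
have h2 : d^-1 / Num.sqrt N%:R <= (Num.sqrt d)^-1.
  rewrite -{1}(sqr_sqrtr (ltW d0)) -invfM lef_pV2 ?posrE //; last first.
    by rewrite mulr_gt0 // exprn_gt0.
  by rewrite expr2 -mulrA [_ * Num.sqrt N%:R]mulrC ler_peMr // ltW.
rewrite -[32 / d / _]mulrA; move: u0 v0 h2; set u := Num.sqrt t / _; set v := (Num.sqrt d)^-1.
by set w := d^-1 / _; set X := nrm _ => u0 v0 h2 hX; lra.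
Qed.

Variable K : R.
Hypothesis hK : tail_constant K.

Lemma pz_sumD (theta t : R) (N k : nat) : pz_sum theta t (1 / 2) (N + k) =
  pz_sum theta t (1 / 2) N + \sum_(n < k) pz_term theta t (N.+1 + n).
Proof. by rewrite /pz_sum big_split_ord /=. Qed.

Lemma F_approx_of_tail (theta t : R) (N : nat) (M : R) : 0 < theta < 2 * pi ->
  (forall k, nrm (\sum_(n < k) pz_term theta t (N.+1 + n)) <= M) ->
  nrm (F theta (Complex (1 / 2) t) - pz_sum theta t (1 / 2) N) <= M.
Proof.
move=> hth hM; have h12 : 0 < 1 / 2 :> R by lra.
apply: (ccvg_nrm_le (N := N) (ccvgB (F_series hF t hth h12) (ccvg_cst _))) => n Nn.
by rewrite -(subnKC Nn) pz_sumD addrAC subrr add0r.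
Qed.

(** This has the strength of the approximate functional equation with the trivial
    bound for its dual sum, whose length is about [|t| / N]. *)
Lemma F_approx (theta t d : R) (N : nat) : 1 <= `|t| -> 0 < d ->
  d <= theta <= 2 * pi - d -> `|t| <= N.+1%:R ^+ 2 ->
  nrm (F theta (Complex (1 / 2) t) - pz_sum theta t (1 / 2) N) <=
    K * (Num.sqrt `|t| / Num.sqrt N.+1%:R + (Num.sqrt d)^-1).
Proof.
move=> t1 d0 th tN; apply: F_approx_of_tail => [|k]; last exact: hK.2.
by move/andP: th => [? ?]; apply/andP; split; lra.
Qed.

Lemma nrm_pz_term (theta t : R) n : (0 < n)%N -> nrm (pz_term theta t n) <= 1.
Proof.
move=> n0; rewrite /pz_term nrmM nrm_cis mul1r nrm_dpow ?ltr0n // powRN.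
rewrite invf_le1 ?powR_gt0 ?ltr0n //.
by rewrite -[leLHS](powRr0 (n%:R : R)) ler_powR ?ler1n.
Qed.

(** With [d] of the size of the distance from [2 pi x] to the multiples of [2 pi],
    the term [d ^ (- 1 / 2)] of the tail bound is the singularity and the remaining
    ones depend on [t] only. *)
Lemma F_singular_bound (t : R) : 1 <= `|t| -> exists2 A : R, 0 <= A &
  forall x, left_half x ->
   nrm (F (2 * pi * x) (Complex (1 / 2) t)) <= K * x `^ (- (1 / 2)) + A /\
   nrm (F (2 * pi * (1 - x)) (Complex (1 / 2) t)) <= K * x `^ (- (1 / 2)) + A.
Proof.
move=> t1; pose N := Num.truncn `|t|.
have [K0 _] := hK; pose A : R := N%:R + K * (Num.sqrt `|t| / Num.sqrt N.+1%:R).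
exists A => [|x /andP[x0 x1]]; first by rewrite addr_ge0 ?mulr_ge0 ?divr_ge0 ?sqrtr_ge0.
have tN : `|t| <= N.+1%:R ^+ 2.
  have h : `|t| < N.+1%:R by apply: truncnS_gt.
  by apply: le_trans (ltW h) _; rewrite expr2 ler_peMr // ler1n.
have pp := pi_gt0 R; have p2 := pi_ge2 R.
have d0 : 0 < 2 * pi * x by rewrite !mulr_gt0.
have H th : 2 * pi * x <= th <= 2 * pi - 2 * pi * x ->
    nrm (F th (Complex (1 / 2) t)) <= K * x `^ (- (1 / 2)) + A.
  move=> hth; have h := F_approx t1 d0 hth tN.
  have h2 : nrm (pz_sum th t (1 / 2) N) <= N%:R.
    apply: le_trans (nrm_sum _ _ _) _.
    apply: le_trans (_ : \sum_(i < N) 1 <= _); last by rewrite sumr_const card_ord.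
    by apply: ler_sum => n _; apply: nrm_pz_term.
  have h3 : K * (Num.sqrt (2 * pi * x))^-1 <= K * x `^ (- (1 / 2)).
    apply: (ler_wpM2l K0); rewrite powRN div1r powR12_sqrt ?(ltW x0) // lef_pV2 ?posrE ?sqrtr_gt0 //.
    rewrite ler_sqrt; last exact: ltW.
    by rewrite ler_peMl ?(ltW x0) //; lra.
  have := nrmD (F th (Complex (1 / 2) t) - pz_sum th t (1 / 2) N) (pz_sum th t (1 / 2) N).
  rewrite subrK /A; move: h h2 h3; rewrite mulrDr; lra.
by split; apply: H; apply/andP; split; nra.
Qed.

(** Hurwitz's formula up to the size of its two coefficients. *)
Lemma F_le_zeta (zeta : C -> R -> C) (t x : R) : is_hurwitz_zeta zeta ->
  1 <= `|t| -> 0 < x < 1 ->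
  nrm (F (2 * pi * x) (Complex (1 / 2) t)) <=
    K * (nrm (zeta (Complex (1 / 2) (- t)) x) + nrm (zeta (Complex (1 / 2) (- t)) (1 - x))).
Proof.
move=> hz t1 hx; have pp := pi_gt0 R.
have nt0 : - t != 0 by rewrite oppr_eq0 -normr_gt0; lra.
have h12 : 0 < 1 / 2 :> R by lra.
pose g (x : R) : C := F (2 * pi * x) (Complex (1 / 2) t).
pose z1 (x : R) : C := zeta (Complex (1 / 2) (- t)) x.
have gK : kubert t g.
  move=> q a q0 ha; rewrite -mulr_sumr kubert_F //.
  have qp : 0 < q%:R :> R by rewrite ltr0n.
  rewrite -[RHS]mul1r [LHS]mulrA; congr (_ * _).
  rewrite !dpowE // mulNr opprK cisN.
  have -> : q%:R = (q%:R `^ (1 / 2))%:C%C * (q%:R `^ (1 / 2))%:C%C :> C.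
    rewrite -rmorphM /= div1r powR12_sqrt ?(ltW qp) // -expr2 sqr_sqrtr ?(ltW qp) //.
    by rewrite -[LHS](rmorph_nat (real_complex R)).
  rewrite powRN fmorphV /=; set u := (_ `^ _)%:C%C; set v := cis _.
  have u0 : u != 0 by rewrite -nrm_eq0 nrm_real normr_eq0 gt_eqF // powR_gt0.
  have v0 : v != 0 by apply: cis_neq0.
  by field; rewrite u0 v0.
have gL : locally_lip g.
  move=> d d0; have d1 : 0 < 2 * pi * d by rewrite !mulr_gt0.
  have [L L0 hL] := F_lipschitz hF t d1.
  exists (L * (2 * pi)) => [|y z /andP[y1 y2] /andP[z1' z2]].
    by rewrite mulr_ge0 // ltW // mulr_gt0.
  apply: le_trans (hL _ _ _ _) _; [apply/andP; split; nra | apply/andP; split; nra |].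
  by rewrite -mulrBr normrM (ger0_norm (_ : 0 <= 2 * pi)) ?mulrA // ltW // mulr_gt0.
have zK : kubert t z1.
  by move=> q a q0 /andP[a0 _]; apply: kubert_zeta.
have zS y : 0 < y -> z1 y = dpow (- t) (1 / 2) y + z1 (1 + y).
  by move=> y0; apply: zeta_shift.
have zL (y z : R) : 1 <= y -> y <= z <= y + 1 ->
    nrm (z1 y - z1 z) <= (1 / 2 + `|- t|) * (1 + (1 / 2)^-1) * (z - y).
  by move=> y1 yz; apply: zeta_lipschitz.
have [A A0 hA] := F_singular_bound t1.
have [c [c' [cB cB' gE]]] := kubert_basis gK gL zK zS zL A0
  (fun x hx => (hA x hx).1) (fun x hx => (hA x hx).2).
rewrite -/(g x) gE //; apply: le_trans (nrmD _ _) _; rewrite !nrmM mulrDr.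
by rewrite lerD // ler_wpM2r ?nrm_ge0.
Qed.

End PeriodicZetaBounds.

(** * Consequences of a pointwise bound for the Hurwitz zeta function *)

Section HurwitzExponent.
Variable R : realType.
Local Notation C := (R[i]).
Local Notation nrm := (@Normc.normc R).

Lemma lindelof_le (L : C -> C) (sigma beta : R) : 0 <= beta ->
  (forall eps, 0 < eps -> exists B T : R, forall t, T <= `|t| ->
     nrm (L (Complex sigma t)) <= B * `|t| `^ (beta + eps)) ->
  (lindelof L sigma <= beta%:E)%E.
Proof.
move=> b0 h; apply/lee_addgt0Pr => eps e0; rewrite -EFinD.
apply: ereal_inf_lbound; exists (beta + eps) => //; split; last exact: h.
by rewrite addr_ge0 // ltW.
Qed.

Section WithF.
Variables (F : R -> C -> C) (zeta : C -> R -> C).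
Hypotheses (hF : is_periodic_zeta F) (hz : is_hurwitz_zeta zeta).

(** For [1 / 2 <= theta <= 2] the arguments [theta / (2 pi)] and [1 - theta / (2 pi)]
    of the Hurwitz zeta function stay in a compact subset of [(0, 1)]. *)
Lemma F_le_exponent (mu eps : R) : hurwitz_exponent zeta mu -> 0 < eps ->
  exists B T : R, forall theta t, 1 / 2 <= theta <= 2 -> T <= `|t| ->
    nrm (F theta (Complex (1 / 2) t)) <= B * `|t| `^ (mu + eps).
Proof.
move=> hmu e0; have [K hK] := tail_constant_exists R; have [K0 _] := hK.
have [||B [T hB]] := hmu `[1 / 16, 15 / 16]%classic _ _ eps e0.
- exact: segment_compact.
- by move=> x /=; rewrite !in_itv /= => /andP[? ?]; apply/andP; split; lra.
exists (K * (B + B)), (Num.max T 1) => theta t /andP[th1 th2]; rewrite ge_max => /andP[tT t1].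
have pp := pi_gt0 R; have p2 := pi_ge2 R; have p4 := pihalf_lt2 R.
have x0 : 0 < 2 * pi :> R by rewrite mulr_gt0.
pose x := theta / (2 * pi).
have x1 : 1 / 16 <= x by rewrite ler_pdivlMr //; lra.
have x2 : x <= 1 / 2 by rewrite ler_pdivrMr //; lra.
have -> : theta = 2 * pi * x by rewrite /x mulrCA divff ?mulr1 // gt_eqF.
apply: le_trans (F_le_zeta hF hK hz t1 _) _; first by apply/andP; split; lra.
rewrite -mulrA ler_wpM2l // mulrDl.
by apply: lerD; rewrite -[X in X `^ _]normrN; apply: hB; rewrite ?normrN //= in_itv /=; apply/andP; split; lra.
Qed.

Lemma sum_inv_sqrt (N : nat) : \sum_(n < N) (n.+1%:R : R) `^ (- (1 / 2)) <= 2 * Num.sqrt N%:R.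
Proof.
elim: N => [|N IH]; first by rewrite big_ord0 mulr_ge0 ?sqrtr_ge0.
rewrite big_ord_recr /= inv_sqrt_pow //; apply: le_trans (lerD IH (lexx _)) _.
set a := Num.sqrt N%:R; set b := Num.sqrt N.+1%:R.
have a0 : 0 <= a by apply: sqrtr_ge0.
have b0 : 0 < b by rewrite sqrtr_gt0.
have ab : b ^+ 2 = a ^+ 2 + 1 by rewrite !sqr_sqrtr // natr1.
have : b^-1 * b = 1 by rewrite mulVf // gt_eqF.
set c := b^-1 => cb; have c0 : 0 < c by rewrite invr_gt0.
suff : c * b <= (2 * b - 2 * a) * b by rewrite ler_pM2r //; lra.
by rewrite cb; nra.
Qed.

Lemma geometric_cis_sum_bound (x : R) J : 0 < x -> x <= 1 ->
  nrm (\sum_(j < J) cis (- (j%:R * x))) <= 8 / x.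
Proof.
move=> x0 x1.
have h : x / 4 <= nrm (1 - cis (- x)).
  by have := @chord_ge_small R (- x); rewrite normrN ger0_norm ?(ltW x0) //; apply; lra.
have n0 : 0 < nrm (1 - cis (- x)) by lra.
have E : (1 - cis (- x)) * \sum_(j < J) cis (- (j%:R * x)) = 1 - cis (- (J%:R * x)).
  elim: J => [|J IH]; first by rewrite big_ord0 mulr0 mul0r oppr0 cis0 subrr.
  rewrite big_ord_recr /= mulrDr IH.
  have -> : - (J.+1%:R * x) = - (J%:R * x) + - x by rewrite -natr1; ring.
  by rewrite cisD; ring.
have : nrm (1 - cis (- x)) * nrm (\sum_(j < J) cis (- (j%:R * x))) <= 2.
  by rewrite -nrmM E; apply: le_trans (nrmB _ _) _; rewrite nrm1 nrm_cis.
rewrite ler_pdivlMr //; have := nrm_ge0 (\sum_(j < J) cis (- (j%:R * x))).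
set S := nrm (\sum_(_ < _) _); set u := nrm _ in h n0 *; nra.
Qed.

(** The mean of [F 1] over an interval is close to its first coefficient, so [F 1]
    cannot tend to [0]; the sampling step is small enough to avoid resonances
    with the frequencies [ln n] that occur. *)
Lemma F1_not_decaying (B T0 delta : R) : 0 < delta ->
  ~ (forall t, T0 <= `|t| -> nrm (F 1 (Complex (1 / 2) t)) <= B * `|t| `^ (- delta)).
Proof.
move=> d0 H.
have B1 : 0 < `|B| + 1 by rewrite ltr_wpDl.
have e1 : 0 < 1 / 4 / (`|B| + 1) by rewrite divr_gt0 //; lra.
have [N1 HN1] := powR_tends0 d0 e1.
have [N2 HN2] := @powR_tends0 R (1 / 2) (1 / 1000) ltac:(lra) ltac:(lra).
(* The mean is taken over [J] points of step [h = 1 / ln N] in [[T, 2 T]]; the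
   length [N = 8 T] puts the tail of the series in the range of [pz_end]. *)
pose m := maxn (maxn N1 N2) (Num.truncn `|T0|).+1.
pose T : R := m.+1%:R; pose N := (8 * m.+1)%N.
have Tb : `|B| * T `^ (- delta) <= 1 / 4.
  have := HN1 m _; rewrite !leq_max leqnn => /(_ isT).
  rewrite ler_pdivlMr // -/T; have := powR_ge0 T (- delta); set u := T `^ _; nra.
have Ts : (Num.sqrt T)^-1 <= 1 / 1000.
  by have := HN2 m _; rewrite !leq_max leqnn orbT => /(_ isT); rewrite inv_sqrt_pow.
have TT0 : T0 <= T.
  apply: le_trans (ler_norm _) _; apply: ltW; apply: lt_le_trans (truncnS_gt _) _.
  by rewrite ler_nat ltnW // ltnS leq_maxr.
have T1 : 1 <= T by rewrite ler1n.
have T0' : 0 < T by lra.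
have NT : N%:R = 8 * T by rewrite /N natrM.
have N1' : 8 <= N%:R :> R by rewrite NT; lra.
have N0 : 0 < N%:R :> R by lra.
pose l := ln (N%:R : R).
have l1 : 1 / 2 <= l.
  by have := @ln_ratio_ge R 1 N%:R ltr01 ltac:(lra); rewrite ln1 subr0 ler_pdivrMr // -/l => h; nra.
have l0 : 0 < l by lra.
pose h := l^-1; have h0 : 0 < h by rewrite invr_gt0.
have hl : h * l = 1 by rewrite mulVf // gt_eqF.
pose J := Num.truncn (T * l + 1).
have TlJ : 0 <= T * l + 1 by rewrite addr_ge0 // mulr_ge0 // ltW.
have /andP[J1 J2] := truncn_itv TlJ; rewrite -/J -natr1 in J1 J2.
have J0 : 0 < J%:R :> R by have := mulr_gt0 T0' l0; lra.
pose tj (j : nat) : R := T + j%:R * h.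
have tjT j : T <= tj j by rewrite lerDl mulr_ge0 // ltW.
have tj0 j : 0 < tj j by apply: lt_le_trans (tjT j).
have tj2 (j : 'I_J) : tj j <= 2 * T.
  have hj : (j.+1%:R : R) <= J%:R by rewrite ler_nat.
  have : j%:R * h <= T; last by rewrite /tj; lra.
  rewrite -natr1 in hj; have : j%:R * h <= (T * l) * h by rewrite ler_pM2r //; lra.
  by rewrite -mulrA [l * h]mulrC hl mulr1.
have Fj (j : 'I_J) : nrm (F 1 (Complex (1 / 2) (tj j))) <= 1 / 4.
  apply: le_trans (H _ _) _; rewrite ger0_norm ?(ltW (tj0 _)) //; first exact: le_trans TT0 (tjT j).
  apply: le_trans Tb; apply: le_trans (_ : `|B| * tj j `^ (- delta) <= _).
    by rewrite ler_wpM2r ?powR_ge0 ?ler_norm.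
  rewrite ler_wpM2l // !powRN lef_pV2 ?posrE ?powR_gt0 //.
  by apply: ge0_ler_powR; rewrite ?nnegrE ?(ltW d0) ?(ltW T0') ?(ltW (tj0 j)).
have p2 := pi_ge2 R.
have th1 : 1 <= (1 : R) <= 2 * pi - 1 by rewrite lexx /=; lra.
have th0 : 0 < (1 : R) < 2 * pi by apply/andP; split; lra.
have sT : 1000 <= Num.sqrt T.
  have sT0 : 0 < Num.sqrt T by rewrite sqrtr_gt0.
  have := ler_wpM2r (ltW sT0) Ts; rewrite mulVf ?gt_eqF //; lra.
have sN : Num.sqrt N%:R <= 3 * Num.sqrt T.
  have -> : 3 * Num.sqrt T = Num.sqrt (3 ^+ 2 * T).
    by rewrite sqrtrM ?exprn_ge0 // sqrtr_sqr ger0_norm.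
  by rewrite ler_sqrt ?NT; [lra | rewrite mulr_ge0 ?exprn_ge0 // ltW].
have sN1 : Num.sqrt T <= Num.sqrt N.+1%:R.
  by rewrite ler_sqrt // -[N.+1%:R]natr1 NT; lra.
have Pj (j : 'I_J) : nrm (pz_sum 1 (tj j) (1 / 2) N) <= 1 / 2.
  have := @F_approx_of_tail _ _ hF 1 (tj j) N (1 / 4) th0.
  have tail k : nrm (\sum_(n < k) pz_term 1 (tj j) (N.+1 + n)) <= 1 / 4.
    apply: le_trans (pz_end k (tj0 j) ltr01 th1 (ltn0Sn N) _) _.
      by rewrite mulr1 -[N.+1%:R]natr1 NT; have := tj2 j; lra.
    rewrite divr1 ler_pdivrMr ?sqrtr_gt0 //; lra.
  move=> /(_ tail) hh; have := nrmB (F 1 (Complex (1 / 2) (tj j))) (F 1 (Complex (1 / 2) (tj j)) - pz_sum 1 (tj j) (1 / 2) N).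
  by rewrite opprB addrC subrK; have := Fj j; lra.
(* Averaging the partial sum: the term [n = 0] is stationary and contributes [J];
   for the others [0 < h ln (n + 1) <= 1], so the sum over [j] is geometric with a
   ratio away from [1]. *)
pose S (n : nat) : C := \sum_(j < J) cis (- (tj j * ln n.+1%:R)).
have sumE : \sum_(j < J) pz_sum 1 (tj j) (1 / 2) N =
   \sum_(n < N) cis n.+1%:R * (n.+1%:R `^ (- (1 / 2)))%:C%C * S n.
  rewrite exchange_big /=; apply: eq_bigr => n _; rewrite mulr_sumr; apply: eq_bigr => j _.
  by rewrite dpowE // mulr1 mulrA.
have Sn n : (0 < n)%N -> (n < N)%N -> nrm (S n) <= 16 * l.
  move=> n0 nN; have n1 : 2 <= n.+1%:R :> R by rewrite ler_nat.
  have ln2 : 1 / 2 <= ln n.+1%:R :> R.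
    by have := @ln_ratio_ge R 1 n.+1%:R ltr01 ltac:(lra); rewrite ln1 subr0 ler_pdivrMr // => hh; nra.
  have lnl : ln n.+1%:R <= l by rewrite ler_ln ?posrE // ler_nat.
  have -> : S n = cis (- (T * ln n.+1%:R)) * \sum_(j < J) cis (- (j%:R * (h * ln n.+1%:R))).
    rewrite mulr_sumr; apply: eq_bigr => j _; rewrite -cisD /tj; congr cis; ring.
  have x0 : 0 < h * ln n.+1%:R by rewrite mulr_gt0 //; lra.
  have x1 : h * ln n.+1%:R <= 1 by rewrite -[leRHS]hl ler_pM2l.
  rewrite nrmM nrm_cis mul1r; apply: le_trans (geometric_cis_sum_bound J x0 x1) _.
  rewrite ler_pdivrMr // (_ : 16 * l * _ = 16 * (h * l) * ln n.+1%:R); last by ring.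
  by rewrite hl mulr1; move: ln2; set q := ln _ => ln2; clear -ln2; lra.
have main : nrm (\sum_(j < J) pz_sum 1 (tj j) (1 / 2) N) <= J%:R * (1 / 2).
  apply: le_trans (nrm_sum _ _ _) _; apply: le_trans (ler_sum _ (fun j _ => Pj j)) _.
  by rewrite sumr_const card_ord mulr_natl.
have NE : N = N.-1.+1 by rewrite prednK.
have first_term : cis 1%:R * (1%:R `^ (- (1 / 2)))%:C%C * S 0%N = cis 1 * J%:R%:C%C :> C.
  rewrite powR1 mulr1 /S; under eq_bigr do rewrite ln1 mulr0 oppr0 cis0.
  by rewrite sumr_const card_ord (rmorph_nat (real_complex R)).
move: main; rewrite sumE NE big_ord_recl /= first_term.
set rest := \sum_(_ < _) _ => main.
have rest_le : nrm rest <= 16 * l * (2 * Num.sqrt N%:R).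
  apply: le_trans (nrm_sum _ _ _) _.
  apply: le_trans (_ : \sum_(n < N) n.+1%:R `^ (- (1 / 2)) * (16 * l) <= _); last first.
    rewrite -mulr_suml mulrC; apply: ler_wpM2l (sum_inv_sqrt N).
    by rewrite mulr_ge0 // ltW.
  rewrite [in leRHS]NE big_ord_recl /= -[leLHS]add0r; apply: lerD.
    by rewrite mulr_ge0 ?powR_ge0 // mulr_ge0 // ltW.
  apply: ler_sum => n _; rewrite !nrmM nrm_cis mul1r nrm_real ger0_norm ?powR_ge0 //.
  by rewrite ler_wpM2l ?powR_ge0 // Sn // /bump /= add1n [in ltnRHS]NE ltnS.
have Jn : nrm (cis 1 * J%:R%:C%C) = J%:R.
  by rewrite nrmM nrm_cis mul1r nrm_real ger0_norm.
have := nrmB (cis 1 * J%:R%:C%C + rest) rest; rewrite addrK Jn.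
have TT : T = Num.sqrt T ^+ 2 by rewrite sqr_sqrtr // ltW.
move: sT sN rest_le main J2; set r := nrm rest; set w := nrm (_ + rest).
set a := Num.sqrt T in TT *; set b := Num.sqrt N%:R => sT sN r_le main J2 JJ.
have h3 : l * b <= l * (3 * a) by rewrite ler_pM2l.
have h4 : T * l <= 192 * (a * l) by lra.
have h5 : 1000 * (a * l) <= T * l.
  by rewrite TT expr2 -[a * a * l]mulrA ler_wpM2r // mulr_ge0 ?(ltW l0) //; lra.
have h6 : 0 < a * l by rewrite mulr_gt0 //; lra.
lra.
Qed.

End WithF.
End HurwitzExponent.

(** * Combinatorics of the kept intervals *)

Section Kept.
Variable b : nat.
Variable Dn : pred nat.
Hypothesis b1 : (1 < b)%N.

(** Integer positions of the kept intervals of stage [n], in units of b ^ (- n). *)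
Fixpoint kept (n i : nat) : bool :=
  if n is n'.+1 then kept n' (i %/ b)%N && Dn (i %% b)%N else i == 0%N.

Definition digits : nat := (\sum_(a < b | Dn a) 1)%N.

Lemma kept_lt n i : kept n i -> (i < b ^ n)%N.
Proof.
elim: n i => [|n IH] i /=; first by move=> /eqP ->.
by move=> /andP[/IH h _]; rewrite expnSr -ltn_divLR // ltnW.
Qed.

Lemma kept_add n l i j : (j < b ^ l)%N ->
  kept (n + l) (i * b ^ l + j)%N = kept n i && kept l j.
Proof.
have b0 : (0 < b)%N by apply: ltnW.
elim: l j => [|l IH] j.
  by rewrite expn0 ltnS leqn0 => /eqP ->; rewrite addn0 muln1 addn0 andbT.
move=> jl; rewrite addnS /= expnSr mulnA divnMDl // modnMDl IH ?andbA //.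
by rewrite ltn_divLR // -expnSr.
Qed.

Lemma sum_kept_add (V : nmodType) (f : nat -> V) n l :
  \sum_(i < b ^ (n + l) | kept (n + l) i) f i =
  \sum_(i < b ^ n | kept n i) \sum_(j < b ^ l | kept l j) f (i * b ^ l + j)%N.
Proof.
rewrite big_mkcond expnD mulnC (sum_blocks (fun i => if kept (n + l) i then f i else 0)).
rewrite [RHS]big_mkcond; apply: eq_bigr => i _; rewrite -[RHS]/(if _ then _ else _).
rewrite [in RHS]big_mkcond; case: ifP => hi.
  by apply: eq_bigr => j _; rewrite [(b ^ l * i)%N]mulnC kept_add // hi.
by apply: big1 => j _; rewrite [(b ^ l * i)%N]mulnC kept_add // hi.
Qed.

Lemma sum_kept1 (V : nmodType) (f : nat -> V) :
  \sum_(i < b ^ 1 | kept 1 i) f i = \sum_(a < b | Dn a) f a.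
Proof.
rewrite expn1; apply: eq_bigl => i /=.
by rewrite divn_small ?ltn_ord // modn_small ?ltn_ord.
Qed.

Lemma card_kept n : (\sum_(i < b ^ n | kept n i) 1 = digits ^ n)%N.
Proof.
elim: n => [|n IH]; first by rewrite big_mkcond big_ord_recl big_ord0.
rewrite -addn1 (sum_kept_add (fun=> 1%N)) expnD expn1 -IH big_distrl /=.
by apply: eq_bigr => i _; rewrite (sum_kept1 (fun=> 1%N)) mul1n.
Qed.

(** Kept positions at distance at most [b ^ l] of a given one descend from one of
    three ancestors. *)
Lemma count_near j l i0 :
  (\sum_(i < b ^ (j + l) | kept (j + l) i && (i <= i0 + b ^ l) && (i0 <= i + b ^ l)) 1
    <= 3 * digits ^ l)%N.
Proof.
have bl0 : (0 < b ^ l)%N by rewrite expn_gt0 ltnW.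
pose u0 := (i0 %/ b ^ l)%N.
under eq_bigl do rewrite -andbA; rewrite big_mkcondr.
rewrite (sum_kept_add (fun i => if (i <= i0 + b ^ l)%N && (i0 <= i + b ^ l)%N then 1%N else 0%N)).
apply: (@leq_trans (\sum_(u < b ^ j) (if (u <= u0 + 1)%N && (u0 <= u + 1)%N then digits ^ l else 0)%N)).
  rewrite big_mkcond; apply: leq_sum => u _.
  case: (kept j u) => //; case: ifP => hu.
    rewrite -card_kept; apply: leq_sum => v _; by case: ifP.
  rewrite big1 // => v _; case: ifP => // /andP[h1 h2]; case/negP: hu.
  have i0E := divn_eq i0 (b ^ l); have i0r : (i0 %% b ^ l < b ^ l)%N by rewrite ltn_mod.
  have vl := ltn_ord v.
  rewrite -/u0 in i0E; rewrite i0E in h1 h2.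
  have h3 : (u * b ^ l < (u0 + 2) * b ^ l)%N by rewrite mulnDl; lia.
  have h4 : (u0 * b ^ l < (u + 2) * b ^ l)%N by rewrite mulnDl; lia.
  by rewrite !ltn_pmul2r // in h3 h4; lia.
have H (M : nat) : (\sum_(u < M | (u <= u0 + 1)%N && (u0 <= u + 1)%N) 1 <= minn 3 (M + 1 - u0))%N.
  elim: M => [|M IH]; first by rewrite big_ord0.
  rewrite big_mkcond big_ord_recr /= -big_mkcond.
  move: IH; set S := (\sum_(_ < _ | _) _)%N; case: ifP; lia.
have {}H := leq_trans (H (b ^ j)%N) (geq_minl _ _).
apply: leq_trans (leq_mul H (leqnn (digits ^ l))); rewrite big_distrl /=.
by rewrite -big_mkcond; apply: leq_sum => u _; rewrite mul1n.
Qed.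

End Kept.

(** * Mean squares of Fourier coefficients *)

Section DiscreteStrichartz.
Variable R : realType.
Local Notation C := (R[i]).
Local Notation nrm := (@Normc.normc R).

Lemma nrm_sum_cis_sqr (I : finType) (P : pred I) (a : I -> R) :
  nrm (\sum_(i | P i) cis (a i)) ^+ 2 = \sum_(i | P i) \sum_(j | P j) cos (a i - a j).
Proof.
rewrite nrm_sqr Re_sum Im_sum !expr2 !big_distrlr -big_split /=.
apply: eq_bigr => i _; rewrite -big_split /=; apply: eq_bigr => j _.
by rewrite cosB.
Qed.

Lemma nrm_geometric_sqr_le (u : R) M : `|u| <= 2 ->
  u ^+ 2 * nrm (\sum_(j < M) cis (j%:R * u)) ^+ 2 <= 64.
Proof.
move=> u2; have h := chord_ge_small u2.
have E : (1 - cis u) * \sum_(j < M) cis (j%:R * u) = 1 - cis (M%:R * u).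
  elim: M => [|M IH]; first by rewrite big_ord0 mulr0 mul0r cis0 subrr.
  rewrite big_ord_recr /= mulrDr IH.
  have -> : M.+1%:R * u = M%:R * u + u by rewrite -natr1; ring.
  by rewrite cisD; ring.
have : nrm (1 - cis u) * nrm (\sum_(j < M) cis (j%:R * u)) <= 2.
  by rewrite -nrmM E; apply: le_trans (nrmB _ _) _; rewrite nrm1 nrm_cis.
set S := nrm (\sum_(_ < _) _) => h2; have S0 : 0 <= S by apply: nrm_ge0.
have h3 : `|u| * S <= 8.
  by have := ler_wpM2r S0 h; lra.
rewrite -exprMn -real_normK ?num_real // normrM (ger0_norm S0).
have : 0 <= `|u| * S by rewrite mulr_ge0.
by move: h3; set x := _ * S => h3 x0; nra.
Qed.

Section Points.
Variables (b : nat) (Dn : pred nat).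
Hypothesis b1 : (1 < b)%N.
Variables (c0 len : R).
Hypotheses (len0 : 0 < len) (len2 : len <= 2).
Local Notation m := (digits b Dn).
Hypothesis m1 : (1 < m)%N.
Hypothesis mb : (m <= b)%N.

(** Left endpoint of the interval at position [i]. *)
Definition node (k i : nat) : R := c0 + len * (i%:R / (b ^ k)%:R).

Definition coef (k : nat) (y : R) : C := \sum_(i < b ^ k | kept b Dn k i) cis (y * node k i).

Lemma node_near k j i i' : (j <= k)%N -> (0 < b ^ k)%N ->
  `|node k i - node k i'| <= len / (b ^ j)%:R ->
  (i <= i' + b ^ (k - j))%N && (i' <= i + b ^ (k - j))%N.
Proof.
move=> jk bk; have bkR : 0 < (b ^ k)%:R :> R by rewrite ltr0n.
have bjR : 0 < (b ^ j)%:R :> R by rewrite ltr0n expn_gt0 ltnW.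
have -> : node k i - node k i' = len * ((i%:R - i'%:R) / (b ^ k)%:R).
  by rewrite /node; field; rewrite gt_eqF.
rewrite normrM (gtr0_norm len0) ler_pM2l // normrM [`|_^-1|]gtr0_norm ?invr_gt0 //.
rewrite ler_pdivrMr // [in leRHS](_ : (b ^ k)%N = (b ^ j * b ^ (k - j))%N); last first.
  by rewrite -expnD subnKC.
rewrite natrM mulrA mulVf ?gt_eqF // mul1r ler_norml => /andP[h1 h2].
apply/andP; split; rewrite -(ler_nat R) natrD; lra.
Qed.

Lemma count_near_real k j (i : nat) : (j <= k)%N ->
  \sum_(i' < b ^ k | kept b Dn k i')
     (if (i' <= i + b ^ (k - j))%N && (i <= i' + b ^ (k - j))%N then 1 else 0 : R)
  <= 3 * (m ^ (k - j))%:R.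
Proof.
move=> jk; rewrite -natrM; have := @count_near b Dn b1 j (k - j) i.
rewrite subnKC // -(ler_nat R); apply: le_trans; rewrite natr_sum.
under [leRHS]eq_bigl do rewrite -andbA.
by rewrite [leRHS]big_mkcondr.
Qed.

Lemma geometric_scales J : (\sum_(j < J) b ^ (2 * j) * m ^ (J - j) <= b ^ (2 * J))%N.
Proof.
elim: J => [|J IH]; first by rewrite big_ord0.
rewrite big_ord_recr /= subSnn expn1.
have -> : (\sum_(i < J) b ^ (2 * i) * m ^ (J.+1 - i) = m * \sum_(i < J) b ^ (2 * i) * m ^ (J - i))%N.
  rewrite big_distrr /=; apply: eq_bigr => i _.
  by rewrite subSn ?(ltnW (ltn_ord i)) // expnS mulnCA.
rewrite mulnS expnD; apply: leq_trans (leq_add (leq_mul (leqnn m) IH) (leqnn _)) _.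
set B := (b ^ (2 * J))%N; rewrite (mulnC m) -mulnDr [(b ^ 2 * B)%N]mulnC leq_mul2l.
apply/orP; right; rewrite addnn -mul2n -mulnn; exact: leq_mul.
Qed.

Lemma scale_cases (u : R) J : `|u| <= len -> `|u| <= len / (b ^ J)%:R \/
  exists2 j, (j < J)%N & len / (b ^ j.+1)%:R < `|u| /\ `|u| <= len / (b ^ j)%:R.
Proof.
move=> ul; elim: J => [|J [IH|[j jJ H]]]; first by left; rewrite expn0 divr1.
  have [h|h] := leP `|u| (len / (b ^ J.+1)%:R); first by left.
  by right; exists J.
by right; exists j => //; apply: leqW.
Qed.

(** Frostman's condition bounds the energy of the Dirichlet kernel: the scales
    coarser than [b ^ (- J)] form a geometric series. *)
Lemma kernel_energy (J k : nat) (i : 'I_(b ^ k)) : (J <= k)%N ->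
  \sum_(i' < b ^ k | kept b Dn k i')
     nrm (\sum_(j < 2 * b ^ J) cis (j%:R * (node k i - node k i'))) ^+ 2
  <= (12 + 192 * b%:R ^+ 2 / len ^+ 2) * (b ^ J)%:R ^+ 2 * (m ^ (k - J))%:R.
Proof.
move=> Jk; have b0 : (0 < b)%N by apply: ltnW.
have bp n : 0 < (b ^ n)%:R :> R by rewrite ltr0n expn_gt0 b0.
pose ind j (i' : nat) : R := if (i' <= i + b ^ (k - j))%N && (i <= i' + b ^ (k - j))%N then 1 else 0.
have ind0 j i' : 0 <= ind j i' by rewrite /ind; case: ifP.
pose c (j : nat) : R := 64 * (b ^ j.+1)%:R ^+ 2 / len ^+ 2.
have c0' j : 0 <= c j by rewrite divr_ge0 ?exprn_ge0 ?mulr_ge0 ?(ltW len0).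
have pointwise (i' : 'I_(b ^ k)) :
    nrm (\sum_(j < 2 * b ^ J) cis (j%:R * (node k i - node k i'))) ^+ 2 <=
    4 * (b ^ J)%:R ^+ 2 * ind J i' + \sum_(j < J) c j * ind j i'.
  set u := node k i - node k i'.
  have indP j : (j <= k)%N -> `|u| <= len / (b ^ j)%:R -> ind j i' = 1.
    move=> jk; rewrite /u distrC => /(node_near jk (_ : 0 < b ^ k)%N) h.
    by rewrite /ind h // expn_gt0 b0.
  have ul : `|u| <= len.
    rewrite /u /node (_ : _ - _ = len * ((i%:R - i'%:R) / (b ^ k)%:R)); last by field; rewrite gt_eqF.
    rewrite normrM gtr0_norm // ler_piMr ?(ltW len0) // normrM [`|_^-1|]gtr0_norm ?invr_gt0 //.
    rewrite ler_pdivrMr // mul1r ler_norml.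
    have h1 : (i%:R : R) <= (b ^ k)%:R by rewrite ler_nat ltnW.
    have h2 : (i'%:R : R) <= (b ^ k)%:R by rewrite ler_nat ltnW.
    have := ler0n R i; have := ler0n R i'; move=> *; apply/andP; split; lra.
  have sum0 : 0 <= \sum_(j < J) c j * ind j i' by apply: sumr_ge0 => j _; rewrite mulr_ge0.
  have [h|[j jJ [h1 h2]]] := scale_cases J ul.
    rewrite (indP J) // mulr1 -[leLHS]addr0 lerD //.
    apply: le_trans (_ : (2 * b ^ J)%:R ^+ 2 <= _).
      rewrite lerXn2r ?nnegrE ?nrm_ge0 //; apply: le_trans (nrm_sum _ _ _) _.
      by under eq_bigr do rewrite nrm_cis; rewrite sumr_const card_ord.
    by rewrite natrM le_eqVlt; apply/orP; left; apply/eqP; ring.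
  rewrite -[leLHS]add0r; apply: lerD; first by rewrite mulr_ge0 ?mulr_ge0 ?exprn_ge0.
  rewrite (bigD1 (Ordinal jJ)) //= -[leLHS]addr0; apply: lerD; last first.
    by apply: sumr_ge0 => j' _; rewrite mulr_ge0.
  rewrite (indP j) ?(ltnW (leq_trans jJ Jk)) // mulr1.
  have h3 := nrm_geometric_sqr_le (2 * b ^ J) (le_trans ul len2).
  move: h3; set S := nrm _ => h3.
  rewrite /c ler_pdivlMr ?exprn_gt0 //.
  have h4 : len <= `|u| * (b ^ j.+1)%:R by rewrite -ler_pdivrMr // ltW.
  have h5 : len ^+ 2 <= u ^+ 2 * (b ^ j.+1)%:R ^+ 2.
    rewrite -[u ^+ 2]real_normK ?num_real // -exprMn lerXn2r ?nnegrE ?mulr_ge0 //; exact: ltW.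
  apply: le_trans (ler_wpM2l (sqr_ge0 S) h5) _.
  by rewrite mulrA ler_wpM2r ?exprn_ge0 // mulrC.
apply: le_trans (ler_sum _ (fun i' _ => pointwise i')) _.
rewrite big_split /= -mulr_sumr exchange_big /=.
have cnt j : (j <= k)%N -> \sum_(i' < b ^ k | kept b Dn k i') ind j i' <= 3 * (m ^ (k - j))%:R.
  by move=> jk; apply: count_near_real.
have mk j : (j <= J)%N -> (m ^ (k - j) = m ^ (k - J) * m ^ (J - j))%N.
  by move=> jJ; rewrite -expnD addnBA // subnK.
apply: le_trans (_ : 4 * (b ^ J)%:R ^+ 2 * (3 * (m ^ (k - J))%:R) +
   \sum_(j < J) c j * (3 * (m ^ (k - j))%:R) <= _).
  apply: lerD; first by rewrite ler_wpM2l ?cnt // mulr_ge0 ?exprn_ge0.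
  apply: ler_sum => j _; rewrite -mulr_sumr ler_wpM2l // cnt //.
  exact: leq_trans (ltnW (ltn_ord j)) Jk.
set Q := 192 * _ / _; rewrite (_ : (12 + Q) * _ * _ =
  12 * (b ^ J)%:R ^+ 2 * (m ^ (k - J))%:R + Q * (b ^ J)%:R ^+ 2 * (m ^ (k - J))%:R); last by ring.
apply: lerD.
  by rewrite le_eqVlt; apply/orP; left; apply/eqP; ring.
apply: le_trans (_ : Q * (m ^ (k - J))%:R *
   (\sum_(j < J) b ^ (2 * j) * m ^ (J - j))%:R <= _).
  rewrite natr_sum mulr_sumr le_eqVlt; apply/orP; left; apply/eqP.
  apply: eq_bigr => j _; rewrite (mk j) ?(ltnW (ltn_ord j)) // /c.
  have -> : (b ^ j.+1)%:R ^+ 2 = b%:R ^+ 2 * (b ^ (2 * j))%:R :> R.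
    by rewrite -!natrX -natrM -expnM -expnD; congr (_%:R); congr expn; lia.
  by rewrite /Q !natrM; ring.
rewrite -[leRHS]mulrA [(b ^ J)%:R ^+ 2 * _]mulrC mulrA ler_wpM2l //.
  by rewrite mulr_ge0 // divr_ge0 ?mulr_ge0 ?exprn_ge0 // ltW.
by rewrite -natrX ler_nat -expnM [(J * 2)%N]mulnC geometric_scales.
Qed.

(** By positivity the sum over [0 <= n < N] is at most [1 / N] times the sum of
    [|coef (j - j')| ^ 2] over all [j, j' < 2 N], where every difference below [N]
    occurs at least [N] times; exchanging the sums turns it into the
    [kernel_energy] of all pairs of nodes. *)
Lemma strichartz (J k : nat) : (J <= k)%N ->
  \sum_(n < b ^ J) nrm (coef k n%:R) ^+ 2 <=
  (12 + 192 * b%:R ^+ 2 / len ^+ 2) * (b ^ J)%:R * (m ^ (k - J) * m ^ k)%:R.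
Proof.
move=> Jk; set N := (b ^ J)%N; set A := 12 + _.
have N0 : 0 < N%:R :> R by rewrite ltr0n expn_gt0 ltnW.
have swap : \sum_(j < 2 * N) \sum_(j' < 2 * N) nrm (coef k (j%:R - j'%:R)) ^+ 2 =
    \sum_(i < b ^ k | kept b Dn k i) \sum_(i' < b ^ k | kept b Dn k i')
      nrm (\sum_(j < 2 * N) cis (j%:R * (node k i - node k i'))) ^+ 2.
  transitivity (\sum_(j < 2 * N) \sum_(j' < 2 * N)
     \sum_(i < b ^ k | kept b Dn k i) \sum_(i' < b ^ k | kept b Dn k i')
        cos ((j%:R - j'%:R) * (node k i - node k i'))).
    apply: eq_bigr => j _; apply: eq_bigr => j' _; rewrite nrm_sum_cis_sqr.
    by apply: eq_bigr => i _; apply: eq_bigr => i' _; rewrite -mulrBr.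
  under eq_bigr do rewrite exchange_big /=.
  rewrite exchange_big /=; apply: eq_bigr => i _.
  under eq_bigr do rewrite exchange_big /=.
  rewrite exchange_big /=; apply: eq_bigr => i' _.
  rewrite nrm_sum_cis_sqr; apply: eq_bigr => j _; apply: eq_bigr => j' _.
  by rewrite -mulrBl.
have lower : N%:R * \sum_(n < N) nrm (coef k n%:R) ^+ 2 <=
    \sum_(j < 2 * N) \sum_(j' < 2 * N) nrm (coef k (j%:R - j'%:R)) ^+ 2.
  rewrite exchange_big /= mul2n -addnn [leRHS]big_split_ord /= -[leLHS]addr0.
  apply: lerD; last by apply: sumr_ge0 => j _; apply: sumr_ge0 => j' _; apply: exprn_ge0; apply: nrm_ge0.
  rewrite mulr_natl -[X in _ *+ X](card_ord N) -sumr_const; apply: ler_sum => j' _.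
  have jN : (j' + N + (N - j') = N + N)%N by have := ltn_ord j'; lia.
  rewrite -jN [leRHS]big_split_ord /= [X in _ <= X + _]big_split_ord /=.
  rewrite addrAC [X in _ <= X]addrC -[leLHS]addr0; apply: lerD.
    apply: ler_sum => n _; rewrite natrD addrAC subrr add0r //.
  by apply: addr_ge0; apply: sumr_ge0 => n _; apply: exprn_ge0; apply: nrm_ge0.
have upper : \sum_(i < b ^ k | kept b Dn k i) \sum_(i' < b ^ k | kept b Dn k i')
      nrm (\sum_(j < 2 * N) cis (j%:R * (node k i - node k i'))) ^+ 2 <=
   A * N%:R ^+ 2 * (m ^ (k - J))%:R * (m ^ k)%:R.
  apply: le_trans (ler_sum _ (fun i _ => kernel_energy i Jk)) _.
  have -> : (m ^ k)%:R = \sum_(i < b ^ k | kept b Dn k i) 1 :> R.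
    by rewrite -card_kept // natr_sum.
  by rewrite mulr_sumr; apply: ler_sum => i _; rewrite mulr1.
rewrite -(ler_pM2l N0); apply: le_trans lower _; rewrite swap; apply: le_trans upper _.
by rewrite natrM le_eqVlt; apply/orP; left; apply/eqP; ring.
Qed.

End Points.
End DiscreteStrichartz.

(** * The Cantor measure *)

Section CantorMeasure.
Variable R : realType.
Variables (b : nat) (D : {set 'I_b}).
Variable nu : probability (measurableTypeR R) R.
Hypothesis b1 : (1 < b)%N.
Hypothesis D1 : (1 < #|D|)%N.
Hypothesis hnu : is_cantor_measure D nu.

Definition digit_pred : pred nat := fun a => [exists x : 'I_b, (val x == a) && (x \in D)].
Local Notation Dn := digit_pred.
Local Notation kp := (kept b Dn).
Local Notation m := (digits b Dn).
Definition width : R := theta1 R - theta0 R.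
Local Notation nd := (node b (theta0 R) width).

Lemma digitP (x : 'I_b) : Dn (val x) = (x \in D).
Proof.
apply/existsP/idP => [[y /andP[/eqP/val_inj -> //]]|xD].
by exists x; rewrite eqxx.
Qed.

Lemma digits_card : m = #|D|.
Proof. by rewrite /digits -sum1_card; apply: eq_bigl => x; rewrite digitP. Qed.

Lemma width_gt0 : 0 < width. Proof. by rewrite /width /theta1 /theta0; lra. Qed.
Lemma width_le2 : width <= 2. Proof. by rewrite /width /theta1 /theta0; lra. Qed.

Lemma bpow_gt0 n : 0 < (b ^ n)%:R :> R.
Proof. by rewrite ltr0n expn_gt0 ltnW. Qed.

Lemma mpow_gt0 n : 0 < (m ^ n)%:R :> R.
Proof. by rewrite ltr0n expn_gt0 digits_card ltnW. Qed.

Lemma le_node n (i j : nat) : (nd n i <= nd n j) = (i <= j)%N.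
Proof.
rewrite /node lerD2l ler_pM2l ?width_gt0 // ler_pM2r ?invr_gt0 ?bpow_gt0 //.
by rewrite ler_nat.
Qed.

Lemma lt_node n (i j : nat) : (nd n i < nd n j) = (i < j)%N.
Proof. by rewrite ltNge le_node -ltnNge. Qed.

Lemma node_refine n l i : nd (n + l) (i * b ^ l) = nd n i.
Proof.
rewrite /node expnD !natrM; congr (_ + _ * _).
by field; rewrite !gt_eqF ?bpow_gt0.
Qed.

Definition cellI n i : set R := `[nd n i, nd n i.+1].

Lemma kept_word n i : kp n i -> exists2 w : 'I_b ^ n, (forall j, w j \in D) &
   \sum_(j < n) (w j)%:R / b%:R ^+ j.+1 = i%:R / (b ^ n)%:R :> R.
Proof.
elim: n i => [|n IH] i.
  move=> /eqP ->; exists [ffun _ => Ordinal (ltnW b1)]; first by case.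
  by rewrite big_ord0 mul0r.
move=> /= /andP[/IH[w wD wE] /existsP[d /andP[/eqP dE dD]]].
exists [ffun j : 'I_n.+1 => oapp w d (insub (val j))] => [j|].
  by rewrite ffunE; case: insubP => [j' _ _|_] //=.
rewrite big_ord_recr /= ffunE insubF ?ltnn //=.
have -> : \sum_(j < n) ([ffun j : 'I_n.+1 => oapp w d (insub (val j))] (widen_ord (leqnSn n) j))%:R / b%:R ^+ j.+1 =
    \sum_(j < n) (w j)%:R / b%:R ^+ j.+1 :> R.
  by apply: eq_bigr => j _; rewrite ffunE /= valK.
have b0 : b%:R != 0 :> R by rewrite pnatr_eq0 -lt0n ltnW.
rewrite wE dE [in RHS](divn_eq i b) natrD natrM !natrX exprS; field.
by rewrite b0 expf_neq0.
Qed.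

Lemma measurable_cellI n i : measurable (cellI n i : set (measurableTypeR R)).
Proof. exact: measurable_itv. Qed.

Lemma cell_measure n i : kp n i -> nu (cellI n i) = ((m ^ n)%:R^-1)%:E.
Proof.
move=> /kept_word[w wD wE]; rewrite natrX digits_card -(hnu wD); congr (nu _).
have e1 : cell_left R w = nd n i by rewrite /cell_left wE.
have e2 : cell_left R w + (theta1 R - theta0 R) / b%:R ^+ n = nd n i.+1.
  by rewrite e1 /node -[i.+1%:R]natr1 -/width natrX; ring.
by rewrite /cellI /cell e2 e1.
Qed.

Definition pr (A : set R) : R := fine (nu A).

Lemma prE (A : set R) : measurable (A : set (measurableTypeR R)) -> nu A = (pr A)%:E.
Proof. by move=> mA; rewrite /pr fineK // fin_num_measure. Qed.

Lemma pr_ge0 (A : set R) : 0 <= pr A.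
Proof. by rewrite /pr fine_ge0. Qed.

Lemma pr_le (A B : set R) : measurable (A : set (measurableTypeR R)) ->
  measurable (B : set (measurableTypeR R)) -> A `<=` B -> pr A <= pr B.
Proof.
by move=> mA mB AB; rewrite -lee_fin -!prE //; apply: le_measure; rewrite ?inE.
Qed.

Lemma pr_le1 (A : set R) : measurable (A : set (measurableTypeR R)) -> pr A <= 1.
Proof. by move=> mA; rewrite -lee_fin -prE // probability_le1. Qed.

Lemma prU (A B : set R) : measurable (A : set (measurableTypeR R)) ->
  measurable (B : set (measurableTypeR R)) -> A `&` B = set0 ->
  pr (A `|` B) = pr A + pr B.
Proof.
move=> mA mB AB; apply: EFin_inj; rewrite EFinD -!prE //; last exact: measurableU.
by apply: measureU.
Qed.

Lemma pr_cell n i : kp n i -> pr (cellI n i) = (m ^ n)%:R^-1.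
Proof. by move=> /cell_measure h; rewrite /pr h. Qed.

(** Adjacent kept intervals share an endpoint; [piece] attributes it to the right
    one, so that the pieces partition the stage. *)
Definition piece n i : set R :=
  if kp n i.+1 then `[nd n i, nd n i.+1[%classic else cellI n i.

Definition stage n : set R := \big[setU/set0]_(i < b ^ n | kp n i) piece n i.

Lemma stage_pieceP n x : stage n x <-> exists2 i, kp n i & piece n i x.
Proof.
rewrite /stage -(bigcup_pred [pred i : 'I_(b ^ n) | kp n i] (fun i => piece n i)).
split => [[i ki h]|[i ki h]]; first by exists (val i).
by exists (Ordinal (kept_lt b1 ki)).
Qed.

Lemma stageP n x : stage n x <-> exists2 i, kp n i & cellI n i x.
Proof.
rewrite stage_pieceP; split.
  move=> [i ki]; rewrite /piece; case: ifP => _ h; exists i => //.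
  by move: h; rewrite /cellI /= !in_itv /= => /andP[-> /ltW].
move=> [i ki]; rewrite /cellI /= in_itv /= => /andP[h1 h2].
have [k1|k1] := boolP (kp n i.+1); last first.
  by exists i => //; rewrite /piece (negbTE k1) /cellI /= in_itv /= h1.
have [e|ne] := eqVneq x (nd n i.+1).
  exists i.+1 => //.
  by rewrite /piece e; case: ifP => _; rewrite /cellI /= in_itv /= lexx /= ?lt_node ?le_node.
by exists i => //; rewrite /piece k1 /= in_itv /= h1 lt_neqAle ne.
Qed.

Lemma measurable_piece n i : measurable (piece n i : set (measurableTypeR R)).
Proof. by rewrite /piece; case: ifP => _; apply: measurable_itv. Qed.

Lemma measurable_stage n : measurable (stage n : set (measurableTypeR R)).
Proof. by apply: bigsetU_measurable => i _; apply: measurable_piece. Qed.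

Lemma piece_disjoint n (i j : nat) x : kp n i -> kp n j -> piece n i x -> piece n j x -> i = j.
Proof.
wlog ij : i j / (i < j)%N => [H ki kj pi pj|ki kj].
  have [h|h|//] := ltngtP i j; first exact: H pi pj.
  by apply/esym; apply: H pj pi.
have pj : piece n j x -> nd n j <= x.
  by rewrite /piece; case: ifP => _; rewrite /cellI /= in_itv /= => /andP[].
move=> pi /pj xj; exfalso; move: pi; rewrite /piece.
case: ifP => k1; rewrite /cellI /= in_itv /= => /andP[_ h].
  have := le_lt_trans xj h; rewrite lt_node ltnS; lia.
have := le_trans xj h; rewrite le_node => h2.
have e : j = i.+1 by apply/eqP; rewrite eqn_leq h2.
by rewrite e k1 in kj.
Qed.

Definition shared n : R := \sum_(i < b ^ n | kp n i && kp n i.+1) pr [set nd n i.+1].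

Lemma pr_piece n i : kp n i ->
  pr (piece n i) = (m ^ n)%:R^-1 - (if kp n i.+1 then pr [set nd n i.+1] else 0).
Proof.
move=> ki; rewrite /piece -(pr_cell ki); case: ifP => _; last by rewrite subr0.
have -> : cellI n i = `[nd n i, nd n i.+1[%classic `|` [set nd n i.+1].
  apply/seteqP; split => x; rewrite /cellI /= !in_itv /=.
    move=> /andP[h1]; rewrite le_eqVlt => /predU1P[->|h2]; [by right | by left; rewrite h1].
  by move=> [/andP[-> /ltW //]|->]; rewrite lexx andbT le_node.
rewrite prU ?addrK //.
by apply/seteqP; split => x //= [h e]; move: h; rewrite e in_itv /= ltxx andbF.
Qed.

(** The pieces are disjoint, and all kept intervals together have mass [1] when
    common endpoints are counted twice. *)
Lemma pr_stage n : pr (stage n) = 1 - shared n.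
Proof.
have h : nu (stage n) = (\sum_(i < b ^ n | kp n i) (pr (piece n i))%:E)%E.
  rewrite /stage (measure_bigsetU_ord_cond nu (F := fun i : 'I_(b ^ n) => piece n i)) //.
  - by apply: eq_bigr => i _; apply: prE; apply: measurable_piece.
  - by move=> i _; apply: measurable_piece.
  move=> i j /= ki kj [x [pi pj]]; by apply: val_inj; apply: (piece_disjoint ki kj pi pj).
rewrite /pr h sumEFin /=.
rewrite (eq_bigr (fun i : 'I_(b ^ n) => (m ^ n)%:R^-1 - (if kp n i.+1 then pr [set nd n i.+1] else 0))).
  rewrite sumrB; congr (_ - _); last by rewrite /shared big_mkcondr.
  transitivity (\sum_(i < b ^ n | kp n i) (1 : R) / (m ^ n)%:R).
    by apply: eq_bigr => i _; rewrite div1r.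
  have ck : (m ^ n)%:R = \sum_(i < b ^ n | kp n i) 1 :> R by rewrite -card_kept // natr_sum.
  by rewrite -mulr_suml -ck divff // gt_eqF // mpow_gt0.
by move=> i ki; apply: pr_piece.
Qed.

End CantorMeasure.

Section CantorSupport.
Variable R : realType.
Variables (b : nat) (D : {set 'I_b}).
Variable nu : probability (measurableTypeR R) R.
Hypothesis b1 : (1 < b)%N.
Hypothesis D1 : (1 < #|D|)%N.
Hypothesis hnu : is_cantor_measure D nu.
Local Notation Dn := (digit_pred D).
Local Notation kp := (kept b Dn).
Local Notation m := (digits b Dn).
Local Notation nd := (node b (theta0 R) (width R)).
Local Notation stage := (@stage R b D).
Local Notation cellI := (@cellI R b).

Lemma inv_mpow_small (e : R) : 0 < e -> exists l0, forall l, (l0 <= l)%N -> (m ^ l)%:R^-1 <= e.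
Proof.
move=> e0; exists (Num.truncn e^-1).+1 => l hl.
rewrite -[leRHS]invrK lef_pV2 ?posrE ?invr_gt0 //; last exact: mpow_gt0.
apply: le_trans (ltW (truncnS_gt _)) _; rewrite ler_nat; apply: leq_trans hl _.
by rewrite ltnW // ltn_expl // digits_card.
Qed.

Lemma inv_bpow_small (e : R) : 0 < e -> exists n, width R * (b ^ n)%:R^-1 < e.
Proof.
move=> e0; exists (Num.truncn (width R / e)).+1.
rewrite ltr_pdivrMr; last exact: bpow_gt0.
rewrite -ltr_pdivrMl // mulrC; apply: lt_trans (truncnS_gt _) _.
by rewrite ltr_nat ltn_expl.
Qed.

Lemma pr_point_small (x e : R) : 0 < e -> (forall l0, exists2 l, (l0 <= l)%N & exists2 i, kp l i & cellI l i x) ->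
  pr nu [set x] <= e.
Proof.
move=> /inv_mpow_small[l0 hl0] h; have [l ll [i ki xi]] := h l0.
apply: le_trans (hl0 l ll); rewrite -(pr_cell b1 hnu ki); apply: pr_le => //.
  exact: measurable_cellI.
by move=> _ ->.
Qed.

Lemma eq0_small (x : R) : 0 <= x -> (forall e, 0 < e -> x <= e) -> x = 0.
Proof.
move=> x0 h; apply/eqP; rewrite eq_le x0 andbT; apply/ler_addgt0Pr => e e0.
by rewrite add0r h.
Qed.

Lemma stage_decreasing n : stage n.+1 `<=` stage n.
Proof.
move=> x /(stageP D b1)[i /= /andP[ki _]]; rewrite /cellI /= in_itv /= => /andP[h1 h2].
apply/(stageP D b1); exists (i %/ b)%N => //; rewrite /cellI /= in_itv /=.
have i_eq := divn_eq i b; have ir : (i %% b < b)%N by rewrite ltn_mod ltnW.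
rewrite -!(node_refine R b1 n 1) addn1 expn1; apply/andP; split.
  by apply: le_trans h1; rewrite le_node // {2}i_eq leq_addr.
by apply: le_trans h2 _; rewrite le_node // mulSn {1}i_eq; lia.
Qed.

Lemma kept0 l : Dn 0%N -> kp l 0%N.
Proof. by move=> h; elim: l => //= l IH; rewrite div0n mod0n IH. Qed.

Lemma kept_max l : Dn b.-1 -> kp l (b ^ l).-1.
Proof.
have b0 : (0 < b)%N by apply: ltnW.
move=> h; elim: l => //= l IH.
have E : ((b ^ l.+1).-1 = (b ^ l).-1 * b + b.-1)%N.
  have : (0 < b ^ l)%N by rewrite expn_gt0 b0.
  rewrite expnSr; case: (b ^ l)%N => // c _; rewrite mulSn /=; lia.
by rewrite E divnMDl // modnMDl divn_small ?modn_small ?prednK // addn0 IH h.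
Qed.

(** If an extreme digit is kept, a common endpoint lies in a kept interval of every
    later stage, whose mass tends to [0]. *)
Lemma shared_point_null n i : kp n i -> kp n i.+1 -> Dn 0%N \/ Dn b.-1 ->
  pr nu [set nd n i.+1] = 0.
Proof.
move=> ki ki1 hD; apply: eq0_small => [|e e0]; first exact: pr_ge0.
apply: pr_point_small e0 _ => l0; exists (n + l0)%N; first exact: leq_addl.
have bl : (0 < b ^ l0)%N by rewrite expn_gt0 ltnW.
case: hD => hD.
  exists (i.+1 * b ^ l0)%N.
    by rewrite -[(_ * _)%N]addn0 kept_add // ki1 kept0.
  rewrite /cellI /= in_itv /= (node_refine R b1) lexx -(node_refine R b1 n l0 i.+1) le_node //.
  by rewrite leqnSn.
exists (i * b ^ l0 + (b ^ l0).-1)%N.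
  by rewrite kept_add ?prednK // ki kept_max.
have E : ((i * b ^ l0 + (b ^ l0).-1).+1 = i.+1 * b ^ l0)%N by rewrite -addnS prednK // mulSn addnC.
rewrite /cellI /= in_itv /= E.
by rewrite (node_refine R b1) lexx andbT -(node_refine R b1 n l0) le_node //; rewrite mulSn; lia.
Qed.

Definition shared_points n : set R :=
  \big[setU/set0]_(i < b ^ n | kp n i && kp n i.+1) [set nd n i.+1].

Lemma shared_pointsP n x : shared_points n x <->
  exists2 i, kp n i && kp n i.+1 & x = nd n i.+1.
Proof.
rewrite /shared_points -(bigcup_pred [pred i : 'I_(b ^ n) | kp n i && kp n i.+1] (fun i => [set nd n i.+1])).
split => [[i ki h]|[i ki h]]; first by exists (val i).
by have /andP[k1 _] := ki; exists (Ordinal (kept_lt b1 k1)).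
Qed.

Lemma measurable_shared_points n : measurable (shared_points n : set (measurableTypeR R)).
Proof. by apply: bigsetU_measurable => i _; apply: measurable_set1. Qed.

Lemma pr_shared_points n : pr nu (shared_points n) = shared D nu n.
Proof.
have h : nu (shared_points n) = (\sum_(i < b ^ n | kp n i && kp n i.+1) (pr nu [set nd n i.+1])%:E)%E.
  rewrite /shared_points (measure_bigsetU_ord_cond nu (F := fun i : 'I_(b ^ n) => [set nd n i.+1])).
  - by apply: eq_bigr => i _; apply: prE; apply: measurable_set1.
  - by move=> i _; apply: measurable_set1.
  move=> i j _ _ [x [/= -> /eqP]]; rewrite eq_le !le_node // !ltnS => /andP[? ?].
  by apply: val_inj; apply/eqP; rewrite eqn_leq; apply/andP.
by rewrite /pr h sumEFin.
Qed.

(** If neither extreme digit is kept, the common endpoints of stage [n] lie in that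
    stage but not in the next one. Comparing the masses [1 - shared n] and
    [1 - shared n.+1] of the two stages gives the inequality, which forces the
    masses to vanish as they are at most [1]. *)
Lemma shared_doubles n : ~ Dn 0%N -> ~ Dn b.-1 -> 2 * shared D nu n <= shared D nu n.+1.
Proof.
move=> D0 Db.
have disj : stage n.+1 `&` shared_points n = set0.
  apply/seteqP; split => // x [/(stageP D b1)[j /= /andP[kj dj]] + /shared_pointsP[i /andP[ki ki1] xE]].
  rewrite /cellI /= in_itv /= xE -(node_refine R b1 n 1) addn1 expn1 !le_node // => /andP[h1 h2].
  have jE := divn_eq j b; set a := (j %% b)%N in dj jE.
  have a0 : (0 < a)%N by rewrite lt0n; apply/eqP => e; rewrite e in dj.
  have ab : (a < b)%N by rewrite ltn_mod ltnW.
  have ab' : (a < b.-1)%N.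
    rewrite ltn_neqAle; apply/andP; split; last by lia.
    by apply/eqP => e; rewrite e in dj.
  set q := (j %/ b)%N in jE.
  have h3 : (i.+1 * b < q.+1 * b)%N by rewrite mulSn; lia.
  have h4 : (q * b < i.+1 * b)%N by lia.
  rewrite !ltn_pmul2r ?(ltnW b1) // in h3 h4; lia.
have sub : stage n.+1 `|` shared_points n `<=` stage n.
  move=> x [|/shared_pointsP[i /andP[ki ki1] ->]]; first exact: stage_decreasing.
  by apply/(stageP D b1); exists i => //; rewrite /cellI /= in_itv /= lexx le_node // leqnSn.
have ms k := @measurable_stage R b D k.
have mp := measurable_shared_points n.
have : pr nu (stage n.+1 `|` shared_points n) <= pr nu (stage n).
  by apply: pr_le => //; apply: measurableU.
by rewrite prU // pr_shared_points !(pr_stage b1 D1 hnu); lra.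
Qed.

Lemma shared_eq0 n : shared D nu n = 0.
Proof.
have [hD|hD] := pselect (Dn 0%N \/ Dn b.-1).
  by rewrite /shared big1 // => i /andP[ki ki1]; apply: shared_point_null.
have D0 : ~ Dn 0%N by move=> h; apply: hD; left.
have Db : ~ Dn b.-1 by move=> h; apply: hD; right.
have s0 k : 0 <= shared D nu k by rewrite -pr_shared_points pr_ge0.
have s1 k : shared D nu k <= 1 by rewrite -pr_shared_points pr_le1 //; apply: measurable_shared_points.
apply: eq0_small => // e e0.
have H l : 2 ^+ l * shared D nu n <= shared D nu (n + l)%N.
  elim: l => [|l IH]; first by rewrite mul1r addn0.
  rewrite addnS; apply: le_trans (shared_doubles _ D0 Db); rewrite exprS -mulrA.
  by rewrite ler_pM2l.
have [l hl] := @geometric_small R (2^-1) e ltac:(lra) e0.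
apply: le_trans hl; rewrite exprVn -[leRHS]mul1r ler_pdivlMr ?exprn_gt0 // mulrC.
exact: le_trans (H l) (s1 _).
Qed.

Lemma pr_stage1 n : pr nu (stage n) = 1.
Proof. by rewrite pr_stage // shared_eq0 subr0. Qed.

(** A point of every stage lies in intervals of mass tending to [0]; any other one
    is outside a set of mass [1]. *)
Lemma pr_point x : pr nu [set x] = 0.
Proof.
apply: eq0_small => [|e e0]; first exact: pr_ge0.
have [H|] := pselect (forall n, stage n x).
  by apply: pr_point_small e0 _ => l0; exists l0 => //; apply/(stageP D b1).
move=> /existsNP[n nx].
have ms := @measurable_stage R b D n.
have m1 : measurable ([set x] : set (measurableTypeR R)) by [].
have : pr nu (stage n `|` [set x]) <= 1 by apply: pr_le1; apply: measurableU.
rewrite prU //; last by apply/seteqP; split => // y [h1 h2]; apply: nx; rewrite -h2.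
by rewrite pr_stage1; lra.
Qed.

Lemma pr_piece_eq n i : kp n i -> pr nu (@piece R b D n i) = (m ^ n)%:R^-1.
Proof. by move=> ki; rewrite pr_piece // pr_point if_same subr0. Qed.

Lemma stage_closed n : closed (stage n).
Proof.
have -> : stage n = \big[setU/set0]_(i < b ^ n | kp n i) cellI n i.
  rewrite -(bigcup_pred [pred i : 'I_(b ^ n) | kp n i] (fun i => cellI n i)).
  apply/seteqP; split => x.
    by move=> /(stageP D b1)[i ki xi]; exists (Ordinal (kept_lt b1 ki)).
  by move=> [i ki xi]; apply/(stageP D b1); exists (val i).
by apply: big_ind => [||i _]; [exact: closed0|exact: closedU|apply: (@interval_closed R)].
Qed.

Lemma cell_small (x e : R) : 0 < e -> exists n, forall i, cellI n i x ->
  forall y, cellI n i y -> `|x - y| < e.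
Proof.
move=> e0; have [n hn] := @inv_bpow_small e e0.
exists n => i; rewrite /cellI /= in_itv /= => /andP[x1 x2] y; rewrite in_itv /= => /andP[y1 y2].
have E : nd n i.+1 = nd n i + width R * (b ^ n)%:R^-1.
  by rewrite /node -[i.+1%:R]natr1; ring.
by rewrite E in x2 y2; rewrite ltr_norml; apply/andP; split; lra.
Qed.

(** The support is the limit set of the construction: outside a stage there is no
    mass, and every cell around a point of the limit set has positive mass. *)
Lemma msupportP x : msupport nu x <-> forall n, stage n x.
Proof.
split => [h n|h U oU Ux].
  apply: contrapT => nx.
  have := h (~` stage n) (closed_openC (@stage_closed n)) nx.
  rewrite probability_setC; last exact: measurable_stage.
  by rewrite (prE _ (@measurable_stage R b D n)) pr_stage1 subee // ltxx.
have /nbhs_ballP[e /= e0 he] := open_nbhs_nbhs (conj oU Ux).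
have [n hn] := cell_small x e0.
have /(stageP D b1)[i ki xi] := h n.
have h1 : cellI n i `<=` U by move=> y yi; apply: he; apply: (hn i).
apply: (@lt_le_trans _ _ (nu (cellI n i))).
  by rewrite (cell_measure b1 hnu ki) lte_fin invr_gt0 mpow_gt0.
apply: le_measure => //; rewrite inE.
  exact: measurable_cellI.
exact: measurable_realfun.open_measurable.
Qed.

Lemma msupportE : msupport nu = \bigcap_n stage n.
Proof. by apply/seteqP; split => x; [move=> /msupportP h n _|move=> h; apply/msupportP => n; apply: h]. Qed.

Lemma measurable_msupport : measurable (msupport nu : set (measurableTypeR R)).
Proof. by rewrite msupportE; apply: bigcap_measurable => // n _; apply: measurable_stage. Qed.

Lemma pr_msupport_setI (A : set R) : measurable (A : set (measurableTypeR R)) ->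
  pr nu (A `&` msupport nu) = pr nu A.
Proof.
move=> mA; have mS := measurable_msupport.
have mAS : measurable (A `&` msupport nu : set (measurableTypeR R)) by apply: measurableI.
have mAC : measurable (A `\` msupport nu : set (measurableTypeR R)) by apply: measurableD.
have null : nu.-negligible (~` msupport nu).
  rewrite msupportE setC_bigcap; apply: negligible_bigcup => n.
  have E : nu (~` stage n) = 0%E.
    rewrite probability_setC; last exact: measurable_stage.
    by rewrite (prE _ (@measurable_stage R b D n)) pr_stage1 subee.
  apply/negligibleP; first by apply: measurableC; apply: measurable_stage.
  exact: E.
have z : pr nu (A `\` msupport nu) = 0.
  apply: EFin_inj; rewrite -(prE _ mAC); apply/(negligibleP nu mAC).
  by apply: negligibleS null => x [].
rewrite -[in RHS](setUIDK A (msupport nu)).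
have disj : (A `&` msupport nu) `&` (A `\` msupport nu) = set0.
  by apply/seteqP; split => // x [[_ h] [_ ]].
by rewrite (prU _ mAS mAC disj) z addr0.
Qed.

Lemma msupport_sub : msupport nu `<=` [set x | 1 / 2 <= x <= 2].
Proof.
move=> x /msupportP/(_ 0%N)/(stageP D b1)[i /= /eqP ->].
rewrite /cellI /= in_itv /= /node /width /theta0 /theta1 expn0 => /andP[h1 h2].
by apply/andP; split; lra.
Qed.

End CantorSupport.

(** * The Hausdorff dimension of the support *)

Section CantorDimension.
Variable R : realType.
Variables (b : nat) (D : {set 'I_b}).
Variable nu : probability (measurableTypeR R) R.
Hypothesis b1 : (1 < b)%N.
Hypothesis D1 : (1 < #|D|)%N.
Hypothesis hnu : is_cantor_measure D nu.
Local Notation Dn := (digit_pred D).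
Local Notation kp := (kept b Dn).
Local Notation m := (digits b Dn).
Local Notation nd := (node b (theta0 R) (width R)).
Local Notation stage := (@stage R b D).
Local Notation cellI := (@cellI R b).

Definition similarity_dim : R := ln (#|D|%:R) / ln (b%:R).

Lemma lnb_gt0 : 0 < ln (b%:R : R).
Proof. by rewrite ln_gt0 // ltr1n. Qed.

Lemma similarity_dim_gt0 : 0 < similarity_dim.
Proof. by rewrite divr_gt0 ?lnb_gt0 // ln_gt0 // ltr1n. Qed.

Lemma bpow_similarity_dim n : (b ^ n)%:R `^ similarity_dim = (m ^ n)%:R :> R.
Proof.
have m0 : 0 < (m%:R : R) by rewrite ltr0n digits_card ltnW.
have b0 : 0 < (b%:R : R) by rewrite ltr0n ltnW.
rewrite !natrX -(powR_mulrn n (ltW b0)) -powRrM mulrC powRrM powR_mulrn ?powR_ge0 //.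
congr (_ ^+ _); rewrite /powR gt_eqF // /similarity_dim divfK ?gt_eqF ?lnb_gt0 //.
by rewrite digits_card in m0 *; rewrite lnK.
Qed.

Lemma pow_floor (X : R) : 1 <= X -> exists J, (b ^ J)%:R <= X < (b ^ J.+1)%:R.
Proof.
move=> X1; have X0 : 0 <= X by apply: le_trans X1.
have t0 : (0 < Num.truncn X)%N by rewrite truncn_gt0.
exists (trunc_log b (Num.truncn X)); apply/andP; split.
  by rewrite -truncn_ge_nat // trunc_logP.
apply: lt_le_trans (truncnS_gt _) _; rewrite ler_nat.
exact: trunc_log_ltn.
Qed.

(** The mass distribution principle: an interval of length comparable to [b ^ - n]
    meets at most three kept cells of stage [n]. *)
Lemma frostman x (r : R) : msupport nu x -> 0 <= r -> r <= 1 ->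
  pr nu `[x - r, x + r] <= 3 * #|D|%:R * r `^ similarity_dim.
Proof.
move=> Sx; rewrite le_eqVlt => /predU1P[<- _|r0 r1].
  by rewrite subr0 addr0 set_itv1 (pr_point b1 D1 hnu) mulr_ge0 ?powR_ge0 // mulr_ge0.
have /pow_floor[n /andP[n1 n2]] : 1 <= r^-1 by rewrite invf_ge1.
have bn0 := bpow_gt0 R b1 n.
have r2 : r < width R / (b ^ n)%:R.
  rewrite ltr_pdivlMr // -ltr_pdivlMl // mulrC.
  apply: le_lt_trans n1 _; rewrite ltr_pMl ?invr_gt0 //.
  by rewrite /width /theta1 /theta0; lra.
have /(stageP D b1)[i0 k0] := (msupportP b1 D1 hnu x).1 Sx n.
rewrite /cellI /= in_itv /= => /andP[x1 x2].
have nS i : nd n i.+1 = nd n i + width R / (b ^ n)%:R.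
  by rewrite /node -[i.+1%:R]natr1; ring.
(* [x] lies in the kept interval [i0], and [r] is smaller than the length of an
   interval of stage [n]. *)
pose near (i : nat) := (i <= i0 + 1)%N && (i0 <= i + 1)%N.
pose A := \big[setU/set0]_(i < b ^ n | kp n i && near i) @piece R b D n i.
have AE : A = \bigcup_(i in [set` [pred i : 'I_(b ^ n) | kp n i && near i]]) @piece R b D n i.
  by rewrite /A -(bigcup_pred [pred i : 'I_(b ^ n) | kp n i && near i] (fun i => @piece R b D n i)).
have mA : measurable (A : set (measurableTypeR R)).
  by apply: bigsetU_measurable => i _; apply: measurable_piece.
have mI : measurable (`[x - r, x + r]%classic : set (measurableTypeR R)) by apply: measurable_itv.
have prA : pr nu A <= 3 * (m ^ n)%:R^-1.
  have h : nu A = (\sum_(i < b ^ n | kp n i && near i) (pr nu (@piece R b D n i))%:E)%E.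
    rewrite /A (measure_bigsetU_ord_cond nu (F := fun i : 'I_(b ^ n) => @piece R b D n i)) //.
    - by apply: eq_bigr => i _; apply: prE; apply: measurable_piece.
    - by move=> i _; apply: measurable_piece.
    move=> i j /= /andP[ki _] /andP[kj _] [y [pi pj]].
    by apply: val_inj; apply: (piece_disjoint b1 D1 ki kj pi pj).
  rewrite /pr h sumEFin /=.
  rewrite (eq_bigr (fun=> (m ^ n)%:R^-1)) => [|i /andP[ki _]]; last exact: pr_piece_eq.
  rewrite sumr_const -[leLHS]mulr_natl ler_wpM2r ?invr_ge0 // ler_nat.
  have := @count_near b Dn b1 n 0 i0; rewrite addn0 expn0 muln1 sum1_card.
  by apply: leq_trans; apply: eq_leq; apply: eq_card => i; rewrite unfold_in /= -topredE /= -andbA.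
apply: le_trans (_ : pr nu A <= _).
  have mS := measurable_msupport b1 D1 hnu.
  rewrite -(pr_msupport_setI b1 D1 hnu) //; apply: (pr_le nu (measurableI _ _ mI mS) mA).
  move=> y [+ /(msupportP b1 D1 hnu)/(_ n)/(stage_pieceP D b1)[i ki pi]].
  rewrite AE /= in_itv /= => /andP[y1 y2].
  have : cellI n i y.
    by move: pi; rewrite /piece; case: ifP => // _; rewrite /cellI /= !in_itv /= => /andP[-> /ltW].
  rewrite /cellI /= in_itv /= => /andP[z1 z2].
  have hn : near i.
    rewrite /near; apply/andP; split; rewrite addn1 -ltnS -(lt_node R b1 n) !nS.
      by rewrite nS in x2; lra.
    by rewrite nS in z2; lra.
  by exists (Ordinal (kept_lt b1 ki)) => //; apply/andP.
apply: le_trans prA _; rewrite -mulrA ler_pM2l //.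
have mn0 := mpow_gt0 R D1.
rewrite -digits_card -[leLHS](@divfK _ m%:R); last by rewrite gt_eqF // -[m]expn1 mn0.
rewrite mulrC ler_wpM2l // -invfM -natrM mulnC -expnS -(bpow_similarity_dim n.+1) -powR_inv1 ?powR_ge0 //.
rewrite -powRrM mulrC powRrM; apply: ge0_ler_powR; rewrite ?nnegrE ?powR_ge0 ?(ltW similarity_dim_gt0) ?(ltW r0) //.
rewrite powR_inv1; last exact: ler0n.
by rewrite -[leRHS]invrK lef_pV2 ?posrE ?invr_gt0 ?bpow_gt0 // ltW.
Qed.

Lemma set_diam_ge0 (V : set R) : (0 <= set_diam V)%E.
Proof. by apply: ereal_sup_ubound; left. Qed.

Lemma le_set_diam (V : set R) x y : V x -> V y -> (`|x - y|%:E <= set_diam V)%E.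
Proof. by move=> Vx Vy; apply: ereal_sup_ubound; right; exists (x, y). Qed.

Lemma set_diam0 : set_diam (set0 : set R) = 0%E.
Proof.
apply/le_anti; rewrite set_diam_ge0 andbT; apply: ge_ereal_sup => _ [->//|[p [] []]].
Qed.

Lemma set_diam_itv (u v : R) : u <= v -> (set_diam `[u, v] <= (v - u)%:E)%E.
Proof.
move=> uv; apply: ge_ereal_sup => _ [->|[[x y] /= [] +] + <-].
  by rewrite lee_fin subr_ge0.
rewrite !in_itv /= => /andP[x1 x2] /andP[y1 y2]; rewrite lee_fin ler_norml.
by apply/andP; split; lra.
Qed.

Lemma powR_le_exponent (r s q : R) : 0 <= r -> r <= 1 -> s <= q -> 0 < q -> r `^ q <= r `^ s.
Proof.
rewrite le_eqVlt => /predU1P[<- _ _ q0|r0 r1 sq _].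
  by rewrite powR0 ?gt_eqF // powR_ge0.
by apply: ger_powR => //; rewrite r0 r1.
Qed.

(** A covering set that meets the support is replaced by an interval of twice its
    diameter; by [frostman] the content of a cover is then at least a constant times
    the mass it covers. *)
Lemma hausdorff_lower (s : R) : 0 <= s -> hausdorff_measure s (msupport nu) = 0%E -> similarity_dim <= s.
Proof.
move=> s0 h0; rewrite leNgt; apply/negP => sd.
pose c : R := 3 * #|D|%:R.
have c0 : 0 < c by rewrite mulr_gt0 // ltr0n ltnW.
have : (hausdorff_content s 1 (msupport nu) < c^-1%:E)%E.
  apply: (@le_lt_trans _ _ 0%E); last by rewrite lte_fin invr_gt0.
  by rewrite -h0; apply: ereal_sup_ubound; exists 1 => //=; apply: ltr01.
move=> /ereal_inf_lt[_ [U [SU dU] <-]] sumU.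
have : forall i, exists B : set R, [/\ measurable (B : set (measurableTypeR R)),
    U i `&` msupport nu `<=` B & (nu B <= c%:E * (set_diam (U i) `^ s))%E].
  move=> i; have [[x [Ux Sx]]|/nonemptyPn e] := pselect ((U i `&` msupport nu) !=set0); last first.
    by exists set0; rewrite e measure0; split => //; rewrite mule_ge0 ?poweR_ge0 // lee_fin ltW.
  have d0 := set_diam_ge0 (U i); have d1 := dU i.
  have [r rE] : exists r : R, set_diam (U i) = r%:E.
    exists (fine (set_diam (U i))); rewrite fineK // ge0_fin_numE //.
    by apply: le_lt_trans d1 _; apply: ltry.
  rewrite rE !lee_fin in d0 d1.
  exists `[x - r, x + r]%classic; split; first exact: measurable_itv.
    move=> y [Uy _]; have := le_set_diam Ux Uy; rewrite rE lee_fin ler_norml => /andP[? ?].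
    by rewrite /= in_itv /=; apply/andP; split; lra.
  rewrite (prE _ (measurable_itv _)) rE poweR_EFin -EFinM lee_fin.
  apply: le_trans (frostman Sx d0 d1) _; rewrite ler_pM2l //.
  by apply: powR_le_exponent => //; [exact: ltW|exact: similarity_dim_gt0].
move=> /choice[B hB].
have cover : msupport nu `<=` \bigcup_i B i.
  by move=> x Sx; have [i _ Ux] := SU _ Sx; exists i => //; have [_ + _] := hB i; apply.
have mB i : measurable (B i : set (measurableTypeR R)) by have [] := hB i.
have h1 := measure_sigma_subadditive nu mB (measurable_msupport b1 D1 hnu) cover.
have nuS : nu (msupport nu) = 1%E.
  rewrite (prE _ (measurable_msupport b1 D1 hnu)) -[msupport nu]setTI.
  by rewrite (pr_msupport_setI b1 D1 hnu) // /pr probability_setT.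
have : (1 < 1 :> \bar R)%E; last by rewrite ltxx.
rewrite -{1}nuS; apply: le_lt_trans h1 _.
apply: le_lt_trans (_ : (\sum_(0 <= i <oo) c%:E * (set_diam (U i) `^ s) < _)%E).
  by apply: lee_nneseries => i _; [by rewrite measure_ge0|have [] := hB i].
rewrite nneseriesZl; last by move=> *; apply: poweR_ge0.
apply: (@lt_le_trans _ _ (c%:E * c^-1%:E)%E); first by rewrite lte_pmul2l ?lte_fin.
by rewrite -EFinM divff // gt_eqF.
Qed.

(** Cover by the kept intervals of a late stage. *)
Lemma hausdorff_upper (s : R) : similarity_dim < s -> hausdorff_measure s (msupport nu) = 0%E.
Proof.
move=> ds; have s0 : 0 < s by apply: lt_trans ds; apply: similarity_dim_gt0.
apply/le_anti/andP; split; last first.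
  apply: le_ereal_sup_tmp; exists (hausdorff_content s 1 (msupport nu)); first by exists 1 => //=; apply: ltr01.
  apply: le_ereal_inf_tmp => _ [U _ <-]; apply: nneseries_ge0 => *; exact: poweR_ge0.
apply: ge_ereal_sup => _ [delta /= delta0 <-].
apply/lee_addgt0Pr => e e0; rewrite add0e.
(* The content of the cover of stage [n] is [width ^ s * q ^ n]. *)
pose q : R := #|D|%:R / b%:R `^ s.
have b0 : 0 < (b%:R : R) by rewrite ltr0n ltnW.
have bs0 : 0 < b%:R `^ s by rewrite powR_gt0.
have q01 : 0 <= q < 1.
  rewrite divr_ge0 ?powR_ge0 //= ltr_pdivrMr // mul1r.
  have := bpow_similarity_dim 1; rewrite !expn1 digits_card => <-.
  by rewrite /powR gt_eqF // ltr_expR ltr_pM2r ?lnb_gt0.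
have [k1 hk1] := geometric_small q01 (divr_gt0 e0 (powR_gt0 s (width_gt0 R))).
have [k2 hk2] := inv_bpow_small b1 delta0.
pose n := maxn k1 k2.
have bn0 := bpow_gt0 R b1 n.
pose x := width R * (b ^ n)%:R^-1.
have x0 : 0 <= x by rewrite mulr_ge0 ?invr_ge0 // ltW // width_gt0.
have xd : x <= delta.
  apply: le_trans (ltW hk2); rewrite ler_pM2l ?width_gt0 // lef_pV2 ?posrE ?bpow_gt0 //.
  by rewrite ler_nat leq_pexp2l ?leq_maxr // ltnW.
have mx : (m ^ n)%:R * x `^ s <= e.
  have E : (m ^ n)%:R * x `^ s = width R `^ s * q ^+ n.
    have F : (b ^ n)%:R^-1 `^ s = (b%:R `^ s) ^- n.
      rewrite -powR_inv1 ?(ltW bn0) // powRAC powR_inv1 ?powR_ge0 // natrX -powR_mulrn ?(ltW b0) //.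
      by rewrite powRAC powR_mulrn ?powR_ge0.
    rewrite /x powRM ?invr_ge0 ?(ltW bn0) ?(ltW (width_gt0 R)) // F /q digits_card expr_div_n natrX.
    by rewrite mulrCA.
  rewrite E mulrC -ler_pdivlMr ?powR_gt0 ?width_gt0 //; apply: le_trans hk1.
  have /andP[q0 q1] := q01; apply: ler_wiXn2l => //; [exact: ltW|exact: leq_maxl].
pose U i := if (i < b ^ n)%N && kp n i then cellI n i else set0.
have dU i : (set_diam (U i) <= (if (i < b ^ n)%N && kp n i then x else 0)%:E)%E.
  rewrite /U; case: ifP => _; last by rewrite set_diam0.
  have -> : x = nd n i.+1 - nd n i by rewrite /x /node -[i.+1%:R]natr1; ring.
  by apply: set_diam_itv; rewrite le_node.
apply: le_trans (_ : (\sum_(0 <= i <oo) set_diam (U i) `^ s <= _)%E).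
  apply: ereal_inf_lbound; exists U => //; split => [y|i].
    move=> /(msupportP b1 D1 hnu)/(_ n)/(stageP D b1)[i ki yi].
    by exists i => //; rewrite /U (kept_lt b1 ki) ki.
  by apply: le_trans (dU i) _; rewrite lee_fin; case: ifP => // _; apply: ltW.
have pU i : (set_diam (U i) `^ s <= (if (i < b ^ n)%N && kp n i then x `^ s else 0)%:E)%E.
  have -> : (if (i < b ^ n)%N && kp n i then x `^ s else 0) = (if (i < b ^ n)%N && kp n i then x else 0) `^ s.
    by case: ifP => _ //; rewrite powR0 // gt_eqF.
  rewrite -poweR_EFin; apply: gt0_ler_poweR; last exact: dU.
  - exact: ltW.
  - by rewrite in_itv /= set_diam_ge0 leey.
  - by rewrite in_itv /= leey andbT lee_fin; case: ifP.
rewrite (nneseries_split 0 (b ^ n)); last by move=> *; apply: poweR_ge0.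
rewrite eseries0; last first.
  by move=> i hi _; rewrite /U ltnNge hi set_diam0 poweR0r // gt_eqF.
rewrite adde0 add0n; apply: le_trans (_ : (\sum_(0 <= i < b ^ n) (if (i < b ^ n)%N && kp n i then x `^ s else 0)%:E <= _)%E).
  by apply: lee_sum => i _.
rewrite sumEFin lee_fin big_mkord -big_mkcondr /=.
apply: le_trans mx; rewrite -card_kept // natr_sum mulr_suml big_mkcond [leRHS]big_mkcond /=.
by apply: ler_sum => i _; rewrite ltn_ord mul1r.
Qed.

Theorem cantor_hausdorff_dim : hausdorff_dim (msupport nu) = similarity_dim%:E.
Proof.
apply/le_anti/andP; split; last first.
  by apply: le_ereal_inf_tmp => _ [s [s0 hs] <-]; rewrite lee_fin hausdorff_lower.
apply/lee_addgt0Pr => e e0; rewrite -EFinD; apply: ereal_inf_lbound; exists (similarity_dim + e) => //.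
by split; [rewrite addr_ge0 // ltW // similarity_dim_gt0|apply: hausdorff_upper; rewrite ltrDl].
Qed.

End CantorDimension.

(** * Averages over the kept intervals *)

Section CantorAverage.
Variable R : realType.
Local Notation C := (R[i]).
Local Notation nrm := (@Normc.normc R).
Variables (b : nat) (D : {set 'I_b}).
Variable nu : probability (measurableTypeR R) R.
Hypothesis b1 : (1 < b)%N.
Hypothesis D1 : (1 < #|D|)%N.
Hypothesis hnu : is_cantor_measure D nu.
Local Notation Dn := (digit_pred D).
Local Notation kp := (kept b Dn).
Local Notation m := (digits b Dn).
Local Notation nd := (node b (theta0 R) (width R)).
Local Notation S := (msupport nu).

Lemma node_in k i : (i < b ^ k)%N -> 1 / 2 <= nd k i <= 2.
Proof.
move=> ik; have b0 := bpow_gt0 R b1 k.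
have h0 : 0 <= i%:R / (b ^ k)%:R :> R by rewrite divr_ge0.
have h1 : i%:R / (b ^ k)%:R <= 1 :> R by rewrite ler_pdivrMr // mul1r ler_nat ltnW.
rewrite /node /width /theta0 /theta1; set x := _ / _ in h0 h1 *; apply/andP; split; lra.
Qed.

Variables (h : R -> R) (L : R).
Hypothesis L0 : 0 <= L.
Hypothesis hL : forall x y : R, 1 / 2 <= x <= 2 -> 1 / 2 <= y <= 2 -> `|h x - h y| <= L * `|x - y|.

(** Extends a function on [[1 / 2, 2]] to a continuous one on the line, which is
    then measurable. *)
Definition clamp (x : R) : R := if x < 1 / 2 then 1 / 2 else if 2 < x then 2 else x.

Lemma clamp_in x : 1 / 2 <= clamp x <= 2.
Proof.
rewrite /clamp; case: (ltrP x (1 / 2)) => h1; first by rewrite lexx /=; lra.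
by case: (ltrP 2 x) => h2; [rewrite lexx andbT; lra | rewrite h1].
Qed.

Lemma clamp_dist x y : `|clamp x - clamp y| <= `|x - y|.
Proof.
rewrite /clamp; case: (ltrP x (1 / 2)) => h1; case: (ltrP y (1 / 2)) => h2;
  case: (ltrP 2 x) => h3; case: (ltrP 2 y) => h4;
  rewrite ler_norml; have := ler_norm (x - y); have := ler_norm (y - x); rewrite distrC => ? ?;
  apply/andP; split; lra.
Qed.

Lemma measurable_lip : measurable_fun (S : set (measurableTypeR R)) h.
Proof.
have c : continuous (h \o clamp).
  move=> x; apply/cvgrPdist_lt => e e0.
  have L1 : 0 < L + 1 by move: L0; lra.
  have eL : 0 < e / (L + 1) by rewrite divr_gt0.
  near=> y; rewrite /=; apply: le_lt_trans (hL (clamp_in _) (clamp_in _)) _.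
  apply: le_lt_trans (ler_wpM2l L0 (clamp_dist _ _)) _.
  apply: (@le_lt_trans _ _ ((L + 1) * `|x - y|)).
    by rewrite ler_wpM2r //; lra.
  by rewrite mulrC -ltr_pdivlMr //; near: y; apply: cvgr_dist_lt.
have mc : measurable_fun (setT : set (measurableTypeR R)) (h \o clamp).
  exact: measurable_realfun.continuous_measurable_fun.
apply: (eq_measurable_fun (h \o clamp)); last exact: measurable_funTS mc.
move=> x; rewrite inE => /(msupport_sub b1 D1 hnu) /= /andP[x1 x2].
by rewrite /= /clamp !ltNge x1 x2.
Unshelve. all: by end_near. Qed.

Lemma bounded_lip x : 1 / 2 <= x <= 2 -> `|h x| <= `|h 1| + 2 * L.
Proof.
move=> hx; have := hL hx (_ : 1 / 2 <= 1 <= 2) => /(_ ltac:(lra)) h1.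
have h2 : `|x - 1| <= 2 by move/andP: hx => [? ?]; rewrite ler_norml; apply/andP; split; lra.
have h3 : `|h x| <= `|h x - h 1| + `|h 1| by rewrite -[X in `|X| <= _](subrK (h 1)) ler_normD.
have h4 : L * `|x - 1| <= L * 2 by rewrite ler_wpM2l.
by lra.
Qed.

Lemma integrable_lip (A : set R) : measurable (A : set (measurableTypeR R)) -> A `<=` S ->
  nu.-integrable A (EFin \o h).
Proof.
move=> mA AS; apply: (@measurable_bounded_integrable _ _ _ nu h A mA).
- have e : (nu A < +oo)%E by rewrite (prE nu mA) ltry.
  exact: e.
- exact: (measurable_funS (measurable_msupport b1 D1 hnu) AS measurable_lip).
exists (`|h 1| + 2 * L); split; first exact: num_real.
move=> M hM x /= Ax; apply: le_trans (ltW hM); apply: bounded_lip.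
exact: (msupport_sub b1 D1 hnu (AS _ Ax)).
Qed.

Definition average k (g : R -> R) : R := (m ^ k)%:R^-1 * \sum_(i < b ^ k | kp k i) g (nd k i).

(** The integral splits over the pieces of stage [k], on each of which [h] varies by
    at most [L] times the length. *)
Lemma average_close k :
  `|\int[nu]_(x in S) h x - average k h| <= L * (width R / (b ^ k)%:R).
Proof.
set w := width R / (b ^ k)%:R.
pose P i := @piece R b D k i `&` S.
have mP i : measurable (P i : set (measurableTypeR R)).
  by apply: measurableI; [exact: measurable_piece|exact: (measurable_msupport b1 D1 hnu)].
have PS i : P i `<=` S by move=> x [].
pose s := [seq i <- index_iota 0 (b ^ k) | kp k i].
have us : uniq s by rewrite filter_uniq // iota_uniq.
have tP : trivIset [set` s] P.
  move=> i j /=; rewrite !mem_filter => /andP[ki _] /andP[kj _] [x [[pi _] [pj _]]].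
  exact: (piece_disjoint b1 D1 ki kj pi pj).
have SE : \big[setU/set0]_(i <- s) P i = S.
  rewrite -bigcup_seq; apply/seteqP; split => [x [i _ []//]|x Sx].
  have /(stage_pieceP D b1)[i ki pi] := (msupportP b1 D1 hnu x).1 Sx k.
  by exists i => //=; rewrite mem_filter ki mem_index_iota (kept_lt b1 ki).
have hP i : `|\int[nu]_(x in P i) h x - h (nd k i) * pr nu (P i)| <= L * w * pr nu (P i) \/ ~~ kp k i.
  have [ki|] := boolP (kp k i); last by right.
  left; rewrite -Rintegral_cst // -RintegralB //; first last.
  - exact: finite_measure_integrable_cst.
  - exact: integrable_lip.
  have ihc : nu.-integrable (P i) (EFin \o (fun x => h x - h (nd k i))).
    apply: (@eq_integrable _ _ _ nu _ (mP i) ((EFin \o h) \- (EFin \o cst (h (nd k i))))%E) => //.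
    by apply: integrableB => //; [exact: integrable_lip|exact: finite_measure_integrable_cst].
  apply: le_trans (le_normr_Rintegral _ ihc) _ => //.
  rewrite -Rintegral_cst //; apply: le_Rintegral => //.
  - exact: integrable_norm.
  - exact: finite_measure_integrable_cst.
  move=> x [pi Sx]; apply: le_trans (hL _ _) _.
  - exact: (msupport_sub b1 D1 hnu Sx).
  - by apply: node_in; apply: kept_lt ki.
  rewrite ler_wpM2l //.
  have : @cellI R b k i x.
    by move: pi; rewrite /piece; case: ifP => // _; rewrite /cellI /= !in_itv /= => /andP[-> /ltW].
  rewrite /cellI /= in_itv /= => /andP[x1 x2].
  have nS : nd k i.+1 = nd k i + w by rewrite /node /w -[i.+1%:R]natr1; ring.
  by rewrite nS in x2; rewrite ger0_norm ?subr_ge0 //; lra.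
have prP i : kp k i -> pr nu (P i) = (m ^ k)%:R^-1.
  move=> ki; rewrite /P (pr_msupport_setI b1 D1 hnu); last exact: measurable_piece.
  by rewrite (pr_piece_eq b1 D1 hnu ki).
have intE : \int[nu]_(x in S) h x = \sum_(i <- s) \int[nu]_(x in P i) h x.
  rewrite /Rintegral -[in LHS]SE (integral_bigsetU_EFin nu mP us tP).
    by rewrite -sum_fine // => i _; apply: integrable_fin_num => //; apply: integrable_lip.
  rewrite SE; apply/measurable_realfun.measurable_EFinP; exact: measurable_lip.
have avE : average k h = \sum_(i <- s) h (nd k i) * pr nu (P i).
  rewrite /average big_filter big_mkord mulr_sumr; apply: eq_bigr => i ki.
  by rewrite prP // mulrC.
rewrite intE avE -sumrB; apply: le_trans (ler_norm_sum _ _ _) _.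
apply: le_trans (_ : \sum_(i <- s) L * w * pr nu (P i) <= _).
  rewrite big_seq [leRHS]big_seq; apply: ler_sum => i; rewrite mem_filter => /andP[ki _].
  by case: (hP i) => //; rewrite ki.
rewrite -mulr_sumr big_filter big_mkord (eq_bigr (fun=> (m ^ k)%:R^-1)) => [|i ki]; last exact: prP.
rewrite (_ : \sum_(i < b ^ k | kp k i) _ = 1) ?mulr1 //.
transitivity (\sum_(i < b ^ k | kp k i) (1 : R) / (m ^ k)%:R); first by apply: eq_bigr => i _; rewrite div1r.
have ck : (m ^ k)%:R = \sum_(i < b ^ k | kp k i) 1 :> R by rewrite -card_kept // natr_sum.
by rewrite -mulr_suml -ck divff // gt_eqF // mpow_gt0.
Qed.

End CantorAverage.

(** * The Cantor Dirichlet series on the critical line *)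

Lemma harmonic_le (R : realType) (N : nat) :
  \sum_(n < N.+1) (n.+1%:R : R)^-1 <= 1 + ln N.+1%:R.
Proof.
elim: N => [|N IH]; first by rewrite big_ord1 ln1 addr0 invr1.
have h1 : 0 < N.+1%:R :> R by rewrite ltr0n.
have h2 : N.+1%:R <= N.+2%:R :> R by rewrite ler_nat.
have := ln_ratio_ge h1 h2; have -> : N.+2%:R - N.+1%:R = 1 :> R by rewrite -[N.+2%:R]natr1; ring.
rewrite big_ord_recr /= div1r => h3; apply: le_trans (lerD IH (lexx _)) _.
by rewrite -addrA lerD2l addrC -lerBrDr.
Qed.

Section CantorSeries.
Variable R : realType.
Local Notation C := (R[i]).
Local Notation nrm := (@Normc.normc R).
Variables (b : nat) (D : {set 'I_b}).
Variable nu : probability (measurableTypeR R) R.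
Hypothesis b1 : (1 < b)%N.
Hypothesis D1 : (1 < #|D|)%N.
Hypothesis hnu : is_cantor_measure D nu.
Variable F : R -> C -> C.
Hypothesis hF : is_periodic_zeta F.
Local Notation Dn := (digit_pred D).
Local Notation kp := (kept b Dn).
Local Notation m := (digits b Dn).
Local Notation nd := (node b (theta0 R) (width R)).
Local Notation cf := (coef b Dn (theta0 R) (width R)).

Definition caverage k (g : R -> C) : C :=
  ((m ^ k)%:R^-1)%:C%C * \sum_(i < b ^ k | kp k i) g (nd k i).

Lemma Re_caverage k g : complex.Re (caverage k g) = average D k (fun x => complex.Re (g x)).
Proof. by rewrite /caverage /average -Re_sum; case: (\sum_(_ < _ | _) _) => x y /=; rewrite mul0r subr0. Qed.

Lemma Im_caverage k g : complex.Im (caverage k g) = average D k (fun x => complex.Im (g x)).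
Proof. by rewrite /caverage /average -Im_sum; case: (\sum_(_ < _ | _) _) => x y /=; rewrite mul0r addr0. Qed.

Lemma caverageB k g h : caverage k (fun x => g x - h x) = caverage k g - caverage k h.
Proof. by rewrite /caverage sumrB mulrBr. Qed.

Lemma nrm_caverage_le k g (M : R) :
  (forall x : R, 1 / 2 <= x <= 2 -> nrm (g x) <= M) -> nrm (caverage k g) <= M.
Proof.
move=> hM; have mk := mpow_gt0 R D1 k.
rewrite /caverage nrmM nrm_real ger0_norm ?invr_ge0 ?(ltW mk) // mulrC ler_pdivrMr //.
apply: le_trans (nrm_sum _ _ _) _; rewrite -card_kept // natr_sum mulr_sumr.
by apply: ler_sum => i _; rewrite mulr1; apply: hM; apply: node_in.
Qed.

(** A bound that is uniform in the stage passes to the limit: the Lipschitz constant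
    of [F] depends on [t] in an uncontrolled way, but only [k] tends to infinity. *)
Lemma cantor_L_le t (M : R) k0 :
  (forall k, (k0 <= k)%N -> nrm (caverage k (F^~ (Complex (1 / 2) t))) <= M) ->
  nrm (cantor_L F nu (Complex (1 / 2) t)) <= M.
Proof.
move=> hM; set s := Complex (1 / 2) t in hM *.
have h12 : 0 < 1 / 2 :> R by lra.
have [L L0 hL] := F_lipschitz hF t h12.
have p2 := @pi_ge2 R.
have hin (x : R) : 1 / 2 <= x <= 2 -> 1 / 2 <= x <= 2 * pi - 1 / 2.
  by move=> /andP[? ?]; apply/andP; split; lra.
have hL' (x y : R) : 1 / 2 <= x <= 2 -> 1 / 2 <= y <= 2 -> nrm (F x s - F y s) <= L * `|x - y|.
  by move=> /hin hx /hin hy; apply: hL.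
have hRe (x y : R) : 1 / 2 <= x <= 2 -> 1 / 2 <= y <= 2 ->
    `|complex.Re (F x s) - complex.Re (F y s)| <= L * `|x - y|.
  by move=> hx hy; apply: le_trans (hL' x y hx hy); rewrite -ReB nrm_Re.
have hIm (x y : R) : 1 / 2 <= x <= 2 -> 1 / 2 <= y <= 2 ->
    `|complex.Im (F x s) - complex.Im (F y s)| <= L * `|x - y|.
  by move=> hx hy; apply: le_trans (hL' x y hx hy); rewrite -ImB nrm_Im.
apply/ler_addgt0Pr => e e0.
have e1 : 0 < e / (2 * L + 1) by rewrite divr_gt0 //; lra.
have [k1 hk1] := inv_bpow_small b1 e1.
pose k := maxn k0 k1.
have hk : width R / (b ^ k)%:R <= e / (2 * L + 1).
  apply: le_trans (ltW hk1); rewrite ler_pM2l ?width_gt0 // lef_pV2 ?posrE ?bpow_gt0 //.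
  by rewrite ler_nat leq_pexp2l ?leq_maxr // ltnW.
have aRe := average_close b1 D1 hnu L0 hRe k.
have aIm := average_close b1 D1 hnu L0 hIm k.
rewrite -Re_caverage in aRe; rewrite -Im_caverage in aIm.
set I := cantor_L F nu s; set A := caverage k (F^~ s) in aRe aIm.
have -> : I = A + (I - A) by rewrite addrC subrK.
apply: le_trans (nrmD _ _) _; apply: lerD; first by apply: hM; rewrite leq_maxl.
apply: le_trans (nrm_ReIm _) _; rewrite ReB ImB.
apply: le_trans (lerD aRe aIm) _.
apply: le_trans (_ : L * (e / (2 * L + 1)) + L * (e / (2 * L + 1)) <= _).
  by apply: lerD; rewrite ler_wpM2l.
have -> : L * (e / (2 * L + 1)) + L * (e / (2 * L + 1)) = 2 * L / (2 * L + 1) * e by ring.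
rewrite ler_piMl ?(ltW e0) // ler_pdivrMr; last by lra.
by lra.
Qed.

Hypothesis mb : (#|D| <= b)%N.

Lemma caverage_pz k (t : R) N :
  caverage k (fun x => pz_sum x t (1 / 2) N) =
  \sum_(n < N) dpow t (1 / 2) n.+1%:R * (((m ^ k)%:R^-1)%:C%C * cf k n.+1%:R).
Proof.
rewrite /caverage /pz_sum exchange_big /= mulr_sumr; apply: eq_bigr => n _.
by rewrite -mulr_suml mulrA mulrC.
Qed.

Definition strichartz_constant : R := 12 + 192 * b%:R ^+ 2 / width R ^+ 2.

Lemma mean_square J k : (J <= k)%N ->
  \sum_(n < (b ^ J).-1) nrm (((m ^ k)%:R^-1)%:C%C * cf k n.+1%:R) ^+ 2 <=
  strichartz_constant * ((b ^ J)%:R / (m ^ J)%:R).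
Proof.
move=> Jk; have mk := mpow_gt0 R D1 k; have mJ := mpow_gt0 R D1 J.
have mD : (1 < m)%N by rewrite digits_card.
have mb' : (m <= b)%N by rewrite digits_card.
have := strichartz b1 (theta0 R) (width_gt0 R) (width_le2 R) mD mb' Jk.
rewrite -/strichartz_constant => h.
have N1 : ((b ^ J).-1.+1 = b ^ J)%N by rewrite prednK // expn_gt0 ltnW.
apply: le_trans (_ : (m ^ k)%:R ^- 2 * \sum_(n < b ^ J) nrm (cf k n%:R) ^+ 2 <= _).
  rewrite -[X in \sum_(n < X) nrm (cf k n%:R) ^+ 2]N1 big_ord_recl /= mulrDr ler_wpDl //.
    by rewrite mulr_ge0 ?exprn_ge0 ?nrm_ge0 // invr_ge0 exprn_ge0 // ltW.
  rewrite mulr_sumr; apply: ler_sum => n _.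
  by rewrite nrmM nrm_real ger0_norm ?invr_ge0 ?(ltW mk) // exprMn exprVn.
rewrite ler_pdivrMl ?exprn_gt0 //; apply: le_trans h _.
have E : (m ^ k)%:R = (m ^ J)%:R * (m ^ (k - J))%:R :> R by rewrite -natrM -expnD subnKC.
rewrite natrM E le_eqVlt; apply/orP; left; apply/eqP; field.
by rewrite gt_eqF.
Qed.

(** Cauchy-Schwarz in the form of the arithmetic-geometric mean inequality, with the
    weight [lam] left free. *)
Lemma main_sum J k (t lam : R) : (J <= k)%N -> 0 < lam ->
  nrm (caverage k (fun x => pz_sum x t (1 / 2) (b ^ J).-1)) <=
  (lam * (1 + ln (b ^ J)%:R) + lam^-1 * (strichartz_constant * ((b ^ J)%:R / (m ^ J)%:R))) / 2.
Proof.
move=> Jk lam0; rewrite caverage_pz.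
apply: le_trans (nrm_sum _ _ _) _.
pose c n := nrm (((m ^ k)%:R^-1)%:C%C * cf k n.+1%:R).
apply: le_trans (_ : \sum_(n < (b ^ J).-1) (lam * n.+1%:R^-1 + lam^-1 * c n ^+ 2) / 2 <= _).
  apply: ler_sum => n _; rewrite nrmM nrm_dpow ?ltr0n // inv_sqrt_pow // -/(c n).
  set u := (Num.sqrt _)^-1.
  have -> : n.+1%:R^-1 = u ^+ 2 :> R by rewrite exprVn sqr_sqrtr.
  have -> : lam * u ^+ 2 + lam^-1 * c n ^+ 2 = lam^-1 * (lam * u - c n) ^+ 2 + 2 * (u * c n).
    by field; rewrite gt_eqF.
  rewrite ler_pdivlMr // [leLHS]mulrC lerDr mulr_ge0 ?sqr_ge0 // invr_ge0 ltW //.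
rewrite -mulr_suml ler_pM2r ?invr_gt0 // big_split /= -!mulr_sumr; apply: lerD.
  rewrite ler_pM2l //; have N1 : ((b ^ J).-1.+1 = b ^ J)%N by rewrite prednK // expn_gt0 ltnW.
  apply: le_trans (_ : \sum_(n < (b ^ J).-1.+1) n.+1%:R^-1 <= _); last by rewrite -[in leRHS]N1 harmonic_le.
  by rewrite big_ord_recr /= lerDl invr_ge0.
by rewrite ler_pM2l ?invr_gt0 // mean_square.
Qed.

Local Notation d := (similarity_dim R D).
Local Notation beta := ((1 - d) / (2 * (2 - d))).

Hypothesis d1 : d < 1.

(** [N = b ^ J] is the power of [b] next below [|t| ^ (1 / (2 - d))], which balances
    [sqrt (|t| / N)] and [N ^ ((1 - d) / 2)]. *)
Lemma cantor_L_bound (K eps : R) : tail_constant K -> 0 < eps ->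
  exists B T : R, forall t, T <= `|t| ->
    nrm (cantor_L F nu (Complex (1 / 2) t)) <= B * `|t| `^ (beta + eps).
Proof.
move=> hK e0; have [K0 _] := hK; have hd1 : d < 1 := d1; have d0 : 0 < d := similarity_dim_gt0 R b1 D1.
have b0 : 0 < b%:R :> R by rewrite ltr0n ltnW.
have C0 : 0 <= strichartz_constant.
  by rewrite /strichartz_constant addr_ge0 // divr_ge0 ?sqr_ge0 // mulr_ge0 ?sqr_ge0.
have be0 : 0 <= beta by rewrite divr_ge0 //; lra.
pose H : R := 1 + (2 * eps)^-1.
exists ((H + strichartz_constant) / 2 + K * (b%:R + (Num.sqrt (1 / 2))^-1)).
exists (1 + (b%:R ^+ 2) `^ ((2 - d) / d)) => t tT.
set a := `|t| in tT *.
have a1 : 1 <= a by apply: le_trans tT; rewrite lerDl powR_ge0.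
have a0 : 0 < a by apply: lt_le_trans a1.
have aD x y : a `^ (x + y) = a `^ x * a `^ y by rewrite powRD // (gt_eqF a0) implybT.
have dn : d != 0 by rewrite gt_eqF.
have d2n : 2 - d != 0 by rewrite gt_eqF //; lra.
pose p : R := (2 - d)^-1; pose X := a `^ p.
have p0 : 0 < p by rewrite invr_gt0; lra.
have p1 : p <= 1 by rewrite invf_le1; lra.
have X1 : 1 <= X by rewrite -[leLHS](powRr0 a) ler_powR // ltW.
have X0 : 0 < X by apply: lt_le_trans X1.
have Xa : X <= a by rewrite -[leRHS]powRr1 ?(ltW a0) // ler_powR.
have [J /andP[J1 J2]] := pow_floor b1 X1.
set N := (b ^ J)%:R in J1.
have N0 : 0 < N := bpow_gt0 R b1 J.
have XN : X <= b%:R * N by rewrite -natrM -expnS ltW.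
have N1 : ((b ^ J).-1.+1 = b ^ J)%N by rewrite prednK // expn_gt0 ltnW.
(* [N ^ 2 >= X ^ 2 / b ^ 2], and [X ^ 2 = a ^ (d / (2 - d)) * a] beats [b ^ 2 * a] for
   [a] beyond the chosen threshold. *)
have aN : a <= (b ^ J).-1.+1%:R ^+ 2.
  rewrite N1 -/N.
  have h1 : b%:R ^+ 2 <= a `^ (d * p).
    have h : (b%:R ^+ 2) `^ ((2 - d) / d) <= a by lra.
    have := @ge0_ler_powR R (d * p) _ _ _ _ _ h; rewrite ?nnegrE => /(_ _ _ _); move=> /(_ ltac:(by rewrite mulr_ge0 // ltW) ltac:(exact: powR_ge0) ltac:(exact: ltW)).
    rewrite -powRrM (_ : (2 - d) / d * (d * p) = 1) ?powRr1 ?sqr_ge0 //.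
    by rewrite /p; field; rewrite dn d2n.
  have h2 : X ^+ 2 = a `^ (d * p) * a.
    rewrite -[X in _ * X]powRr1 ?(ltW a0) // -aD /X expr2 -aD; congr (_ `^ _).
    by rewrite /p; field; rewrite d2n.
  have h3 : X ^+ 2 <= b%:R ^+ 2 * N ^+ 2 by rewrite -exprMn ler_pXn2r // nnegrE ?mulr_ge0 // ltW.
  have h4 : b%:R ^+ 2 * a <= b%:R ^+ 2 * N ^+ 2.
    by apply: le_trans h3; rewrite h2 ler_wpM2r // ltW.
  by rewrite ler_pM2l ?exprn_gt0 in h4.
have b2E : a `^ (2 * beta) = (a `^ beta) ^+ 2 by rewrite mulrC powRrM powR_mulrn ?powR_ge0.
have bb : 2 * beta = (1 - d) * p by rewrite /p; field; rewrite d2n.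
have tail : Num.sqrt a / Num.sqrt (b ^ J).-1.+1%:R <= b%:R * a `^ beta.
  rewrite N1 -/N -sqrtrV ?(ltW N0) // -sqrtrM ?(ltW a0) //.
  rewrite -[leRHS]ger0_norm ?mulr_ge0 ?powR_ge0 ?(ltW b0) // -sqrtr_sqr ler_wsqrtr //.
  rewrite ler_pdivrMr // exprMn -b2E bb.
  have h1 : a = X * a `^ ((1 - d) * p).
    rewrite -[LHS]powRr1 ?(ltW a0) // /X -aD; congr (_ `^ _); by rewrite /p; field; rewrite d2n.
  rewrite {1}h1; have h2 : X * a `^ ((1 - d) * p) <= b%:R * N * a `^ ((1 - d) * p).
    by rewrite ler_wpM2r ?powR_ge0.
  apply: le_trans h2 _; set Y := a `^ _.
  have Y0 : 0 <= Y by apply: powR_ge0.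
  have -> : b%:R ^+ 2 * Y * N = b%:R * (b%:R * N * Y) by ring.
  by rewrite ler_peMl ?mulr_ge0 ?(ltW N0) // ler1n ltnW.
have ratio : N / (digits b Dn ^ J)%:R <= a `^ (2 * beta).
  rewrite -(bpow_similarity_dim R b1 D1) -/N.
  have -> : N / N `^ d = N `^ (1 - d).
    by rewrite powRB ?powRr1 ?(ltW N0) // (gt_eqF N0) implybT.
  rewrite bb mulrC powRrM; apply: ge0_ler_powR; rewrite ?nnegrE ?(ltW N0) ?(ltW X0) //; lra.
(* The logarithm is absorbed by [a ^ (2 eps)]. *)
have lnN : 1 + ln N <= H * a `^ (2 * eps).
  have h1 : ln N <= ln a by rewrite ler_ln ?posrE //; apply: le_trans Xa.
  have h2 : 2 * eps * ln a <= a `^ (2 * eps).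
    rewrite -ln_powR; apply: ltW; apply: ln_sublinear; exact: powR_gt0.
  have h3 : 1 <= a `^ (2 * eps) by rewrite -[leLHS](powRr0 a) ler_powR //; lra.
  have h4 : ln a <= (2 * eps)^-1 * a `^ (2 * eps) by rewrite ler_pdivlMl //; lra.
  by rewrite /H mulrDl mul1r; lra.
apply: (@cantor_L_le t _ J) => k Jk.
set P := fun x => pz_sum x t (1 / 2) (b ^ J).-1.
have -> : caverage k (F^~ (Complex (1 / 2) t)) =
   caverage k P + caverage k (fun x => F x (Complex (1 / 2) t) - P x).
  by rewrite caverageB addrC subrK.
apply: le_trans (nrmD _ _) _; rewrite mulrDl; apply: lerD.
  (* This weight equalizes the two terms of [main_sum]. *)
  have lam0 : 0 < a `^ (beta - eps) by apply: powR_gt0.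
  apply: le_trans (main_sum t Jk lam0) _; rewrite -/N [leRHS]mulrAC ler_pM2r ?invr_gt0 // [leRHS]mulrDl; apply: lerD.
    have -> : a `^ (beta + eps) = a `^ (beta - eps) * a `^ (2 * eps) by rewrite -aD; congr (_ `^ _); ring.
    by rewrite mulrCA ler_pM2l.
  have -> : a `^ (beta + eps) = (a `^ (beta - eps))^-1 * a `^ (2 * beta).
    by rewrite -powRN -aD; congr (_ `^ _); lra.
  by rewrite [leRHS]mulrCA ler_pM2l ?invr_gt0 // ler_wpM2l.
apply: nrm_caverage_le => x hx; have p2 := @pi_ge2 R.
have h12 : 0 < 1 / 2 :> R by lra.
have hx' : 1 / 2 <= x <= 2 * pi - 1 / 2 by move/andP: hx => [? ?]; apply/andP; split; lra.
apply: le_trans (F_approx hF hK a1 h12 hx' aN) _; rewrite -mulrA ler_wpM2l // mulrDl.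
apply: lerD.
  by apply: le_trans tail _; rewrite ler_pM2l // ler_powR //; lra.
rewrite ler_peMr ?invr_ge0 ?sqrtr_ge0 // -[leLHS](powRr0 a) ler_powR //; lra.
Qed.

Theorem cantor_subconvexity : (lindelof (cantor_L F nu) (1 / 2) <= beta%:E)%E.
Proof.
have d0 := similarity_dim_gt0 R b1 D1; have [K hK] := tail_constant_exists R.
by apply: lindelof_le => [|eps e0]; [rewrite divr_ge0 //; move: d1; lra|exact: cantor_L_bound hK e0].
Qed.

Theorem cantor_hurwitz_bound (zeta : C -> R -> C) (mu : R) :
  is_hurwitz_zeta zeta -> hurwitz_exponent zeta mu ->
  (lindelof (cantor_L F nu) (1 / 2) <= mu%:E)%E.
Proof.
move=> hz hmu.
have mu0 : 0 <= mu.
  rewrite leNgt; apply/negP => mu0.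
  have e0 : 0 < - mu / 2 by rewrite divr_gt0 // oppr_gt0.
  have [B [T hB]] := F_le_exponent hF hz hmu e0.
  apply: (F1_not_decaying hF (B := B) (T0 := T) e0) => t tT.
  rewrite (_ : - (- mu / 2) = mu + - mu / 2); last by lra.
  by apply: hB => //; apply/andP; split; lra.
apply: lindelof_le => // eps e0; have [B [T hB]] := F_le_exponent hF hz hmu e0.
exists B, T => t tT; apply: (@cantor_L_le t _ 0) => k _.
by apply: nrm_caverage_le => x hx; apply: hB.
Qed.

End CantorSeries.

(** * Numerical values and conclusion *)

Section Numerics.
Variable R : realType.

(** Comparing [ln a / ln b] with a fraction amounts to comparing powers. *)
Lemma ln_ratio_gt_frac (a b p q : nat) : (1 < a)%N -> (1 < b)%N -> (0 < q)%N ->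
  (b%:R : R) ^+ p < a%:R ^+ q -> p%:R / q%:R < ln a%:R / ln b%:R :> R.
Proof.
move=> a1 b1 q0 h.
have a0 : 0 < a%:R :> R by rewrite ltr0n ltnW.
have b0 : 0 < b%:R :> R by rewrite ltr0n ltnW.
have l0 : 0 < ln (b%:R : R) by rewrite ln_gt0 // ltr1n.
have : ln ((b%:R : R) ^+ p) < ln (a%:R ^+ q) by rewrite ltr_ln ?posrE ?exprn_gt0.
rewrite !lnXn // -![ln _ *+ _]mulr_natr => h2.
by rewrite ltr_pdivlMr // mulrAC ltr_pdivrMr ?ltr0n // mulrC.
Qed.

Lemma ln_ratio_lt_frac (a b p q : nat) : (1 < a)%N -> (1 < b)%N -> (0 < q)%N ->
  (a%:R : R) ^+ q < b%:R ^+ p -> ln a%:R / ln b%:R < p%:R / q%:R :> R.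
Proof.
move=> a1 b1 q0 h.
have a0 : 0 < a%:R :> R by rewrite ltr0n ltnW.
have b0 : 0 < b%:R :> R by rewrite ltr0n ltnW.
have l0 : 0 < ln (b%:R : R) by rewrite ln_gt0 // ltr1n.
have : ln ((a%:R : R) ^+ q) < ln (b%:R ^+ p) by rewrite ltr_ln ?posrE ?exprn_gt0.
rewrite !lnXn // -![ln _ *+ _]mulr_natr => h2.
by rewrite ltr_pdivrMr // mulrAC ltr_pdivlMr ?ltr0n // [ltRHS]mulrC.
Qed.

Lemma ternary_dim_bounds : (41 / 65 : R) < (ln 2 / ln 3 : R) < 53 / 84.
Proof.
apply/andP; split.
  by apply: ln_ratio_gt_frac => //; lra.
by apply: ln_ratio_lt_frac => //; lra.
Qed.

Lemma quinary_dim_bounds : (43 / 52 : R) < (ln 5 / ln 7 : R) < 67 / 81.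
Proof.
apply/andP; split.
  by apply: ln_ratio_gt_frac => //; lra.
by apply: ln_ratio_lt_frac => //; lra.
Qed.

End Numerics.

Lemma decreasing_exponent (R : realType) (x y : R) : x <= y -> y < 2 ->
  (1 - y) / (2 * (2 - y)) <= (1 - x) / (2 * (2 - x)).
Proof.
move=> xy y2; rewrite ler_pdivrMr; last by lra.
rewrite mulrAC ler_pdivlMr; last by lra.
by rewrite -subr_ge0 (_ : _ - _ = 2 * (y - x)); [lra|ring].
Qed.

Section CantorSets.
Variables (R : realType) (F : R -> R[i] -> R[i]) (nu : probability (measurableTypeR R) R).
Hypothesis hF : is_periodic_zeta F.

Lemma cantor_set_facts (b : nat) (D : {set 'I_b}) :
  (1 < #|D| < b)%N -> is_cantor_measure D nu ->
  let d := ln (#|D|%:R) / ln (b%:R) : R in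
  [/\ d < 1, hausdorff_dim (msupport nu) = d%:E &
      (lindelof (cantor_L F nu) (1 / 2) <= ((1 - d) / (2 * (2 - d)))%:E)%E].
Proof.
move=> /andP[D1 Db] hnu d; have b1 : (1 < b)%N := ltn_trans D1 Db.
have d1 : d < 1.
  rewrite /d ltr_pdivrMr ?ln_gt0 ?ltr1n // mul1r ltr_ln ?posrE ?ltr0n ?ltr_nat //; exact: ltnW.
split => //; first exact: cantor_hausdorff_dim.
exact: (cantor_subconvexity b1 D1 hnu hF (ltnW Db)).
Qed.

Lemma ternary_facts : is_ternary_cantor nu ->
  let d := ln 2 / ln 3 : R in
  [/\ d < 1, hausdorff_dim (msupport nu) = d%:E &
      (lindelof (cantor_L F nu) (1 / 2) <= ((1 - d) / (2 * (2 - d)))%:E)%E].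
Proof.
move=> h; have D2 : #|[set ord0; ord_max]%SET : {set 'I_3}| = 2 by rewrite cards2.
by have := cantor_set_facts _ h; rewrite D2; apply.
Qed.

Lemma quinary_facts : is_5_of_7_cantor nu ->
  let d := ln 5 / ln 7 : R in
  [/\ d < 1, hausdorff_dim (msupport nu) = d%:E &
      (lindelof (cantor_L F nu) (1 / 2) <= ((1 - d) / (2 * (2 - d)))%:E)%E].
Proof.
move=> [D D5 h]; by have := cantor_set_facts _ h; rewrite D5; apply.
Qed.

Lemma hurwitz_branch (zeta : R[i] -> R -> R[i]) (mu : R) :
  is_hurwitz_zeta zeta -> hurwitz_exponent zeta mu -> is_ternary_cantor nu \/ is_5_of_7_cantor nu ->
  (lindelof (cantor_L F nu) (1 / 2) <= mu%:E)%E.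
Proof.
move=> hz hmu [h|[D D5 h]].
  have D2 : #|[set ord0; ord_max]%SET : {set 'I_3}| = 2 by rewrite cards2.
  by apply: (cantor_hurwitz_bound _ _ h hF hz hmu); rewrite ?D2.
by apply: (cantor_hurwitz_bound _ _ h hF hz hmu); rewrite ?D5.
Qed.

End CantorSets.

Theorem theorem9p12 (R : realType)
    (F : R -> R[i] -> R[i]) (zeta : R[i] -> R -> R[i])
    (hF : is_periodic_zeta F) (hzeta : is_hurwitz_zeta zeta) :
  [/\ forall mu_zeta : R, hurwitz_exponent zeta mu_zeta ->
        forall nu : probability (measurableTypeR R) R,
          is_ternary_cantor nu \/ is_5_of_7_cantor nu ->
          let d := cantor_dim nu in
          (lindelof (cantor_L F nu) (1 / 2) <=
             (if dstar mu_zeta <= d then (1 - d) / (2 * (2 - d))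
              else mu_zeta)%:E)%E,
      dstar (13 / 84) = 16 / 29 :> R /\
        `|16 / 29 - 552 / 1000 : R| <= 5 / 10 ^+ 4,
      forall nu : probability (measurableTypeR R) R, is_ternary_cantor nu ->
        let d := ln 2 / ln 3 in
        [/\ hausdorff_dim (msupport nu) = d%:E,
            `|d - 631 / 1000| <= 5 / 10 ^+ 4,
            dstar (13 / 84) <= d,
            (lindelof (cantor_L F nu) (1 / 2) <=
               ((1 - d) / (2 * (2 - d)))%:E)%E &
            `|(1 - d) / (2 * (2 - d)) - 1348 / 10 ^+ 4| <= 5 / 10 ^+ 5] &
      forall nu : probability (measurableTypeR R) R, is_5_of_7_cantor nu ->
        let d := ln 5 / ln 7 in
        [/\ hausdorff_dim (msupport nu) = d%:E,
            `|d - 827 / 1000| <= 5 / 10 ^+ 4,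
            (lindelof (cantor_L F nu) (1 / 2) <=
               ((1 - d) / (2 * (2 - d)))%:E)%E &
            (1 - d) / (2 * (2 - d)) <= 738 / 10 ^+ 4] ].
Proof.
have h1329 : dstar (13 / 84) = 16 / 29 :> R by rewrite /dstar; field.
split.
- move=> mu hmu nu hnu; cbv zeta; case: ifP => _; last exact: (hurwitz_branch hF hzeta hmu hnu).
  by rewrite /cantor_dim; case: hnu => [/(ternary_facts hF)|/(quinary_facts hF)] [_ -> h].
- by split => //; rewrite ler_norml; apply/andP; split; lra.
- move=> nu hnu d; have [d1 hd hL] := ternary_facts hF hnu.
  have /andP[l u] := ternary_dim_bounds R; rewrite -/d in d1 l u.
  have d2 : d < 2 by lra.
  have e1 : (1 - d) / (2 * (2 - d)) <= 24 / 178.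
    by apply: le_trans (decreasing_exponent (ltW l) d2) _; rewrite le_eqVlt; apply/orP; left; apply/eqP; field.
  have e2 : 31 / 230 <= (1 - d) / (2 * (2 - d)).
    apply: le_trans (decreasing_exponent (ltW u) _); last by lra.
    by rewrite le_eqVlt; apply/orP; left; apply/eqP; field.
  split => //.
  + by rewrite ler_norml; apply/andP; split; lra.
  + by rewrite h1329; lra.
  + by rewrite ler_norml; move: e1 e2; set x := (1 - d) / _ => e1 e2; apply/andP; split; lra.
- move=> nu hnu d; have [d1 hd hL] := quinary_facts hF hnu.
  have /andP[l u] := quinary_dim_bounds R; rewrite -/d in d1 l u.
  have d2 : d < 2 by lra.
  have e1 : (1 - d) / (2 * (2 - d)) <= 9 / 122.
    by apply: le_trans (decreasing_exponent (ltW l) d2) _; rewrite le_eqVlt; apply/orP; left; apply/eqP; field.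
  split => //.
  + by rewrite ler_norml; apply/andP; split; lra.
  + by apply: le_trans e1 _; lra.
Qed.
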